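(* Let $V$ be a $C_\infty$-algebra and put $P:=\prod_{i=1}^\infty(\Sigma V^* )^{\hat\otimes i}$. (i) The bar complex $C^\bullet_{\mathrm{Bar}}(V)=(\Sigma P,b')$ splits as the direct product of the subcomplexes $\Sigma(e(j)[P])$: $$C^\bullet_{\mathrm{Bar}}(V)=\prod_{j=1}^\infty\bigl(\Sigma(e(j)[P]),b'\bigr).$$ (ii) The Hochschild complex of $V$ with coefficients in $V^*$ (identified with $(\Sigma P,b)$ via the isomorphism $\Theta$) splits as the direct product of the subcomplexes $\Sigma(\tilde e(j)[P])$: $$C^\bullet_{\mathrm{Hoch}}(V,V^* )=\prod_{j=0}^\infty\bigl(\Sigma(\tilde e(j)[P]),b\bigr).$$
   Context: Conventions. $\mathbb K$ is an evenly graded commutative ring containing $\mathbb Q$; all modules are graded $\mathbb K$-modules obtained by extension of scalars from vector spaces over a subfield $k\subset\mathbb K$; gradings are cohomological and the Koszul sign rule is used. $(\Sigma V)^i:=V^{i+1}$, and $\Sigma V^*$ means $\mathrm{Hom}_{\mathbb K}(\Sigma V,\mathbb K)$. A profinite module is an inverse limit of free modules of finite rank with the inverse limit topology (e.g. the dual of a free module); $\hat\otimes$ is the completed tensor product; ''linear combinations'' in profinite modules are convergent and possibly infinite. For $W$ profinite, $\widehat TW:=\prod_{i\ge0}W^{\hat\otimes i}$ and $\widehat LW\subset\widehat TW$ is the Lie subalgebra (under the graded commutator) of all convergent linear combinations of Lie monomials. A vector field is a continuous derivation. $C_\infty$-algebras. A $C_\infty$-structure on a free graded module $V$ is a continuous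 derivation $m$ of degree one of the Lie algebra $\widehat L\Sigma V^*$ with $m^2=0$; $V$ with $m$ is a $C_\infty$-algebra. Such $m$ extends uniquely to a continuous derivation $m$ of the associative algebra $\widehat T\Sigma V^*$. Forms. $\Omega^\bullet_{\mathrm{Ass}}(\widehat TW)$ is the (formal) differential envelope of $\widehat TW$: the pro-free associative algebra on $W\oplus dW$ ($dW$ a copy of $W$ with degrees raised by one), with the continuous derivation $d$ of degree $1$, $d(w)=dw$, $d^2=0$; it is bigraded (number of $d$'s, internal degree). $DR^\bullet_{\mathrm{Ass}}(\widehat TW)=\Omega^\bullet_{\mathrm{Ass}}/[\Omega^\bullet_{\mathrm{Ass}},\Omega^\bullet_{\mathrm{Ass}}]$ (graded commutators), and $DR^1_{\mathrm{Ass}}$ is its part with one $d$, regraded so that $x\,dy$ has degree $|x|+|y|$. For a vector field $\xi$, the Lie derivative $L_\xi$ is the derivation of $\Omega^\bullet_{\mathrm{Ass}}$ with $L_\xi(x)=\xi(x)$, $L_\xi(dx)=(-1)^{|\xi|}d(\xi(x))$; it descends to $DR^\bullet_{\mathrm{Ass}}$. There is an isomorphism $\Theta: W\hat\otimes\widehat TW=\prod_{i\ge1}W^{\hat\otimes i}\to DR^1_{\mathrm{Ass}}(\widehat TW)$, $x\hat\otimes y\mapsto dx\cdot y$. Complexes. With $P=\prod_{i\ge1}(\Sigma V^* )^{\hat\otimes i}$: $b':P\to P$ is the restriction of $m$ to $P\subset\widehat T\Sigma V^*$, and the bar complex is $C^\bullet_{\mathrm{Bar}}(V)=(\Sigma P,b')$.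 The Hochschild complex with coefficients in $V^*$ is $C^\bullet_{\mathrm{Hoch}}(V,V^* )=(\Sigma DR^1_{\mathrm{Ass}}(\widehat T\Sigma V^* ),L_m)$; $b:=\Theta^{-1}L_m\Theta:P\to P$, so it is isomorphic to $(\Sigma P,b)$. Projections. Let $\mu$ be the multiplication of $\widehat TW$ and $\Delta:\widehat TW\to\widehat TW\hat\otimes\widehat TW$ the continuous algebra homomorphism with $\Delta(w)=w\otimes1+1\otimes w$ for $w\in W$. The modified shuffle operator is $s:=\mu\Delta$, with components $s_n:W^{\hat\otimes n}\to W^{\hat\otimes n}$. With $\lambda_i:=2^i$, set $e_n(j):=\bigl[\prod_{0\le r\le n,r\ne j}(\lambda_j-\lambda_r)\bigr]^{-1}\prod_{0\le r\le n,r\ne j}(s_n-\lambda_r\mathrm{id})$ for $0\le j\le n$ and $e_n(j):=0$ for $j>n$; $e(j):\widehat TW\to\widehat TW$ has components $e_n(j)$. Under $\prod_{i\ge1}W^{\hat\otimes i}=W\hat\otimes\widehat TW$ put $\tilde e(j):=1\hat\otimes e(j)$. Here $W=\Sigma V^*$. *)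

(* Defs.v *)
From HB Require Import structures.
From mathcomp Require Import all_boot all_order all_algebra.
From mathcomp Require Import all_classical topology sequences.

Set Implicit Arguments.
Unset Strict Implicit.
Unset Printing Implicit Defensive.

Import Order.TTheory GRing.Theory Num.Theory.

Local Open Scope classical_set_scope.
Local Open Scope ring_scope.

(* Conventions.
   A graded module is the family of its homogeneous pieces, so limits, infinite
   products and continuity are taken degree by degree.  The graded profinite
   modules considered here are duals of free graded modules, hence of the form
   K^S with S a homogeneous topological basis and degrees deg : S -> int.  Their
   elements are functions S -> K, f standing for the convergent sum of the
   f s . s; completed tensor products are obtained by multiplying bases, e.g.
   T^ W has as basis the words in a basis of W.  Only homogeneous functions (hom
   below) are elements of the graded module; the maps are defined on all
   functions, but their values elsewhere are irrelevant. *)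

Definition koszul (p : int) : rat := (-1) ^+ `|p|%N.

Record even_grading (K : comAlgType rat) (gr : int -> set K) : Prop := {
  gr_zero : forall p, gr p 0;
  gr_sub : forall p x y, gr p x -> gr p y -> gr p (x - y);
  gr_one : gr 0 1;
  gr_mul : forall p q x y, gr p x -> gr q y -> gr (p + q) (x * y);
  gr_span : forall x, exists (s : seq int) (c : int -> K),
    (forall p, gr p (c p)) /\ x = \sum_(p <- s) c p;
  gr_indep : forall (s : seq int) (c : int -> K), uniq s ->
    (forall p, gr p (c p)) -> \sum_(p <- s) c p = 0 ->
    forall p, p \in s -> c p = 0;
  gr_odd : forall p x, odd `|p|%N -> gr p x -> x = 0
}.

(* Product topology; it is the inverse limit topology of the finite subproducts,
   K itself being discrete. *)
Definition pro (K : choiceType) (S : Type) : topologicalType :=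
  prod_topology (fun _ : S => discrete_topology K).

Definition continuous_on (T U : topologicalType) (A : set T) (f : T -> U) : Prop :=
  {within A, continuous f}.

Section Profinite.
Context (K : comAlgType rat) (gr : int -> set K).

Definition hom (S : Type) (deg : S -> int) (n : int) : set (S -> K) :=
  [set f | forall s, gr (n - deg s) (f s)].

Definition scale (S : Type) (c : K) (f : S -> K) : S -> K := fun s => c * f s.

Definition elt (S : eqType) (s : S) : S -> K := fun t => (s == t)%:R.

(* The continuous linear map with value phi s at the basis element s. *)
Definition cext (S : choiceType) (T : Type) (phi : S -> T -> K) (f : S -> K) :
    T -> K :=
  fun t => \sum_(s \in [set: S]) f s * phi s t.

(* All convergent, possibly infinite, linear combinations of elements of B. *)
Definition cspan (S : Type) (B : set (S -> K)) : set (S -> K) :=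
  [set f | exists (A : choiceType) (c : A -> K) (l : A -> S -> K),
    [/\ forall a, B (l a),
        forall s, finite_set [set a | c a * l a s != 0] &
        forall s, f s = \sum_(a \in [set: A]) c a * l a s]].

(* K is concentrated in even degrees: K-linear maps of any degree satisfy
   F (c f) = c (F f) without sign. *)
Definition graded_linear (S T : Type) (C : int -> set (S -> K))
    (F : (S -> K) -> (T -> K)) : Prop :=
  (forall n f g, C n f -> C n g -> F (f + g) = F f + F g) /\
  (forall p n c f, gr p c -> C n f -> F (scale c f) = scale c (F f)).

Definition graded_submodule (S : Type) (C : int -> set (S -> K)) : Prop :=
  [/\ forall n, C n 0,
      forall n f g, C n f -> C n g -> C n (f - g) &
      forall p n c f, gr p c -> C n f -> C (p + n) (scale c f)].

Definition cochain_complex (S : Type) (C : int -> set (S -> K))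
    (d : (S -> K) -> (S -> K)) : Prop :=
  [/\ graded_submodule C,
      graded_linear C d,
      forall n f, C n f -> C (n + 1) (d f) &
      forall n f, C n f -> d (d f) = 0].

Definition Sigma (S : Type) (C : int -> set (S -> K)) : int -> set (S -> K) :=
  fun n => C (n + 1).

(* (C, d) is the direct product of its subcomplexes (D j, d): in each degree,
   (x_j)_j |-> \sum_j x_j is a well defined bicontinuous bijection from the
   product of the D j onto C. *)
Definition splits_as_product (S : Type) (C : int -> set (S -> K))
    (d : (S -> K) -> (S -> K)) (D : nat -> int -> set (S -> K)) : Prop :=
  [/\ cochain_complex C d,
      forall j, cochain_complex (D j) d /\ (forall n, D j n `<=` C n) &
      forall n, exists Phi : (nat -> S -> K) -> (S -> K),
        let E := [set x : nat -> S -> K | forall j, D j n (x j)] in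
        [/\ forall x, E x -> (series x : nat -> pro K S) @ \oo --> (Phi x : pro K S),
            set_bij E (C n) Phi,
            @continuous_on (prod_topology (fun _ : nat => pro K S)) (pro K S) E Phi &
            @continuous_on (pro K S) (prod_topology (fun _ : nat => pro K S)) (C n)
              (pinv_ (fun=> 0) E Phi)]].

End Profinite.

Section TensorAlgebra.
Context (K : comAlgType rat) (gr : int -> set K).
Context (X : choiceType) (deg : X -> int).

Definition wdeg (w : seq X) : int := \sum_(x <- w) deg x.

Definition mul (f g : seq X -> K) : seq X -> K :=
  fun w => \sum_(k < (size w).+1) f (take k w) * g (drop k w).

Definition gcomm (p q : int) (f g : seq X -> K) : seq X -> K :=
  mul f g - koszul (p * q) *: mul g f.

(* Value on the word w of the derivation of degree e with value phi x at the
   generator x. *)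
Fixpoint der_word (e : int) (phi : X -> seq X -> K) (w : seq X) : seq X -> K :=
  if w is x :: u then
    mul (phi x) (elt K u)
      + koszul (e * deg x) *: mul (elt K [:: x]) (der_word e phi u)
  else 0.

(* The continuous derivation of degree e of T^ W extending phi. *)
Definition der (e : int) (phi : X -> seq X -> K) : (seq X -> K) -> (seq X -> K) :=
  cext (der_word e phi).

Definition Wpart (n : int) : set (seq X -> K) :=
  [set f | hom gr wdeg n f /\ (forall w, size w != 1%N -> f w = 0)].

(* Homogeneous Lie monomials, with their degree. *)
Inductive lie_monomial : int -> (seq X -> K) -> Prop :=
| lie_gen n f : Wpart n f -> lie_monomial n f
| lie_bracket p q f g : lie_monomial p f -> lie_monomial q g ->
    lie_monomial (p + q) (gcomm p q f g).

(* Degree n part of L^ W. *)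
Definition Lie (n : int) : set (seq X -> K) :=
  hom gr wdeg n `&` cspan [set f | exists p, lie_monomial p f].

(* Degree n part of [A, A] for A = T^ W, spanned by the graded commutators. *)
Definition commutators (n : int) : set (seq X -> K) :=
  hom gr wdeg n `&` cspan [set h | exists p q f g,
    [/\ hom gr wdeg p f, hom gr wdeg q g & h = gcomm p q f g]].

(* T^ W (x)^ T^ W, with basis the pairs of words and product
   (a (x) b)(a' (x) b') = (-1)^(|b||a'|) aa' (x) bb'. *)
Definition mul2 (F G : seq X * seq X -> K) : seq X * seq X -> K :=
  fun p => \sum_(k < (size p.1).+1) \sum_(l < (size p.2).+1)
    koszul (wdeg (take l p.2) * wdeg (drop k p.1)) *:
      (F (take k p.1, take l p.2) * G (drop k p.1, drop l p.2)).

(* The continuous algebra map with w |-> w (x) 1 + 1 (x) w on W. *)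
Definition Delta : (seq X -> K) -> (seq X * seq X -> K) :=
  cext (fun w => \big[mul2/elt K ([::], [::])]_(x <- w)
                   (elt K ([:: x], [::]) + elt K ([::], [:: x]))).

Definition mu : (seq X * seq X -> K) -> (seq X -> K) :=
  cext (fun p => elt K (p.1 ++ p.2)).

Definition shuffle : (seq X -> K) -> (seq X -> K) := mu \o Delta.

Definition lambda (i : nat) : rat := 2 ^+ i.

(* e_n(j); shuffle preserves the length n of words, so that s_n is the
   restriction of shuffle. *)
Definition e_comp (n j : nat) (f : seq X -> K) : seq X -> K :=
  if (j <= n)%N then
    (\prod_(0 <= r < n.+1 | r != j) (lambda j - lambda r))^-1 *:
      (\big[(fun F G => F \o G)/id]_(0 <= r < n.+1 | r != j)
         (fun g : seq X -> K => shuffle g - lambda r *: g)) f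
  else 0.

Definition tpart (n : nat) (f : seq X -> K) : seq X -> K :=
  fun w => if size w == n then f w else 0.

Definition e_idem (j : nat) (f : seq X -> K) : seq X -> K :=
  fun w => e_comp (size w) j (tpart (size w) f) w.

(* 1 (x)^ e(j) on W (x)^ T^ W, the word x :: u being x (x) u. *)
Definition et_idem (j : nat) : (seq X -> K) -> (seq X -> K) :=
  cext (fun w => if w is x :: u then mul (elt K [:: x]) (e_idem j (elt K u))
                 else 0).

(* Degree n part of \prod_(i >= 1) W^{(x) i}. *)
Definition P (n : int) : set (seq X -> K) :=
  [set f | hom gr wdeg n f /\ f [::] = 0].

Definition gimage (F : (seq X -> K) -> (seq X -> K)) (C : int -> set (seq X -> K)) :
    int -> set (seq X -> K) :=
  fun n => F @` C n.

(* m is a continuous derivation of degree one of the Lie algebra L^ W with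
   square zero. *)
Record square_zero_lie_derivation (m : (seq X -> K) -> (seq X -> K)) : Prop := {
  sld_deg : forall n f, Lie n f -> Lie (n + 1) (m f);
  sld_linear : graded_linear gr Lie m;
  sld_continuous : forall n,
    @continuous_on (pro K (seq X)) (pro K (seq X)) (Lie n) m;
  sld_leibniz : forall p q f g, Lie p f -> Lie q g ->
    m (gcomm p q f g) = gcomm (p + 1) q (m f) g + koszul p *: gcomm p (q + 1) f (m g);
  sld_square : forall n f, Lie n f -> m (m f) = 0
}.

(* The continuous derivation of T^ W extending the derivation m of L^ W. *)
Definition assoc_ext (m : (seq X -> K) -> (seq X -> K)) :
    (seq X -> K) -> (seq X -> K) :=
  der 1 (fun x => m (elt K [:: x])).

End TensorAlgebra.

Section Forms.
Context (K : comAlgType rat) (gr : int -> set K).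
Context (X : choiceType) (deg : X -> int).

(* Basis of W (+) dW: inl x is x and inr x is dx. *)
Definition odeg (z : X + X) : int :=
  match z with inl x => deg x | inr x => deg x + 1 end.

Definition to_form : (seq X -> K) -> (seq (X + X) -> K) :=
  cext (fun w => elt K (map inl w)).

Definition dform : (seq (X + X) -> K) -> (seq (X + X) -> K) :=
  der odeg 1 (fun z => if z is inl x then elt K [:: inr x] else 0).

(* The Lie derivative along the vector field xi of degree e. *)
Definition Lie_der (e : int) (xi : (seq X -> K) -> (seq X -> K)) :
    (seq (X + X) -> K) -> (seq (X + X) -> K) :=
  der odeg e (fun z =>
    match z with
    | inl x => to_form (xi (elt K [:: x]))
    | inr x => koszul e *: dform (to_form (xi (elt K [:: x])))
    end).

(* Theta, with values in representatives: x (x) y |-> dx . y. *)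
Definition Theta : (seq X -> K) -> (seq (X + X) -> K) :=
  cext (fun w => if w is x :: u then elt K (inr x :: map inl u) else 0).

(* Inverse of Theta : P -> DR^1, on representatives.  Theta raises by one the
   degree of Omega (DR^1 is regraded by |x dy| = |x| + |y| to compensate). *)
Definition Theta_inv (h : seq (X + X) -> K) : seq X -> K :=
  xget 0 [set f | exists n, P gr deg n f /\ commutators gr odeg (n + 1) (h - Theta f)].

Section Hochschild.
Context (m : (seq X -> K) -> (seq X -> K)).

Definition L_m : (seq (X + X) -> K) -> (seq (X + X) -> K) :=
  Lie_der 1 (assoc_ext deg m).

Definition hoch_b : (seq X -> K) -> (seq X -> K) :=
  fun f => Theta_inv (L_m (Theta f)).

Definition is_d (z : X + X) : bool := if z is inr _ then true else false.

(* Forms with one d; DR^1 is the quotient of Omega1 by the commutators in it. *)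
Definition Omega1 (n : int) : set (seq (X + X) -> K) :=
  [set h | hom gr (wdeg odeg) n h /\ (forall w, count is_d w != 1%N -> h w = 0)].

(* Theta identifies (Sigma P, b) with C_Hoch(V, V^* ) = (Sigma DR^1, L_m). *)
Record Theta_identifies_Hoch : Prop := {
  hoch_Theta : forall n f, P gr deg n f -> Omega1 (n + 1) (Theta f);
  hoch_inj : forall n f, P gr deg n f ->
    commutators gr odeg (n + 1) (Theta f) -> f = 0;
  hoch_surj : forall n h, Omega1 (n + 1) h ->
    exists2 f, P gr deg n f & commutators gr odeg (n + 1) (h - Theta f);
  hoch_descends : forall n h, Omega1 n h -> commutators gr odeg n h ->
    Omega1 (n + 1) (L_m h) /\ commutators gr odeg (n + 1) (L_m h);
  hoch_intertwines : forall n f, P gr deg n f ->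
    commutators gr odeg (n + 1 + 1) (L_m (Theta f) - Theta (hoch_b f))
}.

End Hochschild.
End Forms.

(* Degrees of the basis of Sigma V^* dual to a basis of V with degrees degV. *)
Definition dual_susp (I : Type) (degV : I -> int) : I -> int :=
  fun i => 1 - degV i.

Definition C_infty_structure (K : comAlgType rat) (gr : int -> set K)
    (I : choiceType) (degV : I -> int) (m : (seq I -> K) -> (seq I -> K)) : Prop :=
  square_zero_lie_derivation gr (dual_susp degV) m.

(* Main.v *)
Require Import Defs.
From mathcomp Require Import all_boot all_order all_algebra all_classical.
From mathcomp Require Import topology sequences ring.
Require Import Defs.

(** The operator [s = mu o Delta] is the convolution square of the identity of
    the tensor algebra [T], and the [e(j)] are its spectral projections.  If
    [l_1, ..., l_k] are Lie elements, hence primitive, then [Delta (l_1 ...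
    l_k)] is the product of the [l_i (x) 1 + 1 (x) l_i], so that [s (l_1 ...
    l_k)] is a signed sum of [2^k] reorderings of [l_1 ... l_k]; a reordering
    only costs commutators, which are products of fewer Lie elements.  Thus [s -
    2^k] lowers by one the filtration by the number of Lie factors
    ([shuffle_lie_fil]).  A word of length [n > 0] is a product of [n] letters,
    so [(s - 2) ... (s - 2^n)] kills it ([shift_prod_positive]).  Hence [s] is
    diagonalizable in each length, [e(j)] is the Lagrange projector onto the
    eigenspace of [2^j] ([e_idem_eigen], [e_idem_of_eigen], [e_idem_sum]), and
    [e(0)] vanishes on words of positive length.

    The eigenvalue [2^j] is the same in all lengths, whereas a differential may
    raise the length.  Therefore a differential that commutes with [s] preserves
    every eigenspace, and the complex is the direct product of the eigenspaces;
    the product converges because [e(j)] vanishes on words shorter than [j]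
    ([splitting]).

    For the bar complex, the values of [m] on generators are Lie elements, hence
    primitive, and a derivation with primitive values on generators is also a
    coderivation; it commutes with [Delta] and with [mu], hence with [s]
    ([der_shuffle]).

    For the Hochschild complex, a one-form is brought to the form [dx . u]
    modulo commutators by rotating [dx] to the front.  This normal form is a
    trace because the sum over all signed rotations of a word is one
    ([rotation_sum_trace]); it inverts [Theta] and computes [b].  In this form
    [b] sends [x (x) u] to [- d(m x) . u] plus or minus [x (x) m u].  The second
    term commutes with [1 (x) s] as before.  For the first one, the trace
    property turns [d [l1, l2] . u] into [d l1 . [l2, u]] and [d l2 . [l1, u]]
    ([dmul_class_gcomm]), so for [l] in the Lie algebra [d l . u] is built from
    [u] by adjoint actions of Lie elements; these are derivations with Lie
    values, so they commute with [s] too ([shuffle_ad], [hoch_shuffle1]).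

    Infinite sums are controlled by two notions: continuous linear maps on the
    homogeneous functions of one degree ([cts_linear]), which are determined by
    their values on the basis, and maps of which every coordinate depends on
    finitely many coordinates of an arbitrary argument ([local_linear]). *)

Set Implicit Arguments.
Unset Strict Implicit.
Unset Printing Implicit Defensive.

Import Order.TTheory GRing.Theory Num.Theory.

Local Open Scope classical_set_scope.
Local Open Scope ring_scope.

(** * Signs and homogeneous components *)

(** Koszul signs only depend on parities, and parity is a ring homomorphism to
    the booleans; sign identities are then checked by cases. *)
Definition podd (p : int) : bool := odd `|p|%N.

Lemma koszulE p : koszul p = (-1) ^+ podd p.
Proof. by rewrite /koszul /podd signr_odd. Qed.

Lemma poddN p : podd (- p) = podd p.
Proof. by rewrite /podd abszN. Qed.

Lemma poddD p q : podd (p + q) = podd p (+) podd q.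
Proof.
wlog: p q / 0 <= p.
  move=> H; have [/H//|p0] := leP 0 p.
  by rewrite -poddN opprD H ?poddN// oppr_ge0 ltW.
case: p => // p _; case: q => q; first by rewrite /podd -PoszD !absz_nat oddD.
rewrite NegzE poddN /podd; have [pq|pq] := leqP q.+1 p.
  by rewrite subzn// !absz_nat oddB.
by rewrite -opprB subzn 1?ltnW// abszN !absz_nat oddB 1?ltnW// addbC.
Qed.

Lemma poddM p q : podd (p * q) = podd p && podd q.
Proof. by rewrite /podd abszM oddM. Qed.

Definition poddE := (poddD, poddM, poddN).

Lemma podd0 : podd 0 = false. Proof. by []. Qed.
Lemma podd1 : podd 1 = true. Proof. by []. Qed.

Ltac koszul_sign := rewrite ?koszulE ?poddE ?podd1 ?podd0;
  repeat match goal with |- context [podd ?p] => case: (podd p) end;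
  rewrite /= ?expr0 ?expr1 ?mulr1 ?mul1r ?mulrN ?mulNr ?mulr1 ?opprK.

Lemma koszul0 : koszul 0 = 1. Proof. by koszul_sign. Qed.

Lemma koszul_sq p : koszul p * koszul p = 1.
Proof. by koszul_sign. Qed.

Section Grading.
Context (K : comAlgType rat) (gr : int -> set K) (hK : even_grading gr).

Lemma grB p x y : gr p x -> gr p y -> gr p (x - y).
Proof. exact: gr_sub hK _ _ _. Qed.
Lemma gr0 p : gr p 0. Proof. exact: gr_zero hK _. Qed.
Lemma grN p x : gr p x -> gr p (- x).
Proof. by move=> hx; rewrite -[- x]add0r; apply: grB => //; apply: gr0. Qed.
Lemma grD p x y : gr p x -> gr p y -> gr p (x + y).
Proof. by move=> hx hy; rewrite -[y]opprK; apply: grB => //; apply: grN. Qed.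
Lemma gr_sum p (I : Type) (r : seq I) (Q : pred I) (F : I -> K) :
  (forall i, Q i -> gr p (F i)) -> gr p (\sum_(i <- r | Q i) F i).
Proof. by move=> h; apply: big_rec => [|i x /h hi hx]; [apply: gr0|apply: grD]. Qed.

(** Repeated degrees are merged, so that the components form a function of the
    degree with finite support. *)
Lemma gr_decompose x : exists c : int -> K, (forall p, gr p (c p)) /\
  exists s : seq int, [/\ uniq s, forall p, p \notin s ->
    c p = 0 & x = \sum_(p <- s) c p].
Proof.
have [s [c [hc ->]]] := gr_span hK x; elim: s => [|p s [c' [hc' [s' [us hs e]]]]].
  exists (fun=> 0); split; first exact: gr0.
  by exists [::]; rewrite !big_nil.
exists (fun q => c' q + (if q == p then c p else 0)); split.
  by move=> q; apply: grD => //; case: eqP => [->|_] //; apply: gr0.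
rewrite big_cons e.
have [ps|ps] := boolP (p \in s').
  exists s'; split => // [q qs|].
    by rewrite hs//; case: eqP qs ps => [->/negP//|_ _ _]; rewrite addr0.
  rewrite big_split/= addrC; congr (_ + _).
  by rewrite (bigD1_seq p)//= eqxx big1 ?addr0// => q /negPf->.
exists (p :: s'); split => /=; first by rewrite ps.
  by move=> q; rewrite inE negb_or => /andP[/negPf-> /hs->]; rewrite addr0.
rewrite big_cons eqxx hs// add0r; congr (_ + _).
by rewrite !big_seq; apply: eq_bigr => q qs; case: eqP ps qs => [->/negP//|];
  rewrite addr0.
Qed.

Lemma sum_support (s s' r : seq int) (g : int -> K) : uniq r ->
  (forall q, q \notin r -> g q = 0) -> {subset r <= undup (s ++ s')} ->
  \sum_(q <- undup (s ++ s')) g q = \sum_(q <- r) g q.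
Proof.
move=> ur g0 sub; rewrite (bigID (fun q => q \in r))/= [X in _ + X]big1 ?addr0//.
rewrite -big_filter; apply: perm_big; apply: uniq_perm => //.
  by rewrite filter_uniq// undup_uniq.
move=> q; rewrite mem_filter; apply/andP/idP => [[]//|qr]; split=> //; exact: sub.
Qed.

(** The homogeneous component of degree [d]. *)
Definition gpart (d : int) (x : K) : K := projT1 (cid (gr_decompose x)) d.

Lemma gr_gpart d x : gr d (gpart d x).
Proof. by rewrite /gpart; case: cid => c [hc _] /=. Qed.

Lemma gpart_uniq (x : K) (c : int -> K) (s : seq int) : uniq s ->
  (forall p, gr p (c p)) -> (forall p, p \notin s -> c p = 0) ->
    x = \sum_(p <- s) c p ->
  forall p, gpart p x = c p.
Proof.
move=> us hc cs e p; rewrite /gpart; case: cid => c' [hc' [s' [us' cs' e']]] /=.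
have ext := @sum_support s s'.
have := @gr_indep _ _ hK (undup (s ++ s')) (fun q => c' q - c q) (undup_uniq _).
have h1 q : gr q (c' q - c q) by apply: grB.
move=> /(_ h1); rewrite sumrB (ext s' c')// ?(ext s c)//; last 2 first.
- by move=> q qs; rewrite mem_undup mem_cat qs.
- by move=> q qs; rewrite mem_undup mem_cat qs orbT.
rewrite -e' -e subrr => /(_ erefl) h.
apply/subr0_eq; have [/h//|ps] := boolP (p \in undup (s ++ s')).
move: ps; rewrite mem_undup mem_cat negb_or => /andP[ps ps'].
by rewrite cs// cs'// subrr.
Qed.

Lemma gpart_id p x : gr p x -> gpart p x = x.
Proof.
move=> hx; rewrite (@gpart_uniq x (fun q => if q == p then x else 0) [:: p])//.
- by rewrite eqxx.
- by move=> q; case: eqP => [->//|_]; apply: gr0.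
- by move=> q; rewrite inE => /negPf->.
- by rewrite big_seq1 eqxx.
Qed.

Lemma gpart_other p q x : gr p x -> q != p -> gpart q x = 0.
Proof.
move=> hx /negPf qp; rewrite (@gpart_uniq x (fun q =>
  if q == p then x else 0) [:: p]) ?qp//.
- by move=> r; case: eqP => [->//|_]; apply: gr0.
- by move=> r; rewrite inE => /negPf->.
- by rewrite big_seq1 eqxx.
Qed.

Lemma gpartD p x y : gpart p (x + y) = gpart p x + gpart p y.
Proof.
have [c [hc [s [us cs ->]]]] := gr_decompose x.
have [c' [hc' [s' [us' cs' ->]]]] := gr_decompose y.
rewrite [in RHS](@gpart_uniq _ c s)// [in RHS](@gpart_uniq _ c' s')//.
have ext := @sum_support s s'.
rewrite (@gpart_uniq _ (fun q => c q + c' q) (undup (s ++ s')))// ?undup_uniq//.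
- by move=> q; apply: grD.
- by move=> q; rewrite mem_undup mem_cat negb_or => /andP[/cs-> /cs'->]; rewrite addr0.
- rewrite big_split/= (ext s c)// ?(ext s' c')// => q qs;
  rewrite mem_undup mem_cat qs// orbT//.
Qed.

Lemma gpart0 p : gpart p 0 = 0.
Proof. by rewrite gpart_id//; apply: gr0. Qed.

Lemma gpart_sum p (I : Type) (r : seq I) (F : I -> K) :
  gpart p (\sum_(i <- r) F i) = \sum_(i <- r) gpart p (F i).
Proof.
by elim: r => [|i r IH]; rewrite ?big_nil ?gpart0// !big_cons gpartD IH.
Qed.

(** Multiplication by a homogeneous element shifts the decomposition, and
    decompositions are unique. *)
Lemma gpartM p q x y : gr q y -> gpart p (x * y) = gpart (p - q) x * y.
Proof.
move=> hy; have [c [hc [s [us cs e]]]] := gr_decompose x.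
rewrite (@gpart_uniq x c s)// e mulr_suml.
rewrite (@gpart_uniq _ (fun r => c (r - q) * y) (map (fun r => r + q) s))//.
- by rewrite map_inj_uniq//; apply: addIr.
- by move=> r; rewrite -{1}[r](subrK q); apply: gr_mul.
- move=> r /negP hr; rewrite cs ?mul0r//; apply/negP => h; apply: hr.
  by apply/mapP; exists (r - q) => //; rewrite subrK.
- by rewrite big_map; apply: eq_bigr => r _; rewrite addrK.
Qed.

(** The grading is only assumed to be additive.  For an integer [n], the
    components of [x / n] in the degrees other than that of [x] are killed by
    [n], hence vanish. *)
Lemma grZ p (a : rat) x : gr p x -> gr p (a *: x).
Proof.
move=> hx.
have grMn n y : gr p y -> gr p (y *+ n).
  by move=> hy; elim: n => [|n IH]; rewrite ?mulrS ?mulr0n; [apply: gr0|apply: grD].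
have gpMn q n y : gpart q (y *+ n) = gpart q y *+ n.
  by elim: n => [|n IH]; rewrite ?mulr0n ?gpart0// !mulrS gpartD IH.
have [n en] : exists n : nat, denq a = n%:Z.
  by exists `|denq a|%N; rewrite absz_denq.
have n0 : (n%:R : rat) != 0.
  by rewrite pnatr_eq0 -lt0n -ltz_nat -en denq_gt0.
set y := a *: x; have hy : gr p (y *+ n).
  have -> : y *+ n = (numq a)%:~R *: x.
    by rewrite /y -scaler_nat scalerA numqE en mulrC.
  by rewrite scaler_int; case: (numq a) => k /=; [|apply: grN]; apply: grMn.
have hq q : q != p -> gpart q y = 0.
  move=> qp; have := gpMn q n y; rewrite (gpart_other hy)// -scaler_nat => h.
  by rewrite -[LHS](scalerK n0) -h scaler0.
have [c [hc [s [us cs e]]]] := gr_decompose y.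
have cq q : q != p -> c q = 0 by move=> /hq; rewrite (@gpart_uniq y c s).
by rewrite e; apply: gr_sum => q _; have [->//|/cq->] := eqVneq q p; exact: gr0.
Qed.

End Grading.

(** * Continuous linear maps on functions on a basis *)

Section Maps.
Context (K : comAlgType rat) (gr : int -> set K) (hK : even_grading gr).

Section Hom.
Context (S : choiceType) (d : S -> int).
Implicit Types (f g : S -> K).

Lemma hom0 n : hom gr d n (0 : S -> K).
Proof. by move=> s; apply: gr0. Qed.
Lemma homD n f g : hom gr d n f -> hom gr d n g -> hom gr d n (f + g).
Proof. by move=> hf hg s; apply: grD. Qed.
Lemma homB n f g : hom gr d n f -> hom gr d n g -> hom gr d n (f - g).
Proof. by move=> hf hg s; apply: grB. Qed.
Lemma homZ n (a : rat) f : hom gr d n f -> hom gr d n (a *: f).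
Proof. by move=> hf s; apply: grZ. Qed.
Lemma hom_scale p n c f : gr p c -> hom gr d n f -> hom gr d (p + n) (scale c f).
Proof. by move=> hc hf s; rewrite /scale -addrA; apply: gr_mul. Qed.
Lemma hom_sum n (I : Type) (r : seq I) (F : I -> S -> K) :
  (forall i, hom gr d n (F i)) -> hom gr d n (\sum_(i <- r) F i).
Proof. by move=> h; apply: big_ind => *; [apply: hom0|apply: homD|apply: h]. Qed.
Lemma hom_elt s : hom gr d (d s) (elt K s).
Proof.
move=> t; rewrite /elt; case: eqP => [->|_]; rewrite ?subrr; last exact: gr0.
exact: gr_one.
Qed.
Lemma hom_scale_elt n s c : gr (n - d s) c -> hom gr d n (scale c (elt K s)).
Proof. by move=> hc; rewrite -[n](subrK (d s)); apply: hom_scale => //;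
  apply: hom_elt. Qed.

(** Since [K] is even, a coefficient whose degree has the parity opposite to
    that expected vanishes: the Koszul sign of a homogeneous function can be
    read off at each basis element. *)
Lemma koszul_hom n p x r : gr (n - p) x -> koszul (n * r) *: x = koszul (p * r) *: x.
Proof.
move=> hx; have [o|o] := boolP (podd (n - p)).
  by rewrite (gr_odd hK o hx) !scaler0.
congr (_ *: _); rewrite !koszulE !poddM; move: o; rewrite !poddE.
by case: (podd n); case: (podd p).
Qed.
End Hom.

Section Scale.
Context (S : Type).
Lemma scale1 (f : S -> K) : scale 1 f = f.
Proof. by apply/funext => s; rewrite /scale mul1r. Qed.
Lemma scaler_fun (c : K) : scale c (0 : S -> K) = 0.
Proof. by apply/funext => s; rewrite /scale mulr0. Qed.
Lemma scaleD c (f g : S -> K) : scale c (f + g) = scale c f + scale c g.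
Proof. by apply/funext => s; rewrite /scale mulrDr. Qed.
Lemma scaleB c (f g : S -> K) : scale c (f - g) = scale c f - scale c g.
Proof. by apply/funext => s; rewrite /scale mulrBr. Qed.
Lemma scaleZ c a (f : S -> K) : scale c (a *: f) = a *: scale c f.
Proof. by apply/funext => s; rewrite /scale -scalerAr. Qed.
Lemma scale_rat a (f : S -> K) : a *: f = scale a%:A f.
Proof. by apply/funext => s; rewrite /scale -scalerAl mul1r. Qed.
End Scale.

Lemma gr_rat (a : rat) : gr 0 a%:A.
Proof. by apply: grZ => //; apply: gr_one. Qed.

Lemma fct_sumE (I S : Type) (r : seq I) (F : I -> S -> K) s :
  (\sum_(i <- r) F i) s = \sum_(i <- r) F i s.
Proof. by elim: r => [|i r IH]; rewrite ?big_nil// !big_cons -IH. Qed.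

Lemma fctDE (S : Type) (f g : S -> K) s : (f + g) s = f s + g s. Proof. by []. Qed.
Lemma fctNE (S : Type) (f : S -> K) s : (- f) s = - f s. Proof. by []. Qed.
Lemma fctZE (S : Type) (a : rat) (f : S ->
    K) s : (a *: f) s = a *: f s. Proof. by []. Qed.
Definition fctE := (fctDE, fctNE, fctZE, fct_sumE).

(** Additive maps from the homogeneous functions of degree [n] to those of
    degree [n'] that are continuous at [0] for the product topologies.  The
    degree is fixed because a kernel that sums well against homogeneous
    functions need not do so against all functions. *)
Definition cts_linear (S T : choiceType) (dS : S -> int) (dT : T -> int) (n n' : int)
    (F : (S -> K) -> (T -> K)) : Prop :=
  [/\ forall f, hom gr dS n f -> hom gr dT n' (F f),
      forall f g, hom gr dS n f -> hom gr dS n g -> F (f + g) = F f + F g &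
      forall t, exists L : seq S, forall f, hom gr dS n f ->
        (forall s, s \in L -> f s = 0) -> F f t = 0].

Section ContinuousLinear.
Context (S T : choiceType) (dS : S -> int) (dT : T -> int) (n n' : int).
Implicit Types F G : (S -> K) -> (T -> K).

Lemma cts_linear0 F : cts_linear dS dT n n' F -> F 0 = 0.
Proof.
case=> _ hD _; have := hD 0 0 (hom0 dS n) (hom0 dS n); rewrite addr0.
by move=> h; apply: (addrI (F 0)); rewrite addr0 -h.
Qed.

Lemma cts_linear_sum F (I : Type) (r : seq I) (f : I -> S ->
    K) : cts_linear dS dT n n' F ->
  (forall i, hom gr dS n (f i)) -> F (\sum_(i <- r) f i) = \sum_(i <- r) F (f i).
Proof.
move=> hF hf; elim: r => [|i r IH]; first by rewrite !big_nil (cts_linear0 hF).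
by rewrite !big_cons; case: hF => _ hD _; rewrite hD ?IH//; apply: hom_sum.
Qed.

(** Outside a finite set of basis elements the argument does not matter, so the
    value at [t] is computed by a finite part of the expansion of [f]. *)
Lemma cts_linearE F t : cts_linear dS dT n n' F -> exists L : seq S, forall L' : seq S,
  {subset L <= L'} -> uniq L' -> forall f, hom gr dS n f ->
  F f t = \sum_(s <- L') F (scale (f s) (elt K s)) t.
Proof.
move=> hF; have [_ hD /(_ t)[L hL]] := hF; exists L => L' LL' uL f hf.
pose r := \sum_(s <- L') scale (f s) (elt K s).
have hr : hom gr dS n r by apply: hom_sum => s; apply: hom_scale_elt.
have -> : f = (f - r) + r by rewrite subrK.
rewrite hD//; last exact: homB.
rewrite fctDE hL ?add0r; first 1 last.
- exact: homB.
- move=> s /LL' sL; rewrite /r !fctE (bigD1_seq s)//= big1.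
    by rewrite /scale /elt eqxx mulr1 addr0 subrr.
  by move=> s' /negPf h; rewrite /scale /elt h mulr0.
rewrite subrK /r (cts_linear_sum _ hF) ?fct_sumE//.
by move=> s; apply: hom_scale_elt.
Qed.

(** Equality need only be checked on multiples [c . s] of the basis elements,
    for those [s] in the support of the argument. *)
Lemma cts_linear_eq F G (Q : S -> Prop) : cts_linear dS dT n n' F ->
    cts_linear dS dT n n' G ->
  (forall s c, Q s -> gr (n - dS s) c ->
    F (scale c (elt K s)) = G (scale c (elt K s))) ->
  forall f, hom gr dS n f -> (forall s, f s <> 0 -> Q s) -> F f = G f.
Proof.
move=> hF hG FG f hf hQ; apply/funext => t.
have [L1 e1] := cts_linearE t hF; have [L2 e2] := cts_linearE t hG.
rewrite (e1 (undup (L1 ++ L2)))// ?(e2 (undup (L1 ++ L2)))// ?undup_uniq//;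
  last 2 first.
- by move=> s sL; rewrite mem_undup mem_cat sL orbT.
- by move=> s sL; rewrite mem_undup mem_cat sL.
apply: eq_bigr => s _; have [->|/eqP fs] := eqVneq (f s) 0; last by rewrite FG//;
  apply: hQ.
have -> : scale 0 (elt K s) = 0 by apply/funext => x; rewrite /scale mul0r.
by rewrite (cts_linear0 hF) (cts_linear0 hG).
Qed.

Lemma cts_linearD F G : cts_linear dS dT n n' F -> cts_linear dS dT n n' G ->
  cts_linear dS dT n n' (fun f => F f + G f).
Proof.
move=> [F1 F2 F3] [G1 G2 G3]; split=> [f hf|f g hf hg|t].
- by apply: homD; [apply: F1|apply: G1].
- by rewrite F2// G2// addrACA.
- have [L1 h1] := F3 t; have [L2 h2] := G3 t; exists (L1 ++ L2) => f hf h0.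
  rewrite !fctDE h1 ?h2 ?addr0// => s sL; apply: h0; by rewrite mem_cat sL ?orbT.
Qed.

Lemma cts_linearZ a F : cts_linear dS dT n n' F ->
    cts_linear dS dT n n' (fun f => a *: F f).
Proof.
move=> [F1 F2 F3]; split=> [f hf|f g hf hg|t].
- by apply: homZ => //; apply: F1.
- by rewrite F2// scalerDr.
- have [L1 h1] := F3 t; exists L1 => f hf h0.
  by rewrite fctZE h1 ?scaler0.
Qed.

Lemma cts_linear_opp F : cts_linear dS dT n n' F ->
    cts_linear dS dT n n' (fun f => - F f).
Proof.
move=> h; have := cts_linearZ (-1) h; congr (cts_linear _ _ _ _ _).
by apply/funext => f; rewrite scaleN1r.
Qed.

Lemma cts_linear_null : cts_linear dS dT n n' (fun=> 0).
Proof.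
split=> [f hf|f g hf hg|t]; [exact: hom0|by rewrite addr0|by exists [::]].
Qed.
End ContinuousLinear.

Lemma cts_linear_comp (S T U : choiceType) (dS : S -> int) (dT : T -> int) (dU : U ->
    int)
    n n' n'' F G : cts_linear dT dU n' n'' F -> cts_linear dS dT n n' G ->
  cts_linear dS dU n n'' (F \o G).
Proof.
move=> hF hG; have F0 := cts_linear0 hF.
have [F1 F2 F3] := hF; have [G1 G2 G3] := hG; split=> [f hf|f g hf hg|u].
- by apply: F1; apply: G1.
- by rewrite /= G2// F2//; apply: G1.
- have [L h1] := F3 u.
  have [M hM] : exists M : seq S, forall f, hom gr dS n f -> (forall s, s \in M ->
    f s = 0) ->
      forall t, t \in L -> G f t = 0.
    elim: L {h1} => [|t L [M hM]]; first by exists [::].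
    have [N hN] := G3 t; exists (M ++ N) => f hf h0 t'; rewrite inE => /orP[/eqP->|].
      by apply: hN => // s sN; apply: h0; rewrite mem_cat sN orbT.
    by apply: hM => // s sN; apply: h0; rewrite mem_cat sN.
  by exists M => f hf h0; rewrite /= h1//; [apply: G1|apply: hM].
Qed.

(** In contrast with [cts_linear], nothing is homogeneous here: such maps act on
    all functions and commute with every convergent sum. *)
Definition local_linear (S T : choiceType) (F : (S -> K) -> (T -> K)) : Prop :=
  [/\ forall f g, F (f + g) = F f + F g,
      forall c f, F (scale c f) = scale c (F f) &
      forall t, exists L : seq S, forall f, (forall s, s \in L -> f s = 0) ->
        F f t = 0].

Section LocalLinear.
Context (S T : choiceType).
Implicit Types F G : (S -> K) -> (T -> K).

Lemma local_linear0 F : local_linear F -> F 0 = 0.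
Proof.
by case=> _ hZ _; have := hZ 0 0; rewrite scaler_fun => ->; apply/funext => t;
  rewrite /scale mul0r.
Qed.

Lemma local_linearN F f : local_linear F -> F (- f) = - F f.
Proof.
case=> _ hZ _; have E U (g : U -> K) : - g = scale (-1) g.
  by apply/funext => u; rewrite /scale mulN1r.
by rewrite !E hZ.
Qed.

Lemma local_linearB F f g : local_linear F -> F (f - g) = F f - F g.
Proof. by move=> h; rewrite -(local_linearN _ h); case: h => ->. Qed.

Lemma local_linearZ F a f : local_linear F -> F (a *: f) = a *: F f.
Proof. by case=> _ hZ _; rewrite !scale_rat hZ. Qed.

Lemma local_linear_sum F (I : Type) (r : seq I) (f : I -> S -> K) : local_linear F ->
  F (\sum_(i <- r) f i) = \sum_(i <- r) F (f i).
Proof.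
move=> hF; elim: r => [|i r IH]; first by rewrite !big_nil (local_linear0 hF).
by rewrite !big_cons -IH; case: hF => ->.
Qed.

Lemma local_linearE_seq F t (L : seq S) : local_linear F ->
  (forall f, (forall s, s \in L -> f s = 0) -> F f t = 0) -> uniq L ->
  forall f, F f t = \sum_(s <- L) f s * F (elt K s) t.
Proof.
move=> hF hL uL f; pose r := \sum_(s <- L) scale (f s) (elt K s).
have -> : f = (f - r) + r by rewrite subrK.
have [hD hZ _] := hF; rewrite hD fctDE hL ?add0r; last first.
  move=> s sL; rewrite /r !fctE (bigD1_seq s)//= big1.
    by rewrite /scale /elt eqxx mulr1 addr0 subrr.
  by move=> s' /negPf h; rewrite /scale /elt h mulr0.
rewrite subrK /r (local_linear_sum _ _ hF) ?fct_sumE//.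
by apply: eq_bigr => s _; rewrite hZ.
Qed.

Lemma local_linearE F t : local_linear F -> exists2 L : seq S, uniq L & 
  (forall f, (forall s, s \in L -> f s = 0) -> F f t = 0) /\
  forall f, F f t = \sum_(s <- L) f s * F (elt K s) t.
Proof.
move=> hF; have [_ _ /(_ t)[L hL]] := hF.
have h f : (forall s, s \in undup L -> f s = 0) -> F f t = 0.
  by move=> h; apply: hL => s sL; apply: h; rewrite mem_undup.
exists (undup L); first exact: undup_uniq.
by split=> //; apply: local_linearE_seq => //; apply: undup_uniq.
Qed.

Lemma local_linear_eq F G : local_linear F -> local_linear G ->
    (forall s, F (elt K s) = G (elt K s)) -> F =1 G.
Proof.
move=> hF hG FG f; apply/funext => t.
have [_ _ /(_ t)[L1 e1]] := hF; have [_ _ /(_ t)[L2 e2]] := hG.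
rewrite (local_linearE_seq (L := undup (L1 ++ L2)) hF)// ?undup_uniq//; last first.
  by move=> g g0; apply: e1 => s sL; apply: g0; rewrite mem_undup mem_cat sL.
rewrite (local_linearE_seq (L := undup (L1 ++ L2)) hG)// ?undup_uniq//; last first.
  by move=> g g0; apply: e2 => s sL; apply: g0; rewrite mem_undup mem_cat sL orbT.
by apply: eq_bigr => s _; rewrite FG.
Qed.

Lemma local_linearD F G : local_linear F -> local_linear G ->
    local_linear (fun f => F f + G f).
Proof.
move=> [F1 F2 F3] [G1 G2 G3]; split=> [f g|c f|t].
- by rewrite F1// G1// addrACA.
- by rewrite F2 G2 scaleD.
- have [L1 h1] := F3 t; have [L2 h2] := G3 t; exists (L1 ++ L2) => f h0.
  rewrite !fctDE h1 ?h2 ?addr0// => s sL; apply: h0; by rewrite mem_cat sL ?orbT.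
Qed.

Lemma local_linear_scal a F : local_linear F -> local_linear (fun f => a *: F f).
Proof.
move=> [F1 F2 F3]; split=> [f g|c f|t].
- by rewrite F1// scalerDr.
- by rewrite F2 scaleZ.
- have [L1 h1] := F3 t; exists L1 => f h0.
  by rewrite fctZE h1 ?scaler0.
Qed.

Lemma local_linear_sub F G : local_linear F -> local_linear G ->
    local_linear (fun f => F f - G f).
Proof.
move=> hF hG; have := local_linearD hF (local_linear_scal (-1) hG); congr local_linear.
by apply/funext => f; rewrite scaleN1r.
Qed.

Lemma local_linear_null : local_linear (fun _ : S -> K => 0 : T -> K).
Proof. by split=> [f g|c f|t]; [rewrite addr0|rewrite scaler_fun|exists [::]]. Qed.

Lemma local_linear_pointwise F :
  (forall t, exists2 G : (S -> K) -> (T ->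
    K), local_linear G & forall f, F f t = G f t) -> local_linear F.
Proof.
move=> h; split=> [f g|c f|t].
- by apply/funext => t; have [G [hD _ _] e] := h t; rewrite !fctDE !e hD.
- by apply/funext => t; have [G [_ hZ _] e] := h t; rewrite /scale !e hZ.
- have [G [_ _ /(_ t)[L hL]] e] := h t; exists L => f f0; rewrite e; exact: hL.
Qed.

Lemma local_linear_is_cts (dS : S -> int) (dT : T -> int) n n' F : local_linear F ->
  (forall f, hom gr dS n f -> hom gr dT n' (F f)) -> cts_linear dS dT n n' F.
Proof.
move=> [h1 h2 h3] hh; split=> // t; have [L hL] := h3 t; by exists L => f _; apply: hL.
Qed.
End LocalLinear.

Lemma local_linear_comp (S T U : choiceType) (F : (T -> K) -> (U -> K)) (G : (S ->
    K) -> (T -> K)) :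
  local_linear F -> local_linear G -> local_linear (F \o G).
Proof.
move=> [F1 F2 F3] [G1 G2 G3]; split=> [f g|c f|u] /=.
- by rewrite G1 F1.
- by rewrite G2 F2.
- have [L h1] := F3 u.
  have [M hM] : exists M : seq S, forall f, (forall s, s \in M -> f s = 0) ->
      forall t, t \in L -> G f t = 0.
    elim: L {h1} => [|t L [M hM]]; first by exists [::].
    have [N hN] := G3 t; exists (M ++ N) => f h0 t'; rewrite inE => /orP[/eqP->|].
      by apply: hN => // s sN; apply: h0; rewrite mem_cat sN orbT.
    by apply: hM => // s sN; apply: h0; rewrite mem_cat sN.
  by exists M => f h0; rewrite h1//; apply: hM.
Qed.

Lemma local_linear_id (S : choiceType) : local_linear (@id (S -> K)).
Proof. by split=> // t; exists [:: t] => f; apply; rewrite inE. Qed.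

Section Cext.
Context (S T : choiceType) (dS : S -> int) (dT : T -> int).

Lemma cextE (phi : S -> T -> K) f t (L : seq S) : uniq L ->
  (forall s, s \notin L -> f s * phi s t = 0) ->
  cext phi f t = \sum_(s <- L) f s * phi s t.
Proof.
move=> uL hL; rewrite /cext (fsbigE L)//.
  by apply: eq_bigl => s; rewrite in_setT.
by move=> s _ /hL.
Qed.

Lemma cext_scale_elt (phi : S -> T ->
    K) c s : cext phi (scale c (elt K s)) = scale c (phi s).
Proof.
apply/funext => t; rewrite (@cextE _ _ _ [:: s])//; last first.
  by move=> s'; rewrite inE eq_sym => /negPf h; rewrite /scale /elt h mulr0 mul0r.
by rewrite big_seq1 /scale /elt eqxx mulr1.
Qed.

Lemma cext_elt (phi : S -> T -> K) s : cext phi (elt K s) = phi s.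
Proof. by rewrite -[elt K s]scale1 cext_scale_elt scale1. Qed.

(** The condition on a kernel that makes [cext] converge on homogeneous
    functions of degree [n].  The coefficient [c] is part of it: the kernel may
    have infinitely many nonzero entries at [t] if they are killed by all
    coefficients of the right degree. *)
Definition tame (n : int) (phi : S -> T -> K) : Prop :=
  forall t, exists L : seq S, forall s c, s \notin L -> gr (n - dS s) c ->
    c * phi s t = 0.

Lemma tameE n (phi : S -> T -> K) t : tame n phi -> exists2 L : seq S, uniq L &
  forall f, hom gr dS n f -> (forall s, s \notin L -> f s * phi s t = 0) /\
   cext phi f t = \sum_(s <- L) f s * phi s t.
Proof.
move=> /(_ t)[L hL]; exists (undup L); first exact: undup_uniq.
move=> f hf; have h s : s \notin undup L -> f s * phi s t = 0.
  by rewrite mem_undup => sL; apply: hL.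
by split=> //; apply: cextE => //; apply: undup_uniq.
Qed.

Lemma cext_cts_linear n e (phi : S -> T -> K) : tame n phi ->
  (forall s, hom gr dT (dS s + e) (phi s)) -> cts_linear dS dT n (n + e) (cext phi).
Proof.
move=> ht hs; split=> [f hf t|f g hf hg|t].
- have [L uL /(_ f hf)[_ ->]] := tameE t ht; apply: gr_sum => // s _.
  have -> : n + e - dT t = (n - dS s) + (dS s + e - dT t) by rewrite -!addrA addKr.
  by apply: gr_mul => //; apply: hs.
- apply/funext => t; have [L uL E] := tameE t ht.
  rewrite (E _ (homD hf hg)).2 !fctDE (E _ hf).2 (E _ hg).2 -big_split/=.
  by apply: eq_bigr => s _; rewrite mulrDl.
- have [L uL E] := tameE t ht; exists L => f /E[_ ->] h0.
  by rewrite big_seq big1// => s /h0->; rewrite mul0r.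
Qed.

Lemma cext_scale n (phi : S -> T -> K) c f : tame n phi -> hom gr dS n f ->
  cext phi (scale c f) = scale c (cext phi f).
Proof.
move=> ht hf; apply/funext => t; have [L uL /(_ _ hf)[h0 e]] := tameE t ht.
rewrite /scale e (@cextE _ _ _ L)//; last by move=> s /h0; rewrite -mulrA => ->;
  rewrite mulr0.
by rewrite mulr_sumr; apply: eq_bigr => s _; rewrite mulrA.
Qed.

Lemma cts_linear_tame n n' F : cts_linear dS dT n n' F ->
  (forall s c, F (scale c (elt K s)) = scale c (F (elt K s))) ->
    tame n (fun s => F (elt K s)).
Proof.
case=> h1 h2 h3 hZ t; have [L hL] := h3 t; exists L => s c sL hc.
have := hL (scale c (elt K s)); rewrite hZ; apply; first exact: hom_scale_elt.
by move=> s' s'L; rewrite /scale /elt; case: eqP s'L sL => [->->//|]; rewrite mulr0.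
Qed.

Lemma cext_local_linear (phi : S -> T -> K) :
  (forall t, exists L : seq S, forall s, s \notin L -> phi s t = 0) ->
    local_linear (cext phi).
Proof.
move=> h; have E t : exists2 L : seq S, uniq L & forall f,
   cext phi f t = \sum_(s <- L) f s * phi s t.
  have [L hL] := h t; exists (undup L); first exact: undup_uniq.
  move=> f; apply: cextE; first exact: undup_uniq.
  by move=> s; rewrite mem_undup => /hL->; rewrite mulr0.
split=> [f g|c f|t].
- apply/funext => t; have [L uL e] := E t; rewrite !fctDE !e -big_split/=.
  by apply: eq_bigr => s _; rewrite mulrDl.
- apply/funext => t; have [L uL e] := E t; rewrite /scale/= !e mulr_sumr.
  by apply: eq_bigr => s _; rewrite mulrA.
- have [L uL e] := E t; exists L => f h0; rewrite e.
  by rewrite big_seq big1// => s /h0->; rewrite mul0r.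
Qed.

(** The expansion of [f] in the basis converges, and so does its image because
    each coordinate of [F] only involves finitely many basis elements. *)
Lemma local_linear_cspan (F : (S -> K) -> (T -> K)) (B : set (T ->
    K)) f : local_linear F ->
  (forall s, f s <> 0 -> B (F (elt K s))) -> B 0 -> cspan B (F f).
Proof.
move=> hF hB B0; exists S, f, (fun s => if f s == 0 then 0 else F (elt K s)).
have h0 t : exists2 L, uniq L & F f t = \sum_(s <- L) f s * F (elt K s) t /\
    forall s, s \notin L -> F (elt K s) t = 0.
  have [L uL [h0 e]] := local_linearE t hF; exists L => //; split => // s sL.
  by apply: h0 => s' s'L; rewrite /elt; case: eqP s'L sL => [->->|].
split=> [s|t|t].
- by case: eqP => // /hB.
- have [L uL [_ h]] := h0 t; apply: (sub_finite_set (B := [set` L])) => //.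
  move=> s /=; apply: contraNT => /h e; case: ifP => _; rewrite ?mulr0// e mulr0//.
- have [L uL [-> h]] := h0 t; rewrite (fsbigE L)//.
    by apply: eq_big => s; rewrite ?in_setT//; case: eqP => // ->; rewrite !mul0r.
  by move=> s _ /h e; case: ifP => _; rewrite ?mulr0// e mulr0.
Qed.

(** At a given coordinate only finitely many terms of the combination matter,
    and on these [F] is linear. *)
Lemma local_linear_kills_cspan (F : (S -> K) -> (T -> K)) (B : set (S ->
    K)) f : local_linear F ->
  (forall g, B g -> F g = 0) -> cspan B f -> F f = 0.
Proof.
move=> hF hB [A [c [l [hl hfin e]]]]; apply/funext => t.
have [L uL [h0 E]] := local_linearE t hF.
have [A0 uA hA] : exists2 A0 : seq A, uniq A0 & forall a s, a \notin A0 -> s \in L ->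
  c a * l a s = 0.
  pose D := \bigcup_(s in [set` L]) [set a | c a * l a s != 0].
  have /finite_seqP[r Dr] : finite_set D by apply: bigcup_finite.
  exists (undup r); first exact: undup_uniq.
  move=> a s ar sL; apply/eqP/negPn/negP => h; move: ar; rewrite mem_undup => /negP;
    apply.
  by have : D a; [exists s|rewrite Dr].
have -> : F f t = F (\sum_(a <- A0) scale (c a) (l a)) t.
  rewrite [in LHS]E [in RHS]E; apply: eq_big_seq => s sL; congr (_ * _).
  rewrite e fct_sumE (fsbigE A0)//.
    by apply: eq_bigl => a; rewrite in_setT.
  by move=> a _ /hA /(_ sL).
rewrite (local_linear_sum _ _ hF) fct_sumE big1// => a _.
by case: hF => _ -> _; rewrite hB// /scale mulr0.
Qed.
End Cext.
End Maps.

(** * The concatenation product *)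

Section Concat.
Context (K : comAlgType rat) (X : choiceType).
Implicit Types (f g h : seq X -> K) (w : seq X).

(** The left contraction by the letter [x], along which the concatenation
    product and the coproduct satisfy recursions on words. *)
Definition cut (x : X) f : seq X -> K := fun w => f (x :: w).

Lemma mul_nil f g : mul f g [::] = f [::] * g [::].
Proof. by rewrite /mul big_ord1. Qed.

Lemma mul_cons f g x w : mul f g (x :: w) = f [::] * g (x :: w) + mul (cut x f) g w.
Proof. by rewrite /mul big_ord_recl. Qed.

Lemma cut_mul f g x : cut x (mul f g) = scale (f [::]) (cut x g) + mul (cut x f) g.
Proof. by apply/funext => w; rewrite /cut mul_cons. Qed.

Lemma mulDl f g h : mul (f + g) h = mul f h + mul g h.
Proof. by apply/funext => w; rewrite fctDE /mul -big_split/=; apply: eq_bigr => k _;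
  rewrite fctDE mulrDl. Qed.
Lemma mulDr f g h : mul f (g + h) = mul f g + mul f h.
Proof. by apply/funext => w; rewrite fctDE /mul -big_split/=; apply: eq_bigr => k _;
  rewrite fctDE mulrDr. Qed.
Lemma mul_scalel c f g : mul (scale c f) g = scale c (mul f g).
Proof. by apply/funext => w; rewrite /scale /mul mulr_sumr; apply: eq_bigr => k _;
  rewrite mulrA. Qed.
Lemma mul_scaler c f g : mul f (scale c g) = scale c (mul f g).
Proof. by apply/funext => w; rewrite /scale /mul mulr_sumr; apply: eq_bigr => k _;
  rewrite mulrCA. Qed.
Lemma mulZl a f g : mul (a *: f) g = a *: mul f g.
Proof. by rewrite !scale_rat mul_scalel. Qed.
Lemma mulZr a f g : mul f (a *: g) = a *: mul f g.
Proof. by rewrite !scale_rat mul_scaler. Qed.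
Lemma mulNf f g : mul (- f) g = - mul f g.
Proof. by rewrite -scaleN1r mulZl scaleN1r. Qed.
Lemma mulfN f g : mul f (- g) = - mul f g.
Proof. by rewrite -scaleN1r mulZr scaleN1r. Qed.
Lemma mulBl f g h : mul (f - g) h = mul f h - mul g h.
Proof. by rewrite mulDl mulNf. Qed.
Lemma mulBr f g h : mul f (g - h) = mul f g - mul f h.
Proof. by rewrite mulDr mulfN. Qed.
Lemma mul0f f : mul 0 f = 0.
Proof. by have := mulZl 0 0 f; rewrite !scale0r. Qed.
Lemma mulf0 f : mul f 0 = 0.
Proof. by have := mulZr 0 f 0; rewrite !scale0r. Qed.

(** Induction on the word, through the Leibniz-type rule [cut_mul]. *)
Lemma mulA f g h : mul f (mul g h) = mul (mul f g) h.
Proof.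
apply/funext => w; elim: w f g h => [|x w IH] f g h; first by rewrite !mul_nil mulrA.
rewrite !mul_cons mul_nil mulrDr -addrA -mulrA; congr (_ + _).
by rewrite cut_mul mulDl fctDE IH mul_scalel.
Qed.

Lemma cut_elt x y w : cut x (elt K (y :: w)) = scale (y == x)%:R (elt K w).
Proof.
apply/funext => u; rewrite /cut /elt /scale eqseq_cons.
by case: (y == x); rewrite ?mul1r ?Monoid.mul0m ?mul0r.
Qed.
Lemma cut_elt_nil x : cut x (elt K [::]) = 0.
Proof. by apply/funext. Qed.

Lemma mul_elt_nil f : mul (elt K [::]) f = f.
Proof.
apply/funext => -[|x w]; first by rewrite mul_nil /elt mul1r.
by rewrite mul_cons cut_elt_nil mul0f addr0 /elt mul1r.
Qed.

Lemma scale0 (S : Type) (f : S -> K) : scale 0 f = 0.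
Proof. by apply/funext => s; rewrite /scale mul0r. Qed.

Lemma mul_elt (u v : seq X) : mul (elt K u) (elt K v) = elt K (u ++ v).
Proof.
elim: u => [|x u IH]; first by rewrite mul_elt_nil.
apply/funext => -[|y w]; first by rewrite mul_nil /elt mul0r.
by rewrite mul_cons /elt/= mul0r add0r -!/(elt _ _) cut_elt mul_scalel IH /scale/=
  eqseq_cons /elt mulr_natl mulrb; case: (x == y).
Qed.

Lemma mulr_elt_nil f : mul f (elt K [::]) = f.
Proof.
apply/funext => w; elim: w f => [|x w IH] f; first by rewrite mul_nil /elt mulr1.
by rewrite mul_cons IH /elt mulr0 add0r.
Qed.

Lemma mul_letter x f y w : mul (elt K [:: x]) f (y :: w) = (x == y)%:R * f w.
Proof. by rewrite mul_cons /elt/= mul0r add0r -!/(elt _ _) cut_elt mul_scalel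
  mul_elt_nil. Qed.
Lemma mul_letter_nil x f : mul (elt K [:: x]) f [::] = 0.
Proof. by rewrite mul_nil /elt mul0r. Qed.
Lemma elt_cons (x : X) u : elt K (x :: u) = mul (elt K [:: x]) (elt K u).
Proof. by rewrite mul_elt. Qed.

Lemma elt_letter_off x w : size w != 1%N -> elt K [:: x] w = 0.
Proof. by move=> /eqP hw; rewrite /elt; case: eqP hw => [<-|]. Qed.

Lemma local_linear_mull f : local_linear (mul f).
Proof.
split=> [g h|c g|t]; [exact: mulDr|exact: mul_scaler|].
exists [seq drop k t | k <- iota 0 (size t).+1] => g h0; rewrite /mul big1// => k _.
rewrite h0 ?mulr0//; apply/mapP; exists (nat_of_ord k) => //.
by rewrite mem_iota add0n ltn_ord.
Qed.
Lemma local_linear_mulr g : local_linear (fun k0 => mul k0 g).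
Proof.
split=> [f h|c f|t]; [exact: mulDl|exact: mul_scalel|].
exists [seq take k t | k <- iota 0 (size t).+1] => f h0; rewrite /mul big1// => k _.
rewrite h0 ?mul0r//; apply/mapP; exists (nat_of_ord k) => //.
by rewrite mem_iota add0n ltn_ord.
Qed.
End Concat.

Section WordDegree.
Context (X : choiceType) (deg : X -> int).
Lemma wdeg_nil : wdeg deg [::] = 0. Proof. by rewrite /wdeg big_nil. Qed.
Lemma wdeg_cons x w : wdeg deg (x :: w) = deg x + wdeg deg w.
Proof. by rewrite /wdeg big_cons. Qed.
Lemma wdeg_cat u v : wdeg deg (u ++ v) = wdeg deg u + wdeg deg v.
Proof. by rewrite /wdeg big_cat. Qed.
Lemma wdeg_seq1 x : wdeg deg [:: x] = deg x.
Proof. by rewrite /wdeg big_seq1. Qed.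
Lemma wdeg_take_drop k w : wdeg deg w = wdeg deg (take k w) + wdeg deg (drop k w).
Proof. by rewrite -wdeg_cat cat_take_drop. Qed.
End WordDegree.

(** * Continuous derivations of the tensor algebra *)

Section Graded.
Context (K : comAlgType rat) (gr : int -> set K) (hK : even_grading gr).
Context (X : choiceType) (deg : X -> int).
Implicit Types (f g h : seq X -> K) (w : seq X).
Local Notation homT := (hom gr (wdeg deg)).
Local Notation ctsT := (cts_linear gr (wdeg deg) (wdeg deg)).

Lemma hom_mul p q f g : homT p f -> homT q g -> homT (p + q) (mul f g).
Proof.
move=> hf hg w; apply: (gr_sum hK) => k _.
by rewrite (wdeg_take_drop deg k) opprD addrACA; apply: (gr_mul hK).
Qed.

Lemma hom_letter x : homT (deg x) (elt K [:: x]).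
Proof. by rewrite -(wdeg_seq1 deg); apply: hom_elt. Qed.

Lemma hom_gcomm p q f g : homT p f -> homT q g -> homT (p + q) (gcomm p q f g).
Proof.
move=> hf hg; apply: homB => //; first exact: hom_mul.
by rewrite addrC; apply: homZ => //; apply: hom_mul.
Qed.

Lemma cts_linear_mull p n f : homT p f -> ctsT n (p + n) (mul f).
Proof. by move=> hf; apply: local_linear_is_cts => [|g hg];
  [apply: local_linear_mull|apply: hom_mul]. Qed.
Lemma cts_linear_mulr p n f : homT p f -> ctsT n (n + p) (fun k0 => mul k0 f).
Proof. by move=> hf; apply: local_linear_is_cts => [|g hg];
  [apply: local_linear_mulr|apply: hom_mul]. Qed.

(** The values on generators of a continuous derivation of degree [e]. *)
Definition vector_field (e : int) (phi : X -> seq X -> K) : Prop :=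
  (forall x, homT (deg x + e) (phi x)) /\ (forall n, tame gr deg n phi).

Section Derivation.
Context (e : int) (phi : X -> seq X -> K).
Hypothesis phiP : vector_field e phi.
Let phi_hom := phiP.1.
Let phi_tame := phiP.2.
Local Notation dw := (der_word deg e phi).
Local Notation D := (der deg e phi).

Lemma der_word_cat (u v : seq X) :
  dw (u ++ v) = mul (dw u) (elt K v) + koszul (e * wdeg deg u) *: mul (elt K u) (dw v).
Proof.
elim: u => [|x u IH]; first by rewrite /= mul0f add0r wdeg_nil mulr0 koszul0 scale1r
  mul_elt_nil.
rewrite /= IH -mul_elt mulA mulDl -addrA; congr (_ + _).
rewrite mulDr scalerDr mulZl -mulA; congr (_ + _).
by rewrite mulZr scalerA mulA mul_elt wdeg_cons; congr (_ *: _); koszul_sign.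
Qed.

Lemma der_word_hom w : homT (wdeg deg w + e) (dw w).
Proof.
elim: w => [|x w IH]; first exact: hom0.
rewrite /= wdeg_cons; apply: homD => //.
  by rewrite addrAC; apply: hom_mul => //; apply: hom_elt.
by apply: homZ => //; rewrite -addrA; apply: hom_mul => //; apply: hom_letter.
Qed.

(** Given the output [t], a word [w] with [phi] applied to one letter can only
    produce [t] if the rest of [w] is part of [t]; for each such choice the
    tameness of [phi] bounds the remaining letter. *)
Lemma der_word_tame n : tame gr (wdeg deg) n dw.
Proof.
move=> t; elim: t n => [|y t IH] n.
- have [L hL] := phi_tame n [::]; exists (map (fun x => [:: x]) L).
  case=> [|x w] c cL hc; first by rewrite mulr0.
  rewrite /= fctE mul_nil fctZE mul_letter_nil scaler0 addr0.
  case: w cL hc => [|? ?] cL hc; last by rewrite /elt !mulr0.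
  rewrite /elt mulr1 hL//; last by rewrite -(wdeg_seq1 deg).
  by apply: contra cL => /(map_f (fun x => [:: x])).
- have key k : exists L : seq X, forall x c, x \notin L ->
      gr (n - wdeg deg (drop k (y :: t)) - deg x) c -> c * phi x (take k (y :: t)) = 0.
    exact: phi_tame.
  have [Lf hLf] := choice key; have [L hL] := IH (n - deg y).
  (* Either the derivation hits the first letter, whose image is a prefix of
      the output, or the words share their first letter. *)
  exists (flatten [seq [seq x :: drop k (y :: t) | x <- Lf k] | k <- iota 0 (size t).+2]
     ++ [seq y :: w | w <- L]).
  case=> [|x w] c; first by rewrite mulr0.
  rewrite mem_cat negb_or => /andP[h1 h2]; rewrite wdeg_cons => hc.
  rewrite /= fctDE fctZE mul_letter mulrDr [X in X + _](_ : _ = 0) ?add0r.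
    case: eqP h2 hc => [->|_] h2 hc; last by rewrite mul0r scaler0 mulr0.
    rewrite mul1r -scalerAr hL ?scaler0//; last by rewrite -addrA -opprD.
    by apply: contra h2 => /(map_f (cons y)).
  rewrite /mul mulr_sumr big1// => k _; rewrite /elt; case: eqP => [ew|_];
    last by rewrite !mulr0.
  rewrite mulr1 (hLf k)//; last by rewrite -ew -addrA -opprD [_ + deg x]addrC.
  apply: contra h1 => xL; apply/flattenP; exists [seq x :: drop k (y :: t) | x <- Lf k].
    by apply: (map_f (fun k => _)); rewrite mem_iota add0n ltn_ord.
  by rewrite ew; apply: (map_f (fun x => x :: _)).
Qed.

Lemma der_cts_linear n : ctsT n (n + e) D.
Proof. by apply: cext_cts_linear => //; [apply: der_word_tame|apply: der_word_hom]. Qed.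

Lemma der_hom n f : homT n f -> homT (n + e) (D f).
Proof. by case: (der_cts_linear n) => h _ _; apply: h. Qed.

Lemma der_add n f g : homT n f -> homT n g -> D (f + g) = D f + D g.
Proof. by case: (der_cts_linear n) => _ h _; apply: h. Qed.

Lemma der_scale n c f : homT n f -> D (scale c f) = scale c (D f).
Proof. by move=> hf; apply: (cext_scale c (@der_word_tame n)). Qed.

Lemma der_rat n a f : homT n f -> D (a *: f) = a *: D f.
Proof. by move=> hf; rewrite !scale_rat (der_scale _ hf). Qed.

Lemma der_sub n f g : homT n f -> homT n g -> D (f - g) = D f - D g.
Proof.
move=> hf hg; rewrite -!scaleN1r (@der_add n)// ?(der_rat _ hg)//.
exact: homZ.
Qed.

Lemma der_elt w : D (elt K w) = dw w.
Proof. exact: cext_elt. Qed.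
Lemma der_letter x : D (elt K [:: x]) = phi x.
Proof. by rewrite der_elt /= mulf0 scaler0 addr0 mulr_elt_nil. Qed.
Lemma der_scale_elt c w : D (scale c (elt K w)) = scale c (D (elt K w)).
Proof. by rewrite /der cext_scale_elt cext_elt. Qed.

(** Both sides are continuous in each argument, so the rule follows from the
    case of words, [der_word_cat]; the sign of the homogeneous [f] is that of
    each word in its support. *)
Lemma der_mul p q f g : homT p f -> homT q g ->
  D (mul f g) = mul (D f) g + koszul (e * p) *: mul f (D g).
Proof.
move=> hf hg.
have [D0 _ _] := der_cts_linear 0.
have hF h : homT q h -> ctsT p (p + q + e) (fun f => D (mul f h)).
  by move=> hh; apply: (cts_linear_comp _ (der_cts_linear (p + q)) (cts_linear_mulr p
    hh)).
have hG h : homT q h -> ctsT p (p + q + e) (fun f =>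
  mul (D f) h + koszul (e * p) *: mul f (D h)).
  move=> hh; apply: cts_linearD => //.
    by rewrite addrAC; apply: (cts_linear_comp _ (cts_linear_mulr _ hh)
      (der_cts_linear p)).
  by apply: cts_linearZ => //; rewrite -addrA; apply: cts_linear_mulr; apply: der_hom.
apply: (cts_linear_eq hK (hF g hg) (hG g hg) (Q := fun=> True)) => // u c _ hc.
have hu : homT p (scale c (elt K u)) by apply: hom_scale_elt.
have hF' : ctsT q (p + q + e) (fun g => D (mul (scale c (elt K u)) g)).
  by apply: (cts_linear_comp _ (der_cts_linear (p + q)) (cts_linear_mull q hu)).
have hG' : ctsT q (p + q + e) (fun g => mul (D (scale c (elt K u))) g
    + koszul (e * p) *: mul (scale c (elt K u)) (D g)).
  apply: cts_linearD => //.
    by rewrite addrAC; apply: cts_linear_mull; apply: der_hom.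
  apply: cts_linearZ => //; rewrite -addrA.
  by apply: (cts_linear_comp _ (cts_linear_mull _ hu) (der_cts_linear q)).
apply: (cts_linear_eq hK hF' hG' (Q := fun=> True)) => // v d _ hd.
rewrite !mul_scalel !mul_scaler mul_elt !der_scale_elt.
rewrite (@der_scale (wdeg deg (u ++ v) + (q - wdeg deg v)))//; last first.
  by rewrite addrC; apply: hom_scale_elt => //; rewrite -addrA subrr addr0.
rewrite der_scale_elt !mul_scalel !mul_scaler !der_elt der_word_cat scaleD scaleD.
congr (_ + _); first by apply/funext => w; rewrite /scale mulrCA.
rewrite !scaleZ; apply/funext => w.
by rewrite /scale !fctZE !scalerAl [e * _]mulrC [e * p]mulrC (koszul_hom hK _ hc).
Qed.
End Derivation.
Arguments der_scale {e phi} phiP {n} c {f}.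
Arguments der_rat {e phi} phiP {n} a {f}.

(** The graded commutator of two odd derivations is a derivation, hence
    determined by its values on generators. *)
Lemma odd_der_anticommute phi psi :
  vector_field 1 phi -> vector_field 1 psi ->
  (forall x, der deg 1 phi (psi x) + der deg 1 psi (phi x) = 0) ->
  forall n f, homT n f -> der deg 1 phi (der deg 1 psi f) + der deg 1 psi (der deg 1
    phi f) = 0.
Proof.
move=> hphi hpsi gen n f hf.
have hF : ctsT n (n + 1 + 1) (fun f =>
  der deg 1 phi (der deg 1 psi f) + der deg 1 psi (der deg 1 phi f)).
  by apply: cts_linearD => //;
    apply: (cts_linear_comp _ (der_cts_linear _ (n + 1)) (der_cts_linear _ n)).
apply: (cts_linear_eq hK hF (cts_linear_null hK _ _ _ _) (Q := fun=> True)) =>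
  // w c _ _.
have hs : homT (wdeg deg w + 1) (der deg 1 psi (elt K w)) by apply: der_hom => //;
  apply: hom_elt.
have hp : homT (wdeg deg w + 1) (der deg 1 phi (elt K w)) by apply: der_hom => //;
  apply: hom_elt.
rewrite !der_scale_elt (der_scale hphi _ hs) (der_scale hpsi _ hp) -scaleD.
rewrite [X in scale _ X](_ : _ = 0) ?scaler_fun//.
elim: w {hs hp} => [|x w IH];
  first by rewrite !der_elt /= (cts_linear0 hK (der_cts_linear hphi 0)) (cts_linear0
  hK (der_cts_linear hpsi 0)) addr0.
have hw : homT (wdeg deg w) (elt K w) by apply: hom_elt.
have hx := hom_letter x.
rewrite elt_cons (der_mul hphi hx hw) (der_mul hpsi hx hw) !der_letter.
have step a b : vector_field 1 a -> vector_field 1 b ->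
  der deg 1 a (mul (b x) (elt K w) + koszul (1 * deg x) *: mul (elt K [:: x]) (der deg
    1 b (elt K w)))
  = mul (der deg 1 a (b x)) (elt K w) + koszul (deg x + 1) *: mul (b x) (der deg 1 a
    (elt K w))
   + koszul (deg x) *: mul (a x) (der deg 1 b (elt K w)) +
     mul (elt K [:: x]) (der deg 1 a (der deg 1 b (elt K w))).
  move=> ah bh.
  have hb : homT (wdeg deg w + 1) (der deg 1 b (elt K w)) by apply: der_hom.
  have hm : homT (deg x + wdeg deg w + 1) (mul (elt K [:: x]) (der deg 1 b (elt K w))).
    by rewrite -addrA; apply: hom_mul.
  rewrite (der_add ah (n := deg x + wdeg deg w + 1)); last 2 first.
  - by rewrite addrAC; apply: hom_mul => //; apply: bh.1.
  - exact: homZ.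
  rewrite (der_rat ah _ hm) (der_mul ah (bh.1 x) hw) (der_mul ah hx hb) der_letter.
  rewrite !mul1r scalerDr scalerA koszul_sq scale1r addrA.
  by [].
rewrite (step phi psi)// (step psi phi)//.
have cancel (V : zmodType) (a b k d u v : V) :
    a + b = 0 -> k + d = 0 -> a - u + v + k + (b - v + u + d) = 0.
  move=> ab kd; rewrite addrACA kd addr0 -(addrA a) -(addrA b) [- v + u]addrC.
  by rewrite -[u - v]opprB [- u + v]addrC addrACA subrr addr0.
have -> : koszul (deg x + 1) = - koszul (deg x) by koszul_sign.
by rewrite !scaleNr; apply: cancel; rewrite -?mulDl -?mulDr ?gen ?IH ?mul0f ?mulf0.
Qed.
End Graded.

(** * The coproduct, primitive elements and the operator mu o Delta *)

Section Shuffle.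
Context (K : comAlgType rat) (gr : int -> set K) (hK : even_grading gr).
Context (X : choiceType) (deg : X -> int).
Implicit Types (f g h : seq X -> K) (u v w : seq X) (F G : seq X * seq X -> K).
Local Notation wd := (wdeg deg).
Local Notation homT := (hom gr wd).
Local Notation ctsT := (cts_linear gr wd wd).

Lemma cext_local_linearE (S T : choiceType) (H : (S -> K) -> (T -> K)) (phi : S ->
    T -> K) :
  local_linear H -> (forall s, phi s = H (elt K s)) -> cext phi = H.
Proof.
move=> hH e; apply/funext => f; apply: local_linear_eq => // [|s];
  last by rewrite cext_elt e.
apply: cext_local_linear => t; have [_ _ /(_ t)[L hL]] := hH; exists L => s sL;
  rewrite e.
by apply: hL => s' s'L; rewrite /elt; case: eqP s'L sL => [->->|].
Qed.

(** The coefficient of [u (x) v] in [Delta f], by recursion on the first letter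
    of the words that shuffle [u] and [v].  In this form it makes sense for
    every function [f]. *)
Fixpoint coprod_at u v {struct u} : (seq X -> K) -> K :=
  if u is x :: u' then
    (fix shv v : (seq X -> K) -> K :=
      if v is y :: v' then fun f =>
        coprod_at u' v (cut x f) + koszul (wd u * deg y) *: shv v' (cut y f)
      else fun f => f u) v
  else fun f => f v.

Lemma coprod_at_nill v f : coprod_at [::] v f = f v. Proof. by []. Qed.
Lemma coprod_at_nilr u f : coprod_at u [::] f = f u. Proof. by case: u. Qed.
Lemma coprod_at_cons x u y v f : coprod_at (x :: u) (y :: v) f =
  coprod_at u (y :: v) (cut x f) + koszul (wd (x :: u) * deg y) *: coprod_at (x :: u)
    v (cut y f).
Proof. by []. Qed.

Lemma two_words_ind (Q : seq X -> seq X -> Prop) :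
  (forall v, Q [::] v) -> (forall u, Q u [::]) ->
  (forall x u y v, Q u (y :: v) -> Q (x :: u) v -> Q (x :: u) (y :: v)) ->
  forall u v, Q u v.
Proof.
move=> h1 h2 h3; elim=> [//|x u IH]; elim=> [//|y v IHv].
exact: h3.
Qed.

Lemma coprod_atD u v f g : coprod_at u v (f + g) = coprod_at u v f + coprod_at u v g.
Proof.
move: u v f g; apply: two_words_ind => [v|u|x u y v IH1 IH2] f g;
  rewrite ?coprod_at_nilr ?coprod_at_nill//.
by rewrite !coprod_at_cons [cut x _](_ : _ = cut x f + cut x g)// [cut y _](_ : _ =
  cut y f + cut y g)// IH1 IH2 scalerDr addrACA.
Qed.

Lemma coprod_at_scale u v c f : coprod_at u v (scale c f) = c * coprod_at u v f.
Proof.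
move: u v f; apply: two_words_ind => [v|u|x u y v IH1 IH2] f;
  rewrite ?coprod_at_nilr ?coprod_at_nill//.
rewrite !coprod_at_cons [cut x _](_ : _ = scale c (cut x f))// [cut y _](_ : _ =
  scale c (cut y f))//.
by rewrite IH1 IH2 mulrDr scalerAr.
Qed.

Lemma coprod_at_size u v f g n : (forall w, size w = n -> f w = g w) ->
  (size u + size v)%N = n -> coprod_at u v f = coprod_at u v g.
Proof.
move: u v f g n; apply: two_words_ind => [v|u|x u y v IH1 IH2] f g n fg.
- exact: fg.
- by rewrite addn0 !coprod_at_nilr; apply: fg.
rewrite addSn => e; rewrite !coprod_at_cons (IH1 (cut x f) (cut x g) (size u + size (y
  :: v))%N)//; last first.
  by move=> w hw; apply: fg; rewrite /= hw.
rewrite (IH2 (cut y f) (cut y g) (size (x :: u) + size v)%N)//.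
by move=> w hw; apply: fg; rewrite /= hw -e /= addnS.
Qed.

Lemma coprod_at_local u v : exists L : seq (seq X), forall f, (forall w, w \in L ->
    f w = 0) -> coprod_at u v f = 0.
Proof.
move: u v; apply: two_words_ind => [v|u|x u y v [L1 h1] [L2 h2]].
- by exists [:: v] => f; apply; rewrite inE.
- by exists [:: u] => f h; rewrite coprod_at_nilr h// inE.
- exists (map (cons x) L1 ++ map (cons y) L2) => f h0;
  rewrite coprod_at_cons h1 ?h2 ?scaler0 ?addr0//.
    by move=> w wL; apply: h0; rewrite mem_cat (map_f (cons y))// orbT.
  by move=> w wL; apply: h0; rewrite mem_cat (map_f (cons x)).
Qed.

Lemma coprod_at_hom u v n f : homT n f -> gr (n - wd u - wd v) (coprod_at u v f).
Proof.
move: u v n f; apply: two_words_ind => [v|u|x u y v IH1 IH2] n f hf;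
  rewrite ?coprod_at_nilr ?coprod_at_nill.
- by rewrite wdeg_nil subr0.
- by rewrite wdeg_nil subr0.
have hcut z : homT (n - deg z) (cut z f).
  by move=> w; rewrite /cut -addrA -opprD -wdeg_cons.
rewrite coprod_at_cons; apply: (grD hK).
  by have := IH1 _ _ (hcut x); rewrite -(addrA n) -opprD -wdeg_cons.
apply: (grZ hK); have := IH2 _ _ (hcut y).
by congr gr; rewrite [wd (y :: v)]wdeg_cons; ring.
Qed.

Definition coprod f : seq X * seq X -> K := fun p => coprod_at p.1 p.2 f.

Lemma local_linear_coprod : local_linear coprod.
Proof.
split=> [f g|c f|[u v]].
- by apply/funext => p; apply: coprod_atD.
- by apply/funext => p; apply: coprod_at_scale.
- exact: coprod_at_local.
Qed.

Definition wdeg2 (p : seq X * seq X) : int := wd p.1 + wd p.2.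

Lemma coprod_hom n f : homT n f -> hom gr wdeg2 n (coprod f).
Proof. by move=> hf p; rewrite /wdeg2 opprD addrA; apply: coprod_at_hom. Qed.

(** Left multiplication by [f (x) 1] for the graded product of the tensor
    square. *)
Definition lmul1 f F : seq X * seq X -> K := fun p => mul f (fun u => F (u, p.2)) p.1.
(** Left multiplication by [1 (x) f] moves [f] past the first factor.  The sign
    is attached to each word of [f], so that no degree of [f] is needed. *)
Definition twist (n : int) f : seq X -> K := fun w => koszul (wd w * n) *: f w.
Definition lmul2 f F : seq X * seq X -> K :=
  fun p => mul (twist (wd p.1) f) (fun v => F (p.1, v)) p.2.

(** Primitivity, in the form in which it is used: [Delta] is an algebra map and
    [Delta f = f (x) 1 + 1 (x) f]. *)
Definition primitive f : Prop := forall g,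
    coprod (mul f g) = lmul1 f (coprod g) + lmul2 f (coprod g).

Lemma cut_mul_letters f g x : (forall w, size w != 1%N -> f w = 0) ->
  cut x (mul f g) = scale (f [:: x]) g.
Proof.
move=> hf; rewrite cut_mul hf// scale0 add0r.
have -> : cut x f = scale (f [:: x]) (elt K [::]).
  apply/funext => -[|y w]; rewrite /cut /scale /elt ?mulr1// hf// mulr0//.
by rewrite mul_scalel mul_elt_nil.
Qed.

(** This is the recursion that defines the coproduct. *)
Lemma primitive_letters f : (forall w, size w != 1%N -> f w = 0) -> primitive f.
Proof.
move=> hf g.
have ht n w : size w != 1%N -> twist n f w = 0 by move=> h; rewrite /twist hf// scaler0.
have C h h' x w : (forall w, size w != 1%N -> h w = 0) ->
  mul h h' (x :: w) = h [:: x] * h' w.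
  by move=> hh; rewrite -[LHS]/(cut x (mul h h') w) cut_mul_letters.
apply/funext => -[[|x u] [|y v]]; rewrite fctDE /coprod /lmul1 /lmul2 /=.
- by rewrite !mul_nil ht// hf// !mul0r addr0.
- rewrite mul_nil hf// mul0r add0r (C _ _ _ _ hf) (C _ _ _ _ (ht _)).
  by rewrite /twist wdeg_nil mulr0 koszul0 scale1r.
- by rewrite mul_nil ht// mul0r addr0 !(C _ _ _ _ hf) coprod_at_nilr.
rewrite (C _ _ _ _ hf) (C _ _ _ _ (ht _)) -/(coprod_at (x :: u) v _)
  !cut_mul_letters// !coprod_at_scale.
by rewrite /twist wdeg_seq1 [deg y * _]mulrC scalerAl.
Qed.

Lemma elt_pair u v (p : seq X * seq X) : elt K (u, v) p = elt K u p.1 * elt K v p.2.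
Proof. by case: p => a b; rewrite /elt xpair_eqE /= -natrM mulnb. Qed.

Lemma mul2_letter x F :
  mul2 deg (elt K ([:: x], [::]) + elt K ([::], [:: x])) F =
  lmul1 (elt K [:: x]) F + lmul2 (elt K [:: x]) F.
Proof.
apply/funext => -[u v]; rewrite fctDE /mul2 /=.
under eq_bigr do under eq_bigr do rewrite fctDE !elt_pair mulrDl scalerDr.
under eq_bigr do rewrite big_split/=.
rewrite big_split/=; congr (_ + _).
- rewrite /lmul1 /mul; apply: eq_bigr => k _.
  rewrite big_ord_recl big1 ?addr0.
    by rewrite take0 drop0 wdeg_nil mul0r koszul0 scale1r /elt eqxx mulr1.
  move=> l _; rewrite [elt K [::] _](_ : _ = 0) ?mulr0 ?mul0r ?scaler0//.
  by rewrite /elt /=; case: (v) l => [[]//|].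
- rewrite exchange_big/= /lmul2 /mul; apply: eq_bigr => l _.
  rewrite big_ord_recl big1 ?addr0.
    by rewrite take0 drop0 /= /twist -scalerAl /elt eqxx mul1r.
  move=> k _; rewrite [elt K [::] _](_ : _ = 0) ?mulr0 ?mul0r ?scaler0//.
  by rewrite /elt /=; case: (u) k => [[]//|].
Qed.

Lemma DeltaE : @Delta K X deg = coprod.
Proof.
apply: cext_local_linearE; first exact: local_linear_coprod.
elim=> [|x w IH].
  have z a b : coprod_at a b (0 : seq X -> K) = 0.
    by have := coprod_at_scale a b 0 0; rewrite scale0 mul0r.
  rewrite big_nil; apply/funext => -[[|x u] [|y v]]; rewrite elt_pair /coprod.
  - by rewrite /elt /= mulr1.
  - by rewrite /elt /= mulr0.
  - by rewrite /elt /= mulr1.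
  - by rewrite coprod_at_cons !(cut_elt_nil K) !z scaler0 addr0 /elt mulr0.
rewrite big_cons IH mul2_letter [elt K (x :: w)]elt_cons primitive_letters// => u.
exact: elt_letter_off.
Qed.

Lemma coprod_nil : coprod (elt K [::]) = elt K ([::], [::]).
Proof. by rewrite -DeltaE /Delta cext_elt big_nil. Qed.

Definition concat F : seq X -> K := fun w => \sum_(k < (size w).+1) F (take k w,
    drop k w).

Lemma local_linear_concat : local_linear concat.
Proof.
split=> [F G|c F|w].
- by apply/funext => w; rewrite fctDE /concat -big_split.
- by apply/funext => w; rewrite /scale /concat mulr_sumr.
- exists [seq (take k w, drop k w) | k <- iota 0 (size w).+1] => F h0.
  rewrite /concat big1// => k _; apply: h0; apply/mapP; exists (nat_of_ord k) => //.
  by rewrite mem_iota add0n ltn_ord.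
Qed.

Definition tens f g : seq X * seq X -> K := fun p => f p.1 * g p.2.

Lemma concat_tens f g : concat (tens f g) = mul f g. Proof. by []. Qed.

Lemma elt_tens u v : elt K (u, v) = tens (elt K u) (elt K v).
Proof. by apply/funext => p; apply: elt_pair. Qed.

Lemma muE : @mu K X = concat.
Proof.
by apply: cext_local_linearE => [|[a b]];
  [apply: local_linear_concat|rewrite elt_tens concat_tens mul_elt].
Qed.

Lemma concat_hom n F : hom gr wdeg2 n F -> homT n (concat F).
Proof.
move=> hF w; apply: (gr_sum hK) => k _; rewrite (wdeg_take_drop deg k).
exact: (hF (_, _)).
Qed.

Local Notation s := (@shuffle K X deg).

Lemma shuffleE f : s f = concat (coprod f).
Proof. by rewrite /shuffle /= muE DeltaE. Qed.

Lemma local_linear_shuffle : local_linear s.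
Proof.
have -> : s = concat \o coprod by apply/funext => f; apply: shuffleE.
exact: local_linear_comp local_linear_concat local_linear_coprod.
Qed.

Lemma shuffle_hom n f : homT n f -> homT n (s f).
Proof. by move=> hf; rewrite shuffleE; apply: concat_hom; apply: coprod_hom. Qed.

Lemma shuffle_size f g n : (forall w, size w = n -> f w = g w) ->
  forall w, size w = n -> s f w = s g w.
Proof.
move=> fg w hw; rewrite !shuffleE /concat; apply: eq_bigr => k _.
apply: (coprod_at_size (n := n)) => //=.
by rewrite -size_cat cat_take_drop.
Qed.

Lemma shuffle_nil f : s f [::] = f [::].
Proof. by rewrite shuffleE /concat big_ord1. Qed.

Lemma lmul1D f F G : lmul1 f (F + G) = lmul1 f F + lmul1 f G.
Proof. by apply/funext => p; rewrite /lmul1 fctDE -fctDE -mulDr. Qed.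
Lemma lmul2D f F G : lmul2 f (F + G) = lmul2 f F + lmul2 f G.
Proof. by apply/funext => p; rewrite /lmul2 fctDE -fctDE -mulDr. Qed.
Lemma lmul1Z f a F : lmul1 f (a *: F) = a *: lmul1 f F.
Proof. by apply/funext => p; rewrite /lmul1 fctZE -fctZE -mulZr. Qed.
Lemma lmul2Z f a F : lmul2 f (a *: F) = a *: lmul2 f F.
Proof. by apply/funext => p; rewrite /lmul2 fctZE -fctZE -mulZr. Qed.
Lemma lmul1Bl f g F : lmul1 (f - g) F = lmul1 f F - lmul1 g F.
Proof. by apply/funext => p; rewrite /lmul1 mulBl. Qed.
Lemma lmul1Zl a f F : lmul1 (a *: f) F = a *: lmul1 f F.
Proof. by apply/funext => p; rewrite /lmul1 mulZl. Qed.
Lemma twistB n f g : twist n (f - g) = twist n f - twist n g.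
Proof. by apply/funext => w; rewrite /twist !fctDE !fctNE scalerBr. Qed.
Lemma twistZ n a f : twist n (a *: f) = a *: twist n f.
Proof. by apply/funext => w; rewrite /twist !fctZE scalerA mulrC -scalerA. Qed.
Lemma lmul2Bl f g F : lmul2 (f - g) F = lmul2 f F - lmul2 g F.
Proof. by apply/funext => p; rewrite /lmul2 twistB mulBl. Qed.
Lemma lmul2Zl a f F : lmul2 (a *: f) F = a *: lmul2 f F.
Proof. by apply/funext => p; rewrite /lmul2 twistZ mulZl. Qed.

Lemma twist_mul n f g : twist n (mul f g) = mul (twist n f) (twist n g).
Proof.
apply/funext => w; rewrite /twist /mul scaler_sumr; apply: eq_bigr => k _.
rewrite -scalerAl -scalerAr scalerA {1}(wdeg_take_drop deg k); congr (_ *: _).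
by rewrite mulrDl; koszul_sign.
Qed.

Lemma twist_hom n p f : homT p f -> twist n f = koszul (p * n) *: f.
Proof. by move=> hf; apply/funext => w;
  rewrite /twist fctZE (koszul_hom hK _ (hf w)). Qed.

Lemma lmul1A f g F : lmul1 (mul f g) F = lmul1 f (lmul1 g F).
Proof. by apply/funext => p; rewrite /lmul1 -mulA. Qed.
Lemma lmul2A f g F : lmul2 (mul f g) F = lmul2 f (lmul2 g F).
Proof. by apply/funext => p; rewrite /lmul2 twist_mul -mulA. Qed.

(** The Koszul sign rule in the graded tensor square. *)
Lemma lmul12 p q f g F : homT p f -> homT q g ->
  lmul1 f (lmul2 g F) = koszul (p * q) *: lmul2 g (lmul1 f F).
Proof.
move=> hf hg; apply/funext => -[u v]; rewrite fctZE /lmul1 /lmul2 /mul/= scaler_sumr.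
under eq_bigr do rewrite mulr_sumr.
under [RHS]eq_bigr do rewrite mulr_sumr scaler_sumr.
rewrite exchange_big/=; apply: eq_bigr => l _; apply: eq_bigr => k _.
rewrite /twist -!scalerAl -!scalerAr scalerA mulrCA.
rewrite (wdeg_take_drop deg k u) mulrDr.
have e1 : koszul (p * q) *: f (take k u) = koszul (wd (take k u) * q) *: f (take k u).
  by rewrite (koszul_hom hK _ (hf _)).
have e2 : koszul (q * wd (take k u)) *: g (take l v) =
  koszul (wd (take l v) * wd (take k u)) *: g (take l v).
  by rewrite (koszul_hom hK _ (hg _)).
set x := f _; set y := g _; set z := F _.
have -> : koszul (p * q) * koszul (wd (take l v) * wd (take k u) + wd (take l v) * wd
  (drop k u))
  = koszul (wd (take l v) * wd (drop k u)) * (koszul (p * q) * koszul (wd (take l v) *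
    wd (take k u))).
  by koszul_sign.
rewrite -[RHS]scalerA; congr (_ *: _); rewrite -scalerA scalerAl -e2 -scalerAl.
rewrite scalerA [koszul _ * koszul _]mulrC -scalerA (scalerAr (koszul (p * q)))
  (scalerAl (koszul (p * q))) e1.
rewrite -scalerAl -scalerAr scalerA.
by rewrite [q * _]mulrC koszul_sq scale1r.
Qed.

(** In the commutator of the two sums, the mixed terms cancel by [lmul12]. *)
Lemma primitive_gcomm p q f g : homT p f -> homT q g -> primitive f -> primitive g ->
    primitive (gcomm p q f g).
Proof.
move=> hf hg pf pg h; rewrite /gcomm mulBl mulZl.
rewrite (local_linearB _ _ local_linear_coprod) (local_linearZ _ _
  local_linear_coprod) -!mulA.
rewrite (pf (mul g h)) (pg (mul f h)) (pg h) (pf h) !lmul1D !lmul2D.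
rewrite (lmul12 _ hf hg) (lmul12 _ hg hf).
rewrite lmul1Bl lmul2Bl lmul1Zl lmul2Zl !lmul1A !lmul2A.
set a := lmul1 f _; set b := lmul2 g _; set c := lmul2 f (lmul1 _ _);
  set d := lmul2 f _.
set a' := lmul1 g _; set b' := lmul2 g _.
rewrite !scalerDr scalerA [q * p]mulrC koszul_sq scale1r.
by apply/funext => x; rewrite !(fctDE, fctNE); ring.
Qed.

(** The defect of primitivity is a local linear function of [f]. *)
Lemma primitive_cspan (B : set (seq X -> K)) f : (forall g, B g -> primitive g) ->
    cspan B f -> primitive f.
Proof.
move=> hB hf g; apply/subr0_eq.
pose H f := coprod (mul f g) - (lmul1 f (coprod g) + lmul2 f (coprod g)).
rewrite -/(H f); apply: (local_linear_kills_cspan _ _ hf) => [|h /hB ph];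
  last by rewrite /H ph subrr.
apply: local_linear_sub; first exact: (local_linear_comp local_linear_coprod
  (local_linear_mulr g)).
apply: local_linearD.
- split=> [h1 h2|c h|[u v]].
  + by apply/funext => p; rewrite /lmul1 mulDl.
  + by apply/funext => p; rewrite /lmul1 mul_scalel.
  + by have [_ _ /(_ u)[L hL]] := local_linear_mulr (fun u => coprod g (u, v));
    exists L => h /hL.
- split=> [h1 h2|c h|[u v]].
  + apply/funext => p; rewrite /lmul2 fctDE -fctDE -mulDl; congr (mul _ _ _).
    by apply/funext => w; rewrite /twist fctDE scalerDr.
  + apply/funext => p; rewrite /lmul2 /scale -[RHS]/(scale c (mul _ _) _) -mul_scalel;
    congr (mul _ _ _).
    by apply/funext => w; rewrite /twist /scale scalerAr.
  + have [_ _ /(_ v)[L hL]] := local_linear_mulr (fun v => coprod g (u, v));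
    exists L => h h0.
    by apply: hL => w /h0; rewrite /twist => ->; rewrite scaler0.
Qed.

Lemma lie_monomialP p f : lie_monomial gr deg p f ->
    [/\ homT p f, primitive f & f [::] = 0].
Proof.
elim=> [n g [hg h]|p' q' g h _ [hg pg g0] _ [hh ph h0]].
  by split=> //; [apply: primitive_letters|apply: h].
split; [exact: hom_gcomm|exact: primitive_gcomm|].
by rewrite /gcomm fctDE fctNE fctZE !mul_nil g0 h0 !mulr0 scaler0 subrr.
Qed.

Lemma Lie_hom n f : Lie gr deg n f -> homT n f. Proof. by case. Qed.

Lemma Lie_primitive n f : Lie gr deg n f -> primitive f.
Proof. by case=> _; apply: primitive_cspan => g [p /lie_monomialP[]]. Qed.

Lemma Lie_nil n f : Lie gr deg n f -> f [::] = 0.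
Proof.
case=> _ [A [c [l [hl _ ->]]]]; apply: fsbig1 => a _.
by have [p /lie_monomialP[_ _ ->]] := hl a; rewrite mulr0.
Qed.

(** * Derivations with primitive values are coderivations *)

Section DerivationShuffle.
Context (e : int) (phi : X -> seq X -> K).
Hypothesis phiP : vector_field gr deg e phi.
Hypothesis phi_prim : forall x, primitive (phi x).
Local Notation D := (der deg e phi).

(** The derivation of the graded tensor square that extends [D] on both factors. *)
Definition der2 F : seq X * seq X -> K := fun p =>
  D (fun u => F (u, p.2)) p.1 + koszul (e * wd p.1) *: D (fun v => F (p.1, v)) p.2.

Lemma hom_fix2 n F v : hom gr wdeg2 n F -> homT (n - wd v) (fun u => F (u, v)).
Proof. by move=> hF u; rewrite -addrA -opprD [wd v + _]addrC; apply: (hF (u, v)). Qed.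
Lemma hom_fix1 n F u : hom gr wdeg2 n F -> homT (n - wd u) (fun v => F (u, v)).
Proof. by move=> hF v; rewrite -addrA -opprD; apply: (hF (u, v)). Qed.

Lemma der2_cts_linear n : cts_linear gr wdeg2 wdeg2 n (n + e) der2.
Proof.
split=> [F hF [u v]|F G hF hG|[u v]].
- apply: (grD hK).
    have := der_hom hK phiP (hom_fix2 v hF) u.
    by congr gr; rewrite /wdeg2 /=; ring.
  apply: (grZ hK); have := der_hom hK phiP (hom_fix1 u hF) v.
  by congr gr; rewrite /wdeg2 /=; ring.
- apply/funext => -[u v]; rewrite fctDE /der2 /=.
  rewrite [fun u => _](_ : _ = (fun u => F (u, v)) + (fun u => G (u, v)))//.
  rewrite [X in _ + _ *: D X _](_ : _ = (fun v => F (u, v)) + (fun v => G (u, v)))//.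
  rewrite (der_add hK phiP (hom_fix2 v hF) (hom_fix2 v hG)).
  rewrite (der_add hK phiP (hom_fix1 u hF) (hom_fix1 u hG)).
  by rewrite !fctDE scalerDr addrACA.
- have [_ _ /(_ u)[L1 h1]] := der_cts_linear hK phiP (n - wd v).
  have [_ _ /(_ v)[L2 h2]] := der_cts_linear hK phiP (n - wd u).
  exists ([seq (a, v) | a <- L1] ++ [seq (u, b) | b <- L2]) => F hF h0.
  rewrite /der2 /= h1 ?h2 ?scaler0 ?addr0//.
  + exact: hom_fix1.
  + by move=> b bL; apply: h0; rewrite mem_cat (map_f (fun b => (u, b)))// orbT.
  + exact: hom_fix2.
  + by move=> a aL; apply: h0; rewrite mem_cat (map_f (fun a => (a, v))).
Qed.

Lemma der2_scale n c F : hom gr wdeg2 n F -> der2 (scale c F) = scale c (der2 F).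
Proof.
move=> hF; apply/funext => -[u v]; rewrite /der2 /scale /=.
rewrite -[fun u => _]/(scale c (fun u => F (u, v))) (der_scale phiP _ (hom_fix2 v hF)).
rewrite -[X in _ + _ *: D X _]/(scale c (fun v => F (u,
  v))) (der_scale phiP _ (hom_fix1 u hF)).
by rewrite /scale mulrDr scalerAr.
Qed.

Lemma hom_lmul1 p n f F : homT p f -> hom gr wdeg2 n F ->
    hom gr wdeg2 (p + n) (lmul1 f F).
Proof.
move=> hf hF [u v]; have := hom_mul hK hf (hom_fix2 v hF) u.
by congr gr; rewrite /wdeg2 /=; ring.
Qed.

Lemma hom_lmul2 p n f F : homT p f -> hom gr wdeg2 n F ->
    hom gr wdeg2 (p + n) (lmul2 f F).
Proof.
move=> hf hF [u v]; rewrite /lmul2 /= (twist_hom _ hf) mulZl.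
have := homZ hK (koszul (p * wd u)) (hom_mul hK hf (hom_fix1 u hF)) v.
by congr gr; rewrite /wdeg2 /=; ring.
Qed.

Lemma der_zero : D 0 = 0.
Proof. exact: (cts_linear0 hK (der_cts_linear hK phiP 0)). Qed.

Lemma der2_lmul1 n x G : hom gr wdeg2 n G ->
  der2 (lmul1 (elt K [:: x]) G) =
  lmul1 (phi x) G + koszul (e * deg x) *: lmul1 (elt K [:: x]) (der2 G).
Proof.
move=> hG; have hx := hom_letter hK deg x.
apply/funext => -[u v]; rewrite fctDE fctZE {1}/der2 /lmul1 /=.
rewrite (der_mul hK phiP hx (hom_fix2 v hG)) der_letter !fctDE fctZE -addrA;
  congr (_ + _).
rewrite [fun u => der2 G _](_ : _ = D (fun u => G (u, v)) +
   (fun u => koszul (e * wd u) *: D (fun v => G (u, v)) v))//.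
rewrite mulDr fctDE scalerDr; congr (_ + _).
case: u => [|y u].
  rewrite [fun v => _](_ : _ = 0); last by apply/funext => w; rewrite mul_letter_nil.
  by rewrite der_zero mul_letter_nil !scaler0.
rewrite [fun v => _](_ : _ = scale (x == y)%:R (fun v => G (u, v))); last first.
  by apply/funext => w; rewrite mul_letter.
rewrite (der_scale phiP _ (hom_fix1 u hG)) mul_letter /scale.
case: eqP => [->|_]; last by rewrite !mul0r !scaler0.
rewrite !mul1r scalerA wdeg_cons mulrDr; congr (_ *: _); by koszul_sign.
Qed.

Lemma der2_lmul2 n x G : hom gr wdeg2 n G ->
  der2 (lmul2 (elt K [:: x]) G) =
  lmul2 (phi x) G + koszul (e * deg x) *: lmul2 (elt K [:: x]) (der2 G).
Proof.
move=> hG; have hx := hom_letter hK deg x.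
apply/funext => -[u v]; rewrite fctDE fctZE {1}/der2 /lmul2 /=.
rewrite (twist_hom _ hx) (twist_hom _ (phiP.1 x)) mulZl.
rewrite [X in _ + _ *: D X _](_ : _ =
  koszul (deg x * wd u) *: mul (elt K [:: x]) (fun v => G (u, v)))//.
have hGu := hom_fix1 u hG.
rewrite (der_rat phiP _ (hom_mul hK hx hGu)) (der_mul hK phiP hx hGu) der_letter.
rewrite [fun v => der2 G _](_ : _ = (fun v => D (fun u => G (u, v)) u) +
   koszul (e * wd u) *: D (fun v => G (u, v)))//.
rewrite mulZl mulDr mulZr !(fctDE, fctZE).
have -> : D (fun u0 => mul (twist (wd u0) (elt K [:: x])) (fun v0 => G (u0, v0)) v) u =
   koszul (e * deg x) *: (koszul (deg x * wd u) *: mul (elt K [:: x]) (fun v0 =>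
     D (fun u0 => G (u0, v0)) u) v).
  case: v => [|y v].
    rewrite [fun u => _](_ : _ = 0); last first.
      by apply/funext => w; rewrite (twist_hom _ hx) mulZl fctZE mul_letter_nil scaler0.
    by rewrite der_zero mul_letter_nil !scaler0.
  have hGv := hom_fix2 v hG.
  rewrite [fun u => _](_ : _ = scale (x == y)%:R (koszul (deg x * (n - wd v)) *: (fun
    u => G (u, v)))).
    rewrite (der_scale phiP _ (homZ hK _ hGv)) (der_rat phiP _ hGv) mul_letter /scale
      fctZE !scalerAr.
    congr (_ * _).
    have hD := der_hom hK phiP hGv u.
    rewrite [deg x * wd u]mulrC -(koszul_hom hK (deg x) hD) scalerA; congr (_ *: _).
    by rewrite [(n - wd v + e) * _]mulrC mulrDr [e * _]mulrC; koszul_sign.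
  apply/funext => w; rewrite (twist_hom _ hx) mulZl fctZE mul_letter /scale fctZE
    scalerAr; congr (_ * _).
  by rewrite ![deg x * _]mulrC (koszul_hom hK _ (hGv w)).
rewrite !mulZl !fctZE !scalerDr !scalerA addrCA; congr (_ + (_ *: _ + _ *: _)).
- by rewrite mulrDl; koszul_sign.
- by koszul_sign.
Qed.

Lemma der2_concat n F : hom gr wdeg2 n F -> concat (der2 F) = D (concat F).
Proof.
move=> hF.
have h1 : cts_linear gr wdeg2 wd n (n + e) (fun F => concat (der2 F)).
  apply: (cts_linear_comp hK _ (der2_cts_linear n)); apply: local_linear_is_cts;
    first exact: local_linear_concat.
  exact: concat_hom.
have h2 : cts_linear gr wdeg2 wd n (n + e) (fun F => D (concat F)).
  apply: (cts_linear_comp hK (der_cts_linear hK phiP n)); apply: local_linear_is_cts;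
    first exact: local_linear_concat.
  exact: concat_hom.
apply: (cts_linear_eq hK h1 h2 (Q := fun=> True)) => // -[u v] c _ hc.
have [_ MZ _] := local_linear_concat.
have hu := hom_elt hK wd u; have hv := hom_elt hK wd v.
rewrite (der2_scale _ (hom_elt hK wdeg2 (u, v))) !MZ.
rewrite [concat (elt _ _)](_ : _ = mul (elt K u) (elt K v));
  last by rewrite elt_tens concat_tens.
rewrite (der_scale phiP _ (hom_mul hK hu hv)) (der_mul hK phiP hu hv); congr scale.
have -> : der2 (elt K (u, v)) = tens (D (elt K u)) (elt K v) +
    koszul (e * wd u) *: tens (elt K u) (D (elt K v)).
  apply/funext => -[a b]; rewrite elt_tens /der2 /tens /= fctDE fctZE /=; congr (_ + _).
    rewrite [fun u => _](_ : _ = scale (elt K v b) (elt K u)).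
      by rewrite (der_scale phiP _ hu) /scale mulrC.
    by apply/funext => w; rewrite /scale mulrC.
  rewrite -[fun v => _]/(scale (elt K u a) (elt K v)) (der_scale phiP _ hv) /scale.
  by rewrite {1 3}/elt; case: eqP => [->//|_]; rewrite !mul0r !scaler0.
have [MD _ _] := local_linear_concat.
by rewrite MD (local_linearZ _ _ local_linear_concat) !concat_tens.
Qed.

(** Induction on words: both sides obey the Leibniz rule along left
    multiplication by a letter, and the values of [D] on letters are primitive. *)
Lemma der2_coprod n f : homT n f -> coprod (D f) = der2 (coprod f).
Proof.
move=> hf.
have h1 : cts_linear gr wd wdeg2 n (n + e) (fun f => coprod (D f)).
  apply: (cts_linear_comp hK _ (der_cts_linear hK phiP n));
    apply: local_linear_is_cts; first exact: local_linear_coprod.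
  exact: coprod_hom.
have h2 : cts_linear gr wd wdeg2 n (n + e) (fun f => der2 (coprod f)).
  apply: (cts_linear_comp hK (der2_cts_linear n)); apply: local_linear_is_cts;
    first exact: local_linear_coprod.
  exact: coprod_hom.
apply: (cts_linear_eq hK h1 h2 (Q := fun=> True)) => // w c _ hc.
have [SD SZ _] := local_linear_coprod.
rewrite der_scale_elt !SZ (der2_scale _ (coprod_hom (hom_elt hK wd w))); congr scale.
elim: w {hc} => [|x w IH].
  rewrite der_elt /= (local_linear0 local_linear_coprod) coprod_nil.
  apply/funext => -[a b]; rewrite elt_tens /der2 /tens /=.
  rewrite [fun u => _](_ : _ = scale (elt K [::] b) (elt K [::])).
    rewrite -[X in _ + _ *: D X _]/(scale (elt K [::] a) (elt K [::])).
    by rewrite !der_scale_elt !der_elt /= !scaler_fun scaler0 addr0.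
  by apply/funext => w; rewrite /scale mulrC.
have hx := hom_letter hK deg x; have hw := hom_elt hK wd w.
have px : primitive (elt K [:: x]).
  by apply: primitive_letters => v; apply: elt_letter_off.
rewrite [elt K (x :: w)]elt_cons (der_mul hK phiP hx hw) der_letter SD (local_linearZ
  _ _ local_linear_coprod).
rewrite phi_prim !px IH.
have hS := coprod_hom hw.
have [_ addD _] := der2_cts_linear (deg x + wd w).
by rewrite addD ?(der2_lmul1 _ hS) ?(der2_lmul2 _ hS) ?scalerDr 1?addrACA//;
  [apply: hom_lmul1|apply: hom_lmul2].
Qed.

(** A continuous derivation with primitive values on generators is also a
    coderivation, and it is compatible with [mu] since it is a derivation. *)
Lemma der_shuffle n f : homT n f -> s (D f) = D (s f).
Proof.
by move=> hf; rewrite !shuffleE (der2_coprod hf) (der2_concat (coprod_hom hf)).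
Qed.
End DerivationShuffle.
End Shuffle.

(** * The filtration by the number of Lie factors *)

(** Finite linear combinations, as an inductive predicate so that linear
    statements are proved by induction. *)
Inductive qspan (V : lmodType rat) (B : set V) : V -> Prop :=
| qspan_in v : B v -> qspan B v
| qspan0 : qspan B 0
| qspanD u v : qspan B u -> qspan B v -> qspan B (u + v)
| qspanZ a v : qspan B v -> qspan B (a *: v).

Section QSpan.
Context (V : lmodType rat) (B : set V).

Lemma qspan_map (W : lmodType rat) (C : set W) (F : V -> W) :
  (forall u v, F (u + v) = F u + F v) -> (forall a v, F (a *: v) = a *: F v) ->
  (forall v, B v -> qspan C (F v)) -> forall v, qspan B v -> qspan C (F v).
Proof.
move=> FD FZ FB v; elim=> [u /FB//||u w _ IHu _ IHw|a u _ IH].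
- by have := FZ 0 0; rewrite !scale0r => ->; apply: qspan0.
- by rewrite FD; apply: qspanD.
- by rewrite FZ; apply: qspanZ.
Qed.
End QSpan.

Section PBW.
Context (K : comAlgType rat) (gr : int -> set K) (hK : even_grading gr).
Context (X : choiceType) (deg : X -> int).
Implicit Types (f g h : seq X -> K) (u v w : seq X) (F G : seq X * seq X -> K).
Local Notation wd := (wdeg deg).
Local Notation homT := (hom gr wd).
Local Notation s := (@shuffle K X deg).
Local Notation cop := (@coprod K X deg).
Local Notation lm2 := (lmul2 deg).
Local Notation lie := (lie_monomial gr deg).
Implicit Types (l : seq (int * (seq X -> K))).

Fixpoint all_lie l : Prop := if l is pf :: l' then lie pf.1 pf.2 /\ all_lie l' else
    True.
Definition lie_prod l : seq X -> K := foldr (fun pf => mul pf.2) (elt K [::]) l.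
Definition lie_prod_deg l : int := \sum_(pf <- l) pf.1.

Lemma all_lie_cat l1 l2 : all_lie l1 -> all_lie l2 -> all_lie (l1 ++ l2).
Proof. by elim: l1 => //= pf l1 IH [h /IH h1] /h1. Qed.

Lemma lie_prod_cat l1 l2 : lie_prod (l1 ++ l2) = mul (lie_prod l1) (lie_prod l2).
Proof. by elim: l1 => [|pf l1 IH] /=; rewrite ?mul_elt_nil// IH mulA. Qed.

Lemma lie_prod_hom l : all_lie l -> homT (lie_prod_deg l) (lie_prod l).
Proof.
elim: l => [_|pf l IH [h /IH hl]]; rewrite /lie_prod_deg ?big_nil ?big_cons.
  by rewrite -(wdeg_nil deg); apply: hom_elt.
by have [hp _ _] := lie_monomialP hK h; apply: hom_mul.
Qed.

(** The filtration by the number of Lie factors.  The empty product is excluded,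
    so that step [0] is zero. *)
Definition lie_fil (k : nat) : (seq X -> K) -> Prop :=
  qspan [set f | exists l, [/\ all_lie l, (0 < size l)%N,
    (size l <= k)%N & f = lie_prod l]].
(** The corresponding subspaces of the tensor square, for a fixed total number
    of factors. *)
Definition lie_fil2 (k : nat) : (seq X * seq X -> K) -> Prop :=
  qspan [set F | exists l1 l2, [/\ all_lie l1, all_lie l2, (size l1 + size l2)%N = k &
    F = tens (lie_prod l1) (lie_prod l2)]].

Lemma lie_fil_le k k' f : (k <= k')%N -> lie_fil k f -> lie_fil k' f.
Proof.
move=> kk'; apply: (qspan_map (F := id)) => // g [l [h1 h2 h3 ->]].
by apply: qspan_in; exists l; split=> //; apply: leq_trans kk'.
Qed.

Lemma lie_fil0 f : lie_fil 0 f -> f = 0.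
Proof.
elim=> [g [l [_ h0 h1 _]]|//|g h _ -> _ ->|a g _ ->]; rewrite ?addr0 ?scaler0//.
by move: (leq_trans h0 h1).
Qed.

Lemma lie_fil_mul p a k f : lie p a -> lie_fil k f -> lie_fil k.+1 (mul a f).
Proof.
move=> ha; apply: qspan_map => [g h|c g|g [l [h1 h2 h3 ->]]]; rewrite ?mulDr ?mulZr//.
by apply: qspan_in; exists ((p, a) :: l); split.
Qed.

Lemma lie_fil_mul_pred p a k f : lie p a -> lie_fil k.-1 f -> lie_fil k (mul a f).
Proof.
case: k => [|k] ha; last by move=> hf; apply: (lie_fil_mul ha).
by move=> /lie_fil0->; rewrite mulf0; apply: qspan0.
Qed.

(** Moving a Lie factor to the front costs commutators, each of which merges two
    Lie factors into one. *)
Lemma lie_fil_reorder p a l1 l2 : lie p a -> all_lie l1 -> all_lie l2 ->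
  lie_fil (size l1 + size l2) (mul (lie_prod l1) (mul a (lie_prod l2)) -
    koszul (p * lie_prod_deg l1) *: mul a (mul (lie_prod l1) (lie_prod l2))).
Proof.
move=> ha hl1 hl2; elim: l1 hl1 => [_|[q b] l1 IH [/= hb hl1]].
  by rewrite /lie_prod_deg big_nil mulr0 koszul0 scale1r !mul_elt_nil subrr;
    apply: qspan0.
set A := lie_prod l1; set B := lie_prod l2.
have -> : mul (mul b A) (mul a B) - koszul (p * lie_prod_deg ((q,
  b) :: l1)) *: mul a (mul (mul b A) B) =
   mul b (mul A (mul a B) - koszul (p * lie_prod_deg l1) *: mul a (mul A B)) +
   koszul (p * lie_prod_deg l1) *: mul (gcomm q p b a) (mul A B).
  rewrite mulBr mulZr /gcomm mulBl mulZl scalerBr scalerA !mulA /lie_prod_deg big_cons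
    /= addrA subrK.
  by congr (_ - _ *: _); rewrite mulrDr; koszul_sign.
apply: qspanD; first exact: (lie_fil_mul hb (IH hl1)).
apply: qspanZ; apply: qspan_in; exists ((q + p, gcomm q p b a) :: l1 ++ l2);
  split => //=.
- by split; [apply: lie_bracket|apply: all_lie_cat].
- by rewrite size_cat addSn.
- by rewrite -/(lie_prod (l1 ++ l2)) lie_prod_cat.
Qed.

Lemma lmul2_tens p a f g q : homT p a -> homT q f ->
  lm2 a (tens f g) = koszul (p * q) *: tens f (mul a g).
Proof.
move=> ha hf; apply/funext => -[u v]; rewrite fctZE /lmul2 /tens /=.
rewrite (twist_hom hK _ ha) mulZl fctZE -[fun v => _]/(scale (f u) g) mul_scaler /scale.
by rewrite !scalerAl [p * wd u]mulrC [p * q]mulrC (koszul_hom hK _ (hf u)).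
Qed.

Lemma lmul1_tens a f g : lmul1 a (tens f g) = tens (mul a f) g.
Proof.
apply/funext => -[u v]; rewrite /lmul1 /tens /= [fun u => _](_ : _ = scale (g v) f).
  by rewrite mul_scaler /scale mulrC.
by apply/funext => w; rewrite /scale mulrC.
Qed.

(** Multiplying by [a (x) 1 + 1 (x) a] and then applying [mu] amounts to
    multiplying by [2 a], up to a reordering. *)
Lemma lie_fil2_step p a k F : lie p a -> lie_fil2 k F ->
  [/\ lie_fil2 k.+1 (lmul1 a F), lie_fil2 k.+1 (lm2 a F),
    concat (lmul1 a F) = mul a (concat F) &
    lie_fil k (concat (lm2 a F) - mul a (concat F))].
Proof.
move=> la; have [ha _ _] := lie_monomialP hK la.
have [MD _ _] := local_linear_concat K X;
  have MZ := local_linearZ _ _ (local_linear_concat K X).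
elim=> {F} [F [l1 [l2 [h1 h2 e ->]]]||F G _ [a1 a2 a3 a4] _ [b1 b2 b3 b4]|c F _ [a1 a2
  a3 a4]].
- have hA := lie_prod_hom h1;
  rewrite lmul1_tens (lmul2_tens _ ha hA) MZ !concat_tens -e mulA; split=> //.
  + by apply: qspan_in; exists ((p, a) :: l1), l2.
  + by apply: qspanZ; apply: qspan_in; exists l1, ((p, a) :: l2); split=> //;
    rewrite /= addnS.
  + have := qspanZ (koszul (p * lie_prod_deg l1)) (lie_fil_reorder la h1 h2).
    by rewrite scalerBr scalerA koszul_sq scale1r -mulA.
- have z1 : lmul1 a 0 = 0 by have := lmul1Z a 0 0; rewrite !scale0r.
  have z2 : lm2 a 0 = 0 by have := lmul2Z deg a 0 0; rewrite !scale0r.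
  by rewrite z1 z2 (local_linear0 (local_linear_concat K X)) mulf0 subrr; split => //;
    apply: qspan0.
- rewrite !lmul1D !lmul2D !MD mulDr a3 b3; split => //; try exact: qspanD.
  by rewrite opprD addrACA; apply: qspanD.
- rewrite !lmul1Z !lmul2Z !MZ mulZr a3; split => //; try exact: qspanZ.
  by rewrite -scalerBr; apply: qspanZ.
Qed.

(** Each primitive factor contributes [a (x) 1 + 1 (x) a], hence a factor [2]
    after reordering. *)
Lemma shuffle_lie_prod l : all_lie l -> lie_fil2 (size l) (cop (lie_prod l)) /\
  lie_fil (size l).-1 (s (lie_prod l) - lambda (size l) *: lie_prod l).
Proof.
elim: l => [_|[p a] l IH [/= la hl]].
  rewrite /lambda expr0 scale1r /= shuffleE coprod_nil elt_tens concat_tens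
    mul_elt_nil subrr.
  by split; [apply: qspan_in; exists [::], [::]|apply: qspan0].
have [h1 h2] := IH hl; have [ha pa _] := lie_monomialP hK la.
have [MD _ _] := local_linear_concat K X.
have [a1 a2 a3 a4] := lie_fil2_step la h1.
rewrite /= -/(lie_prod l) pa; split; first exact: qspanD.
rewrite shuffleE pa MD a3 -shuffleE.
have -> : mul a (s (lie_prod l)) + concat (lm2 a (cop (lie_prod l))) - lambda (size
  l).+1 *: mul a (lie_prod l)
  = (concat (lm2 a (cop (lie_prod l))) - mul a (concat (cop (lie_prod l)))) +
    2%:R *: mul a (s (lie_prod l) - lambda (size l) *: lie_prod l).
  rewrite -shuffleE mulBr mulZr scalerBr scalerA /lambda exprS !scaler_nat !mulr2n.
  by apply/funext => w; rewrite !(fctDE, fctNE); ring.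
by apply: qspanD => //; apply: qspanZ; apply: lie_fil_mul_pred la h2.
Qed.

Lemma shuffle_lie_fil k f : (0 < k)%N -> lie_fil k f ->
    lie_fil k.-1 (s f - lambda k *: f).
Proof.
move=> k0; have sZ := local_linearZ _ _ (local_linear_shuffle K deg);
  have [sD _ _] := local_linear_shuffle K deg.
apply: (qspan_map (F := fun f => s f - lambda k *: f)) => [g h|c g|g [l [hl l0 lk ->]]].
- by rewrite sD scalerDr opprD addrACA.
- by rewrite sZ scalerBr !scalerA mulrC.
have [_ h] := shuffle_lie_prod hl; have [->//|lk'] := eqVneq k (size l).
have lk1 : (size l <= k.-1)%N.
  by rewrite -ltnS prednK// ltn_neqAle eq_sym lk' lk.
rewrite -[s _](subrK (lambda (size l) *: lie_prod l)) -addrA -scalerBl.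
apply: qspanD; first by apply: lie_fil_le h; apply: leq_trans (leq_pred _) lk1.
by apply: qspanZ; apply: qspan_in; exists l.
Qed.

(** The factor with the last index of the list acts first. *)
Definition shift_prod (rs : seq nat) f : seq X -> K :=
  foldr (fun r h => s h - lambda r *: h) f rs.

Lemma shift_prod_lie_fil n f : lie_fil n f -> shift_prod (iota 1 n) f = 0.
Proof.
elim: n f => [|n IH] f hf; first exact: lie_fil0.
have -> : iota 1 n.+1 = iota 1 n ++ [:: n.+1] by rewrite -(addn1 n) iotaD add1n addn1.
rewrite /shift_prod foldr_cat -/(shift_prod _ _); apply: IH.
exact: (@shuffle_lie_fil n.+1).
Qed.

Lemma lie_fil_elt w : (0 < size w)%N -> lie_fil (size w) (elt K w).
Proof.
move=> w0; apply: qspan_in; exists (map (fun x => (deg x, elt K [:: x])) w).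
rewrite size_map; split => //; elim: w {w0} => [|x w IH] //=.
  split=> //; apply: lie_gen; split; first exact: hom_letter.
  by move=> u; apply: elt_letter_off.
by rewrite -/(lie_prod _) -IH mul_elt.
Qed.

Lemma local_linear_shift_prod rs : local_linear (shift_prod rs).
Proof.
elim: rs => [|r rs IH]; first exact: local_linear_id.
apply: local_linear_sub; first exact: (local_linear_comp (local_linear_shuffle K deg)
  IH).
exact: local_linear_scal.
Qed.

Lemma shift_prod_size rs f g n : (forall w, size w = n -> f w = g w) ->
  forall w, size w = n -> shift_prod rs f w = shift_prod rs g w.
Proof.
move=> fg; elim: rs => [|r rs IH] //= w hw.
by rewrite !(fctDE, fctNE, fctZE) (shuffle_size deg IH)// IH.
Qed.

(** A word of length [n] is a product of [n] Lie elements, and the factor [s -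
    2^k] lowers the filtration from step [k] to step [k - 1]. *)
Lemma shift_prod_positive f w : (0 < size w)%N -> shift_prod (iota 1 (size w)) f w = 0.
Proof.
move=> w0; have [L uL [_ ->]] := local_linearE w (local_linear_shift_prod (iota 1
  (size w))).
rewrite big1// => v _; have [e|ne] := eqVneq (size v) (size w).
  by rewrite -e shift_prod_lie_fil ?mulr0//; apply: lie_fil_elt; rewrite e.
rewrite (@shift_prod_size _ _ 0 (size w)) ?(local_linear0 (local_linear_shift_prod _))
  ?mulr0//.
by move=> u hu; rewrite /elt; case: (v =P u) ne => [->|//]; rewrite hu eqxx.
Qed.

Lemma shift_prod_all f w : shift_prod (iota 0 (size w).+1) f w = 0.
Proof.
case: w => [|x w].
  by rewrite /= !(fctDE, fctNE, fctZE) shuffle_nil /lambda expr0 scale1r subrr.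
rewrite [size (x :: w)]/= -[iota 0 _]/(0%N :: iota 1 (size w).+1).
rewrite -[shift_prod _ f]/(s (shift_prod (iota 1 (size w).+1) f) - lambda 0 *:
  shift_prod (iota 1 (size w).+1) f).
rewrite !(fctDE, fctNE, fctZE) (@shift_prod_positive _ (x :: w))// scaler0 subr0.
rewrite (@shuffle_size _ _ _ _ 0 (size w).+1)// ?(local_linear0 (local_linear_shuffle
  K deg))// => v hv.
by have := @shift_prod_positive f v; rewrite hv; apply.
Qed.
End PBW.

(** * Lagrange interpolation and the idempotents *)

Section PolynomialAction.
Context (K : comAlgType rat) (S : choiceType) (sg : (S -> K) -> (S -> K)).
Hypothesis sgP : local_linear sg.
Implicit Types (f g : S -> K) (p q : {poly rat}).

Definition poly_act p f : S -> K := \sum_(i < size p) p`_i *: iter i sg f.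

Lemma poly_actE n p f : (size p <= n)%N ->
    poly_act p f = \sum_(i < n) p`_i *: iter i sg f.
Proof.
move=> pn; rewrite /poly_act (big_ord_widen n (fun i =>
  p`_i *: iter i sg f) pn) big_mkcond/=.
apply: eq_bigr => i _; case: ltnP => // h; by rewrite nth_default// scale0r.
Qed.

Lemma poly_actD p q f : poly_act (p + q) f = poly_act p f + poly_act q f.
Proof.
have le1 := leq_maxl (size p) (size q); have le2 := leq_maxr (size p) (size q).
rewrite !(@poly_actE (maxn (size p) (size q)))// ?size_polyD// -big_split/=.
by apply: eq_bigr => i _; rewrite coefD scalerDl.
Qed.

Lemma poly_actZ a p f : poly_act (a *: p) f = a *: poly_act p f.
Proof.
rewrite !(@poly_actE (size p))// ?size_scale_leq// scaler_sumr.
by apply: eq_bigr => i _; rewrite coefZ scalerA.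
Qed.

Lemma poly_act0 f : poly_act 0 f = 0.
Proof. by rewrite /poly_act size_poly0 big_ord0. Qed.

Lemma poly_act1 f : poly_act 1 f = f.
Proof. by rewrite /poly_act size_poly1 big_ord1 coef1 scale1r. Qed.

Lemma poly_act_sum (I : Type) (r : seq I) (P : I -> {poly rat}) f :
  poly_act (\sum_(i <- r) P i) f = \sum_(i <- r) poly_act (P i) f.
Proof. by elim: r => [|i r IH];
  rewrite ?big_nil ?poly_act0// !big_cons poly_actD IH. Qed.

(** The annihilating polynomials are products of linear factors, on which this
    rule determines the action. *)
Lemma poly_act_factor c p f : poly_act (('X - c%:P) * p) f =
    sg (poly_act p f) - c *: poly_act p f.
Proof.
rewrite mulrBl mul_polyC -scaleNr poly_actD poly_actZ scaleNr; congr (_ - _).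
rewrite (@poly_actE (size p).+1); last first.
  by apply: leq_trans (size_polyMleq _ _) _; rewrite size_polyX.
rewrite big_ord_recl coefXM/= scale0r add0r /poly_act (local_linear_sum _ _ sgP).
by apply: eq_bigr => i _; rewrite coefXM/= (local_linearZ _ _ sgP).
Qed.

Lemma poly_act_eigen c p f : sg f = c *: f -> poly_act p f = p.[c] *: f.
Proof.
move=> e; rewrite horner_coef scaler_suml; apply: eq_bigr => i _.
rewrite -scalerA; congr (_ *: _); elim: (i : nat) => [|k IH];
  first by rewrite expr0 scale1r.
by rewrite iterS IH (local_linearZ _ _ sgP) e scalerA exprSr.
Qed.
End PolynomialAction.

Section Lagrange.

Lemma lambda_inj : injective lambda.
Proof. by move=> i j; apply: ieexprIn. Qed.

(** The Lagrange interpolation polynomials for the nodes [2^0, ..., 2^n]. *)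
Definition lagrange (n j : nat) : {poly rat} :=
  (\prod_(0 <= r < n.+1 | r != j) (lambda j - lambda r))^-1 *:
    \prod_(0 <= r < n.+1 | r != j) ('X - (lambda r)%:P).

Lemma lagrange_eval n i j : (i <= n)%N -> (j <= n)%N ->
    (lagrange n i).[lambda j] = (i == j)%:R.
Proof.
move=> hi hj; rewrite /lagrange hornerZ horner_prod.
under [X in _ * X]eq_bigr do rewrite hornerXsubC.
have [->|ne] := eqVneq i j.
  rewrite mulVf//; rewrite prodf_seq_neq0; apply/allP => r _; apply/implyP => rj.
  by rewrite subr_eq0 (inj_eq lambda_inj) eq_sym.
apply/eqP; rewrite mulf_eq0 prodf_seq_eq0; apply/orP; right; apply/hasP; exists j.
  by rewrite mem_index_iota ltnS.
by rewrite eq_sym ne subrr eqxx.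
Qed.

Lemma size_lagrange n j : (j <= n)%N -> (size (lagrange n j) <= n.+1)%N.
Proof.
move=> jn; apply: leq_trans (size_scale_leq _ _) _; rewrite -big_filter.
rewrite size_prod_XsubC -rem_filter ?iota_uniq// size_rem ?mem_index_iota//.
by rewrite size_iota subn0.
Qed.

(** The difference of the two sides has degree at most [n] and vanishes at the
    [n + 1] nodes. *)
Lemma sum_lagrange n : \sum_(0 <= j < n.+1) lagrange n j = 1.
Proof.
apply/subr0_eq; set p := _ - 1.
apply: (@roots_geq_poly_eq0 _ p [seq lambda i | i <- iota 0 n.+1]).
- apply/allP => x /mapP[i]; rewrite mem_iota add0n ltnS => hi ->.
  rewrite rootE /p hornerD hornerN hornerC horner_sum (bigD1_seq i) ?iota_uniq
    ?mem_index_iota//=.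
  rewrite lagrange_eval// eqxx big_seq_cond big1 ?addr0 ?subrr// => j.
  by rewrite mem_index_iota ltnS => /andP[jn /negPf ji]; rewrite lagrange_eval// ji.
- by rewrite map_inj_uniq ?iota_uniq//; apply: lambda_inj.
- rewrite size_map size_iota; apply: leq_trans (size_polyD _ _) _.
  rewrite geq_max size_polyN size_poly1 andbT; apply: leq_trans (size_sum _ _ _) _.
  by apply/bigmax_leqP_seq => j; rewrite mem_index_iota ltnS => jn _;
    apply: size_lagrange.
Qed.

Lemma lagrange_factor n j : (j <= n)%N ->
  ('X - (lambda j)%:P) * lagrange n j =
  (\prod_(0 <= r < n.+1 | r != j) (lambda j - lambda r))^-1 *:
    \prod_(r <- iota 0 n.+1) ('X - (lambda r)%:P).
Proof.
move=> jn; rewrite /lagrange -scalerAr; congr (_ *: _).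
by rewrite [RHS](bigD1_seq j) ?iota_uniq// mem_iota.
Qed.
End Lagrange.

Section Idempotents.
Context (K : comAlgType rat) (gr : int -> set K) (hK : even_grading gr).
Context (X : choiceType) (deg : X -> int).
Implicit Types (f g h : seq X -> K) (u v w : seq X).
Local Notation wd := (wdeg deg).
Local Notation homT := (hom gr wd).
Local Notation s := (@shuffle K X deg).
Local Notation e := (@e_idem K X deg).
Let sP := local_linear_shuffle K deg.

Lemma shift_prodE rs f : shift_prod deg rs f =
    poly_act s (\prod_(r <- rs) ('X - (lambda r)%:P)) f.
Proof.
elim: rs => [|r rs IH]; first by rewrite big_nil poly_act1.
by rewrite big_cons (poly_act_factor sP) -IH.
Qed.

Lemma big_comp_shift (rs : seq nat) (P : pred nat) f :
  (\big[(fun F G => F \o G)/id]_(r <- rs | P r) (fun g => s g - lambda r *: g)) f =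
  shift_prod deg [seq r <- rs | P r] f.
Proof.
elim: rs => [|r rs IH]; first by rewrite big_nil.
by rewrite big_cons /=; case: (P r) => //=; rewrite IH.
Qed.

(** Truncation to the length of [w] has no effect because [s] preserves lengths. *)
Lemma e_idemE j f w : e j f w =
  if (j <= size w)%N then poly_act s (lagrange (size w) j) f w else 0.
Proof.
rewrite /e_idem /e_comp; case: ifP => // jn.
rewrite /lagrange poly_actZ !fctZE big_comp_shift -[X in poly_act _ X]big_filter
  -shift_prodE; congr (_ *: _).
by apply: (@shift_prod_size _ _ _ _ _ _ (size w)) => // v hv; rewrite /tpart hv eqxx.
Qed.

Lemma local_linear_poly_act (p : {poly rat}) : local_linear (poly_act s p).
Proof.
rewrite /poly_act; elim: (size p) => [|n IH].
  have -> : (fun f => \sum_(i < 0) p`_i *: iter i s f) = fun=> 0 by apply/funext => f;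
    rewrite big_ord0.
  exact: local_linear_null.
have -> : (fun f => \sum_(i < n.+1) p`_i *: iter i s f) =
  fun f => \sum_(i < n) p`_i *: iter i s f + p`_n *: iter n s f by apply/funext => f;
    rewrite big_ord_recr.
apply: local_linearD => //; apply: local_linear_scal; elim: n {IH} => [|n IH];
  first exact: local_linear_id.
exact: (local_linear_comp sP IH).
Qed.

Lemma poly_act_hom (p : {poly rat}) n f : homT n f -> homT n (poly_act s p f).
Proof.
move=> hf; apply: hom_sum => // i; apply: homZ => //.
by elim: (i : nat) => [//|k IH]; rewrite iterS; apply: shuffle_hom.
Qed.

Lemma local_linear_e_idem j : local_linear (e j).
Proof.
apply: local_linear_pointwise => w; have [jn|jn] := boolP (j <= size w)%N.
  by exists (poly_act s (lagrange (size w) j)) => [|f];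
    [apply: local_linear_poly_act|rewrite e_idemE jn].
by exists (fun=> 0) => [|f]; [apply: local_linear_null|rewrite e_idemE (negPf jn)].
Qed.

Lemma e_idem_hom j n f : homT n f -> homT n (e j f).
Proof.
move=> hf w; rewrite e_idemE; case: ifP => _; last exact: gr0.
exact: poly_act_hom.
Qed.

Lemma e_idem_gt j f w : (size w < j)%N -> e j f w = 0.
Proof. by rewrite e_idemE ltnNge => /negPf->. Qed.

Lemma e_idem_sum f w : f w = \sum_(0 <= j < (size w).+1) e j f w.
Proof.
rewrite -{1}[f](poly_act1 s) -(sum_lagrange (size w)) poly_act_sum fct_sumE.
by apply: eq_big_nat => j; rewrite ltnS e_idemE => /andP[_ ->].
Qed.

(** Times [X - 2^j], the interpolation polynomial becomes a multiple of the
    product over all nodes, which annihilates [s]. *)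
Lemma e_idem_eigen j f : s (e j f) = lambda j *: e j f.
Proof.
apply/funext => w; rewrite fctZE; have [jn|jn] := leqP j (size w); last first.
  rewrite e_idem_gt// scaler0 (@shuffle_size _ _ deg _ 0 (size w))// ?(local_linear0
    sP)// => v hv.
  by rewrite e_idem_gt// hv.
rewrite (@shuffle_size _ _ deg _ (poly_act s (lagrange (size w) j) f) (size w))//;
  last first.
  by move=> v hv; rewrite e_idemE hv jn.
rewrite e_idemE jn; apply/subr0_eq;
  rewrite -fctZE -fctNE -fctDE -(poly_act_factor sP) lagrange_factor//.
by rewrite poly_actZ fctZE -shift_prodE (shift_prod_all hK) scaler0.
Qed.

(** In length [n] the operator [s] is annihilated by the product over [2^0, ...,
    2^n], so that [2^j] with [j > n] is not an eigenvalue there. *)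
Lemma eigen_vanish j g w : s g = lambda j *: g -> (size w < j)%N -> g w = 0.
Proof.
move=> sg wj; have := shift_prod_all hK deg g w.
rewrite shift_prodE (poly_act_eigen sP _ sg) fctZE horner_prod => h.
have c0 : \prod_(r <- iota 0 (size w).+1) ('X - (lambda r)%:P).[lambda j] != 0.
  rewrite prodf_seq_neq0; apply/allP => r;
    rewrite mem_iota add0n ltnS => /andP[_ rw] /=.
  rewrite hornerXsubC subr_eq0 (inj_eq lambda_inj); apply/eqP => jr.
  by move: wj; rewrite jr ltnNge rw.
by rewrite -[LHS](scalerK c0) h scaler0.
Qed.

(** On an eigenvector a polynomial acts by its value, and interpolation
    polynomials take the values [0] and [1]. *)
Lemma e_idem_of_eigen i j g : s g = lambda j *: g -> e i g = if i == j then g else 0.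
Proof.
move=> sg; apply/funext => w.
have -> : (if i == j then g else 0) w = (i == j)%:R *: g w.
  by case: eqP => _; rewrite ?scale1r ?scale0r.
rewrite e_idemE; have [iw|iw] := leqP i (size w).
  have [jw|jw] := leqP j (size w).
    by rewrite (poly_act_eigen sP _ sg) fctZE lagrange_eval.
  by rewrite (poly_act_eigen sP _ sg) fctZE (eigen_vanish sg jw) !scaler0.
by case: eqP => [ij|_]; rewrite ?scale0r// (eigen_vanish sg) ?scaler0// -ij.
Qed.

(** For [j = 0] the interpolation polynomial is a multiple of the product over
    the nodes [2, ..., 2^n], which already annihilates [s] in positive length. *)
Lemma e_idem0 f w : (0 < size w)%N -> e 0 f w = 0.
Proof.
move=> w0; rewrite e_idemE /lagrange poly_actZ fctZE -[X in poly_act _ X]big_filter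
  -shift_prodE.
rewrite /index_iota subn0 [X in shift_prod _ X](_ : _ = iota 1 (size w)).
  by rewrite (shift_prod_positive hK) ?scaler0.
by rewrite /=; apply/all_filterP/allP => r; rewrite mem_iota; case: r.
Qed.

(** The operator [1 (x) s]; contraction by the first letter turns statements on
    [W (x) T] into statements on [T]. *)
Definition shuffle1 f : seq X -> K := fun w => if w is x :: u then s (cut x f) u else 0.
Local Notation s1 := shuffle1.

Lemma et_idemE j f w : et_idem deg j f w = if w is x :: u then e j (cut x f) u else 0.
Proof.
pose H f : seq X -> K := fun w => if w is x :: u then e j (cut x f) u else 0.
have [eD eZ _] := local_linear_e_idem j.
have hH : local_linear H.
  split=> [a b|c a|[|x u]].
  - by apply/funext => -[|x u]; rewrite /H fctDE ?addr0// -fctDE -eD.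
  - by apply/funext => -[|x u]; rewrite /H /scale ?mulr0// -[c * _]/(scale c _ u) -eZ.
  - by exists [::].
  - have [_ _ /(_ u)[L hL]] := local_linear_e_idem j; exists (map (cons x) L) => a h0.
    by apply: hL => v vL; apply: h0; apply: map_f.
suff -> : et_idem deg j = H by [].
apply: cext_local_linearE => // -[|x u].
  apply/funext => -[|y v]; rewrite /H // cut_elt_nil.
  by rewrite (local_linear0 (local_linear_e_idem j)).
apply/funext => -[|y v]; first by rewrite mul_letter_nil.
by rewrite mul_letter /H cut_elt eZ.
Qed.

Lemma local_linear_shuffle1 : local_linear s1.
Proof.
have [eD eZ _] := sP.
split=> [a b|c a|[|x u]].
- by apply/funext => -[|x u]; rewrite /s1 fctDE ?addr0// -fctDE -eD.
- by apply/funext => -[|x u]; rewrite /s1 /scale ?mulr0// -[c * _]/(scale c _ u) -eZ.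
- by exists [::].
- have [_ _ /(_ u)[L hL]] := sP; exists (map (cons x) L) => a h0.
  by apply: hL => v vL; apply: h0; apply: map_f.
Qed.

Lemma local_linear_et_idem j : local_linear (et_idem deg j : (seq X -> K) -> _).
Proof.
have [eD eZ _] := local_linear_e_idem j.
split=> [a b|c a|[|x u]].
- by apply/funext => -[|x u]; rewrite fctDE !et_idemE ?addr0// -fctDE -eD.
- by apply/funext => -[|x u];
  rewrite /scale !et_idemE ?mulr0// -[c * _]/(scale c _ u) -eZ.
- by exists [::] => f _; rewrite et_idemE.
- have [_ _ /(_ u)[L hL]] := local_linear_e_idem j; exists (map (cons x) L) => a h0.
  by rewrite et_idemE; apply: hL => v vL; apply: h0; apply: map_f.
Qed.

Lemma hom_cut n x f : homT n f -> homT (n - deg x) (cut x f).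
Proof. by move=> hf w; rewrite /cut -addrA -opprD -wdeg_cons. Qed.

Lemma hom_of_cut n f : f [::] = 0 -> (forall x, homT (n - deg x) (cut x f)) -> homT n f.
Proof.
move=> f0 h [|x u]; first by rewrite f0; apply: gr0.
by rewrite wdeg_cons opprD addrA; apply: h.
Qed.

Lemma cut_shuffle1 x f : cut x (s1 f) = s (cut x f). Proof. by []. Qed.
Lemma cut_et_idem j x f : cut x (et_idem deg j f) = e j (cut x f).
Proof. by apply/funext => u; rewrite {1}/cut et_idemE. Qed.
Lemma cut_ext f g : f [::] = g [::] -> (forall x, cut x f = cut x g) -> f = g.
Proof. by move=> h0 h; apply/funext => -[//|x u];
  have := congr1 (fun k => k u) (h x). Qed.

Lemma shuffle1_hom n f : homT n f -> homT n (s1 f).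
Proof. by move=> hf; apply: hom_of_cut => // x; apply: shuffle_hom => //;
  apply: hom_cut. Qed.
Lemma et_idem_hom j n f : homT n f -> homT n (et_idem deg j f).
Proof.
move=> hf; apply: hom_of_cut => [|x]; first by rewrite et_idemE.
by rewrite cut_et_idem; apply: e_idem_hom; apply: hom_cut.
Qed.

Lemma et_idem_eigen j f : s1 (et_idem deg j f) = lambda j *: et_idem deg j f.
Proof.
apply: cut_ext => [|x]; first by rewrite fctZE et_idemE scaler0.
by rewrite cut_shuffle1 cut_et_idem e_idem_eigen -cut_et_idem.
Qed.

Lemma et_idem_of_eigen i j g : g [::] = 0 -> s1 g = lambda j *: g ->
  et_idem deg i g = if i == j then g else 0.
Proof.
move=> g0 sg; apply: cut_ext => [|x]; first by rewrite et_idemE; case: eqP.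
rewrite cut_et_idem (@e_idem_of_eigen _ j); last by rewrite -cut_shuffle1 sg.
by case: eqP.
Qed.

Lemma et_idem_sum f w : f [::] = 0 -> f w = \sum_(0 <= j < size w) et_idem deg j f w.
Proof.
case: w => [->|x u _]; first by rewrite big_nil.
by rewrite -[LHS]/(cut x f u) e_idem_sum; apply: eq_bigr => j _; rewrite et_idemE.
Qed.

Lemma et_idem_ge j f w : (size w <= j)%N -> et_idem deg j f w = 0.
Proof. by rewrite et_idemE; case: w => // x u; apply: e_idem_gt. Qed.
End Idempotents.

(** * Splitting a complex into eigenspaces *)

Section ProTopology.
Context (K : comAlgType rat).

Lemma cvg_prodP (I : eqType) (U : topologicalType) (F : set_system (I -> U)) (f : I ->
    U) :
  Filter F -> (forall i (V : set U), nbhs (f i) V -> F [set g | V (g i)]) ->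
  F --> (f : prod_topology (fun _ : I => U)).
Proof.
move=> FF h; apply/cvg_sup => i A [B [[V oV <-] Vf] /filterS]; apply.
by apply: h; apply: open_nbhs_nbhs; split.
Qed.

Lemma proj_nbhs (I : eqType) (U : topologicalType) (f : prod_topology (fun _ : I =>
    U)) i (V : set U) :
  nbhs (f i) V -> nbhs f [set g | V (g i)].
Proof. exact: (@proj_continuous I (fun=> U) i f V). Qed.

Lemma pro_nbhs (S : choiceType) (f : pro K S) (L : seq S) :
  nbhs f [set g : pro K S | forall s, s \in L -> g s = f s].
Proof.
elim: L => [|s L IH]; first by apply: filterS filterT => g _ s.
have h : nbhs f [set g : pro K S | g s = f s].
  by apply: (proj_nbhs (V := [set f s])); apply: discrete_set1.
by apply: filterS (filterI h IH) => g [h1 h2] t; rewrite inE => /orP[/eqP->|/h2].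
Qed.

(** The finite coordinate conditions generate a filter that converges to [f]
    coordinatewise, hence in the product topology. *)
Lemma nbhs_pro (S : choiceType) (f : pro K S) (A : set (pro K S)) : nbhs f A ->
  exists L : seq S, forall g, (forall s, s \in L -> g s = f s) -> A g.
Proof.
pose F : set_system (S -> K) := [set A | exists L : seq S, forall g, (forall s,
  s \in L -> g s = f s) -> A g].
have FF : Filter F.
  split; first by exists [::].
    move=> B1 B2 [L1 h1] [L2 h2]; exists (L1 ++ L2) => g hg; split;
      [apply: h1|apply: h2] => s sL;
    by apply: hg; rewrite mem_cat sL ?orbT.
  by move=> B1 B2 B12 [L h]; exists L => g /h /B12.
suff h : F --> f by move=> /h.
apply: (@cvg_prodP S (discrete_topology K) F f FF) => s V /nbhs_singleton Vf.
by exists [:: s] => g /(_ s); rewrite inE eqxx => /(_ isT) /= ->.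
Qed.

(** As [K] is discrete, continuity means that each coordinate of the value is
    locally determined by finitely many coordinates of the argument. *)
Lemma continuous_on_proP (S T : choiceType) (A : set (S -> K)) (F : (S -> K) -> (T ->
    K)) :
  @continuous_on (pro K S) (pro K T) A F <->
  forall f t, A f -> exists L : seq S, forall g, A g -> (forall s, s \in L ->
    g s = f s) -> F g t = F f t.
Proof.
rewrite /continuous_on; split=> [/(@subspace_continuousP (pro K S) A (pro K T)) h f t
  Af|h].
  have /(h f Af) : nbhs (F f : pro K T) [set g : pro K T | g t = F f t].
    have := @pro_nbhs T (F f) [:: t]; apply: filterS => g; apply; by rewrite inE.
  by move=> /nbhs_pro[L hL]; exists L => g Ag gf; apply: (hL g gf).
apply: (proj2 (@subspace_continuousP (pro K S) A (pro K T) F)) => f Af.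
apply: (@cvg_prodP T (discrete_topology K)) => t V /nbhs_singleton Vf;
  have [L hL] := h f t Af.
by apply: filterS (@pro_nbhs S f L) => g gf Ag /=; rewrite hL.
Qed.
End ProTopology.

Section Splitting.
Context (K : comAlgType rat) (gr : int ->
  set K) (hK : even_grading gr) (X : choiceType).
Local Notation V := (seq X -> K).
Context (C : int -> set V) (d sg : V -> V) (ee : nat -> V -> V) (lam : nat -> rat).
Hypotheses (hd : cochain_complex gr C d) (sgP : local_linear sg) (eeP : forall j,
  local_linear (ee j))
  (Cpt : forall n f, (forall w, exists2 g, C n g & f w = g w) -> C n f)
  (sgd : forall n f, C n f -> sg (d f) = d (sg f))
  (eeC : forall n j f, C n f -> C n (ee j f))
  (sg_ee : forall n j f, C n f -> sg (ee j f) = lam j *: ee j f)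
  (ee_eigen : forall n i j g, C n g -> sg g = lam j *: g ->
    ee i g = if i == j then g else 0)
  (ee_sum : forall n f w, C n f -> f w = \sum_(0 <= j < size w) ee j f w)
  (ee_ge : forall j f w, (size w <= j)%N -> ee j f w = 0).

(** The image of a projector is the eigenspace it projects onto. *)
Lemma gimage_eigen j n g : gimage (ee j) C n g <-> C n g /\ sg g = lam j *: g.
Proof.
split=> [[f Cf <-]|[Cg sgg]]; first by split; [apply: eeC|apply: sg_ee Cf].
by exists g => //; rewrite (ee_eigen j Cg sgg) eqxx.
Qed.

Lemma subcomplex_eigen j : cochain_complex gr (gimage (ee j) C) d.
Proof.
have [[C0 CB CZ] [dD dZ] dC dd] := hd.
split.
- split=> [n|n f g /gimage_eigen[Cf ef] /gimage_eigen[Cg eg]|p n c f hc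
  /gimage_eigen[Cf ef]];
    apply/gimage_eigen; split.
  + exact: C0.
  + by rewrite (local_linear0 sgP) scaler0.
  + exact: CB.
  + by rewrite (local_linearB _ _ sgP) ef eg scalerBr.
  + exact: CZ.
  + by case: sgP => _ -> _; rewrite ef scaleZ.
- split=> [n f g /gimage_eigen[Cf _] /gimage_eigen[Cg _]|p n c f hc /gimage_eigen[Cf
  _]].
  + exact: dD Cf Cg.
  + exact: dZ hc Cf.
- move=> n f /gimage_eigen[Cf ef]; apply/gimage_eigen; split; first exact: dC.
  by rewrite (sgd Cf) ef !scale_rat (dZ 0 n)//; apply: gr_rat.
- by move=> n f /gimage_eigen[Cf _]; apply: dd Cf.
Qed.

(** Here [ee j] are projectors onto eigenspaces of an operator [sg] that
    commutes with the differential [d].  The differential preserves their images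
    because it commutes with [sg], and the sums [x_0 + x_1 + ...] are finite at
    each word. *)
Lemma splitting : splits_as_product gr C d (fun j => gimage (ee j) C).
Proof.
have [[C0 CB _] _ _ _] := hd.
have CD n f g : C n f -> C n g -> C n (f + g).
  by move=> hf hg; rewrite -[g]opprK -[- g]add0r; apply: (CB n) => //; apply: (CB n).
have Csum n (I : Type) (r : seq I) (F : I -> V) : (forall i, C n (F i)) ->
  C n (\sum_(i <- r) F i).
  by move=> h; apply: big_ind => // *; apply: CD.
split=> // [j|n]; first by split; [apply: subcomplex_eigen|move=> n f /gimage_eigen[]].
pose Phi (x : nat -> V) : V := fun w => \sum_(0 <= j < size w) x j w.
exists Phi; set E := [set x | _].
have EC x j : E x -> C n (x j) by move=> /(_ j) /gimage_eigen[].
have Ege x j w : E x -> (size w <= j)%N -> x j w = 0.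
  by move=> /(_ j)[f _ <-]; apply: ee_ge.
have PhiN x w N : E x -> (size w <= N)%N -> Phi x w = (\sum_(0 <= j < N) x j) w.
  move=> Ex wN; rewrite fct_sumE (@big_cat_nat _ _ _ (size w))//=.
  rewrite [X in _ + X]big_nat [X in _ + X]big1 ?addr0// => j /andP[wj _]; exact: Ege.
have PhiC x : E x -> C n (Phi x).
  move=> Ex; apply: Cpt => w; exists (\sum_(0 <= j < size w) x j); last exact: PhiN.
  by apply: Csum => j; apply: EC.
have eePhi x i : E x -> ee i (Phi x) = x i.
  move=> Ex; apply/funext => w; have [L uL [_ e]] := local_linearE w (eeP i).
  (* Beyond this index no [x j] contributes to the words on which [ee i]
      depends at [w], nor to the term [x i]. *)
  pose N := maxn i.+1 (\max_(v <- L) size v).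
  have -> : ee i (Phi x) w = ee i (\sum_(0 <= j < N) x j) w.
    rewrite !e; apply: eq_big_seq => v vL; rewrite (@PhiN _ _ N)//.
    by rewrite leq_max; apply/orP; right; apply: leq_bigmax_seq.
  rewrite (local_linear_sum _ _ (eeP i)) fct_sumE (bigD1_seq i) ?iota_uniq
    ?mem_index_iota ?leq_max ?ltnSn//=.
  have eex j : ee i (x j) = if i == j then x j else 0.
    by have /gimage_eigen[Cx ex] := Ex j; apply: ee_eigen Cx ex.
  rewrite eex eqxx big1 ?addr0// => j /negPf ji; by rewrite eex eq_sym ji.
have Eee f : C n f -> E (fun j => ee j f).
  by move=> Cf j; exists f.
have Phiee f : C n f -> Phi (fun j => ee j f) = f.
  by move=> Cf; apply/funext => w; rewrite /Phi -(ee_sum w Cf).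
have bijPhi : set_bij E (C n) Phi.
  split; first by move=> x; apply: PhiC.
    move=> x y /set_mem Ex /set_mem Ey xy; apply/funext => i.
    by rewrite -(eePhi x i Ex) xy eePhi.
  by move=> f Cf; exists (fun j => ee j f); [apply: Eee|apply: Phiee].
split=> //.
- move=> x Ex; apply: (@cvg_prodP (seq X) (discrete_topology K)) =>
  w A /nbhs_singleton Aw.
  by exists (size w) => // N /= wN; move: Aw; rewrite (PhiN x w N Ex wN).
- rewrite /continuous_on; apply: (proj2 (@subspace_continuousP (prod_topology (fun _ :
  nat => pro K (seq X))) E (pro K (seq X)) Phi)).
  move=> x Ex; apply: (@cvg_prodP (seq X) (discrete_topology K)) =>
    w A /nbhs_singleton Aw.
  have FN : Filter (nbhs (x : prod_topology (fun _ : nat => pro K (seq X)))).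
    exact: (@nbhs_filter (prod_topology (fun _ : nat => pro K (seq X))) x).
  have nb N : nbhs (x : prod_topology (fun _ : nat => pro K (seq X)))
      [set y : nat -> V | forall j, (j < N)%N -> y j w = x j w].
    elim: N => [|N IH]; first by apply: filterS filterT => y _ j.
    have h : nbhs (x : prod_topology (fun _ : nat => pro K (seq X))) [set y : nat ->
      V | y N w = x N w].
      apply: (@proj_nbhs nat (pro K (seq X)) x N [set g : V | g w = x N w]).
      by have := @pro_nbhs K (seq X) (x N) [:: w]; apply: filterS => g; apply;
        rewrite inE.
    apply: filterS (filterI h IH) => y [h1 h2] j;
      rewrite ltnS leq_eqVlt => /orP[/eqP->//|]; exact: h2.
  apply: filterS (nb (size w)) => y hy Ey /=; rewrite [Phi y w](_ : _ = Phi x w)//.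
  by apply: eq_big_nat => j /andP[_ /hy].
- rewrite /continuous_on; apply: (proj2 (@subspace_continuousP (pro K (seq X)) (C n)
  (prod_topology (fun _ : nat => pro K (seq X))) (pinv_ (fun=> 0) E Phi))).
  have pinvE f : C n f -> pinv_ (fun=> 0) E Phi f = fun j => ee j f.
    move=> Cf; rewrite -{1}(Phiee f Cf) pinvKV ?inE//; last exact: Eee.
    by case: bijPhi.
  move=> f Cf; apply: (@cvg_prodP nat (pro K (seq X))) => j A;
    rewrite (pinvE _ Cf) => /nbhs_pro[L hL].
  have [M hM] : exists M : seq (seq X), forall g, (forall v, v \in M -> g v = f v) ->
      forall w, w \in L -> ee j g w = ee j f w.
    elim: {hL} L => [|w L [M hM]]; first by exists [::].
    have [L1 uL1 [_ e]] := local_linearE w (eeP j); exists (L1 ++ M) => g hg v;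
      rewrite inE => /orP[/eqP->|].
      rewrite !e; apply: eq_big_seq => u uL; rewrite hg// mem_cat uL//.
    by apply: hM => u uM; apply: hg; rewrite mem_cat uM orbT.
  apply: filterS (@pro_nbhs K (seq X) f M) => g hg Cg /=; rewrite (pinvE _ Cg).
  by apply: hL; apply: hM.
Qed.
End Splitting.

(** * Lie derivations and the bar complex *)

Section LieDerivation.
Context (K : comAlgType rat) (gr : int -> set K) (hK : even_grading gr).
Context (X : choiceType) (deg : X -> int) (m : (seq X -> K) -> (seq X -> K)).
Hypothesis hm : square_zero_lie_derivation gr deg m.
Implicit Types (u v w : seq X).
Local Notation wd := (wdeg deg).
Local Notation homT := (hom gr wd).
Local Notation Lie := (Lie gr deg).

Lemma cspan_finite (S A : choiceType) (B : set (S -> K)) (r : seq A) (c : A ->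
    K) (l : A -> S -> K) :
  uniq r -> (forall a, B (l a)) -> cspan B (\sum_(a <- r) scale (c a) (l a)).
Proof.
move=> ur hl; exists A, (fun a => if a \in r then c a else 0), l; split=> // t.
  apply: (sub_finite_set (B := [set` r])) => // a /=; case: ifP => // _.
  by rewrite mul0r eqxx.
rewrite fct_sumE (fsbigE r)//; last by move=> a _ /negPf->; rewrite mul0r.
under [RHS]eq_bigl do rewrite in_setT.
by apply: eq_big_seq => a ar; rewrite ar.
Qed.

Lemma Lie_finite (A : choiceType) (r : seq A) (c : A -> K) (l : A -> seq X -> K) n :
  uniq r -> (forall a, exists2 p, lie_monomial gr deg p (l a) & gr (n - p) (c a)) ->
  Lie n (\sum_(a <- r) scale (c a) (l a)).
Proof.
move=> ur hl; split; last by apply: cspan_finite => // a; have [p hp _] := hl a;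
  exists p.
apply: hom_sum => // a; have [p hp hc] := hl a; rewrite -(subrK p n).
by apply: hom_scale => //; have [] := lie_monomialP hK hp.
Qed.

Lemma Lie_monomial n f : lie_monomial gr deg n f -> Lie n f.
Proof.
move=> hf; have := @Lie_finite unit [:: tt] (fun=> 1) (fun=> f) n isT.
rewrite big_seq1 scale1; apply => _; exists n => //; rewrite subrr; exact: gr_one hK.
Qed.

Lemma Lie_Wpart n f : Wpart gr deg n f -> Lie n f.
Proof. by move=> hf; apply: Lie_monomial; apply: lie_gen. Qed.

Definition lift_letters (g : X -> K) : seq X -> K :=
  fun w => if w is [:: x] then g x else 0.

Lemma local_linear_lift : local_linear (lift_letters).
Proof.
split=> [g g'|c g|[|x [|y w]]]; try by exists [::].
- by apply/funext => -[|x [|y w]]; rewrite fctDE /= ?addr0.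
- by apply/funext => -[|x [|y w]]; rewrite /scale /= ?mulr0.
- by exists [:: x] => g; apply; rewrite inE.
Qed.

Lemma lift_Wpart n (g : X -> K) : hom gr deg n g -> Wpart gr deg n (lift_letters g).
Proof.
move=> hg; split=> [[|x [|y w]]|[|x [|y w]]] //=; try exact: gr0.
by rewrite wdeg_seq1.
Qed.

Lemma cts_linear_lift n : cts_linear gr deg wd n n lift_letters.
Proof. by apply: local_linear_is_cts;
  [apply: local_linear_lift|move=> g /lift_Wpart[]]. Qed.

Lemma lift_elt c x : lift_letters (scale c (elt K x)) = scale c (elt K [:: x]).
Proof.
apply/funext => -[|y [|z w]]; rewrite /lift_letters /scale /elt ?mulr0//.
- by rewrite eqseq_cons andbT.
- by rewrite eqseq_cons andbF mulr0.
Qed.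

Lemma Lie_letter x : Lie (deg x) (elt K [:: x]).
Proof.
apply: Lie_Wpart; rewrite -[elt K _]scale1 -lift_elt; apply: lift_Wpart.
by rewrite scale1; apply: hom_elt.
Qed.

Lemma lift_cut n f : Wpart gr deg n f -> f = lift_letters (fun x => f [:: x]).
Proof. by case=> _ h; apply/funext => -[|x [|y w]] //=; apply: h. Qed.

Lemma m_zero : m 0 = 0.
Proof.
have L0 : Lie 0 0 by apply: Lie_Wpart; split=> [w|//]; apply: gr0.
have := (sld_linear hm).1 0 0 0 L0 L0; rewrite addr0 => h.
by apply: (addrI (m 0)); rewrite addr0 -h.
Qed.

Lemma m_letters_cts_linear n : cts_linear gr deg wd n (n + 1) (fun g : X ->
    K => m (lift_letters g)).
Proof.
have hL f : hom gr deg n f -> Lie n (lift_letters f) by move=> hf; apply: Lie_Wpart;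
  apply: lift_Wpart.
split=> [f hf|f g hf hg|t].
- by apply: (@Lie_hom _ _ _ deg); apply: sld_deg hm _ _ _; apply: hL.
- have -> : lift_letters (f + g) = lift_letters f + lift_letters g.
    by apply/funext => -[|x [|y w]]; rewrite fctDE /= ?addr0.
  exact: (sld_linear hm).1 (hL _ hf) (hL _ hg).
- have L0 : Lie n 0 by apply: Lie_Wpart; split=> [w|//]; apply: gr0.
  have [L h] := (continuous_on_proP _ _).1 (@sld_continuous _ _ _ _ _ hm n) 0 t L0.
  exists (pmap (fun w => if w is [:: x] then Some x else None) L) => f hf f0.
  rewrite (h _ (hL _ hf)) ?m_zero// => -[|x [|y w]] //= xL; apply: f0.
  by rewrite mem_pmap; apply/mapP; exists [:: x].
Qed.

Local Notation phi := (fun x => m (elt K [:: x])).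

(** If infinitely many letters contributed to one coordinate, the corresponding
    multiples of letters would tend to [0] in the Lie algebra while their images
    under [m] would not. *)
Lemma lie_vector_field : vector_field gr deg 1 phi.
Proof.
have e c x : m (lift_letters (scale c (elt K x))) =
  m (scale c (elt K [:: x])) by rewrite lift_elt.
split=> [x|n].
  apply: (@Lie_hom _ _ _ deg); apply: sld_deg hm _ _ _; apply: Lie_letter.
move=> t; have [_ _ /(_ t)[L hL]] := m_letters_cts_linear n; exists L => x c xL hc.
have Lx := Lie_letter x.
have := hL (scale c (elt K x)) (hom_scale_elt hK hc);
  rewrite e ((sld_linear hm).2 _ _ _ _ hc Lx).
by apply=> y yL; rewrite /scale /elt; case: eqP yL xL => [->->|]; rewrite ?mulr0.
Qed.
Let phiP := lie_vector_field.

Local Notation D := (assoc_ext deg m).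

(** A homogeneous combination of letters is a convergent sum of multiples of
    letters, and [m] is continuous on the Lie algebra. *)
Lemma der_letters n f : Wpart gr deg n f -> D f = m f.
Proof.
move=> hf; rewrite (lift_cut hf).
have hg : hom gr deg n (fun x => f [:: x]).
  by move=> x; rewrite -(wdeg_seq1 deg x); apply: (hf.1).
have h1 : cts_linear gr deg wd n (n + 1) (fun g => D (lift_letters g)).
  exact: (cts_linear_comp hK (der_cts_linear hK phiP n) (cts_linear_lift n)).
apply: (cts_linear_eq hK h1 (m_letters_cts_linear n) (Q := fun=> True)) => // x c _ hc.
rewrite lift_elt /assoc_ext der_scale_elt der_letter.
have Lx := Lie_letter x.
by rewrite ((sld_linear hm).2 _ _ _ _ hc Lx).
Qed.

Lemma der_lie_monomial p f : lie_monomial gr deg p f -> D f = m f.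
Proof.
elim=> [n g|p' q g h lg IHg lh IHh]; first exact: der_letters.
have [hg _ _] := lie_monomialP hK lg; have [hh _ _] := lie_monomialP hK lh.
rewrite (sld_leibniz hm (Lie_monomial lg) (Lie_monomial lh)) -IHg -IHh.
rewrite /assoc_ext {1}/gcomm (der_sub hK phiP (hom_mul hK hg hh)); last first.
  by apply: homZ => //; rewrite addrC; apply: hom_mul.
rewrite (der_rat phiP _ (hom_mul hK hh hg)) (der_mul hK phiP hg hh) (der_mul hK phiP
  hh hg).
rewrite /gcomm !scalerBr !scalerDr !scalerA.
have -> : koszul (p' * q) * koszul (1 * q) = koszul ((p' + 1) * q) by rewrite mulrDl;
  koszul_sign.
have -> : koszul p' * koszul (p' * (q + 1)) = koszul (p' * q) by rewrite mulrDr;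
  koszul_sign.
rewrite mul1r; apply/funext => w; rewrite !(fctDE, fctNE); ring.
Qed.

(** The coefficients of a convergent combination need not be homogeneous,
    whereas [m] is only linear over homogeneous scalars; the components of the
    coefficients in the relevant degrees give a combination with the same sum.
    A finite part of it suffices by continuity. *)
Lemma der_Lie n f : Lie n f -> D f = m f.
Proof.
move=> Lf; have [hf [A [c [l [hl hfin e]]]]] := Lf; apply/funext => t.
have [L1 h1] := (continuous_on_proP _ _).1 (@sld_continuous _ _ _ _ _ hm n) f t Lf.
have [L2 h2] := cts_linearE hK t (der_cts_linear hK phiP n).
have [A0 uA hA] : exists2 A0 : seq A, uniq A0 &
    forall a s, a \notin A0 -> s \in L1 ++ undup L2 -> c a * l a s = 0.
  pose E := \bigcup_(s in [set` L1 ++ undup L2]) [set a | c a * l a s != 0].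
  have /finite_seqP[r Er] : finite_set E by apply: bigcup_finite.
  exists (undup r); first exact: undup_uniq.
  move=> a s ar sL; apply/eqP/negPn/negP => h; move: ar; rewrite mem_undup => /negP;
    apply.
  by have : E a; [exists s|rewrite Er].
have [p hp] := choice hl.
(* Outside the finite set A0 the terms do not contribute to the coordinates
    that determine the values of both maps at t. *)
pose g := \sum_(a <- A0) scale (gpart hK (n - p a) (c a)) (l a).
have hterm a : exists2 q, lie_monomial gr deg q (l a) & gr (n - q) (gpart hK (n - p a)
  (c a)).
  by exists (p a) => //; apply: gr_gpart.
have Lg : Lie n g by apply: Lie_finite.
have fg s : s \in L1 ++ undup L2 -> g s = f s.
  move=> sL; rewrite -(gpart_id hK (hf s)) e (fsbigE A0)//; last first.
    by move=> a _ /hA ->.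
  under [X in gpart _ _ X]eq_bigl do rewrite in_setT.
  rewrite gpart_sum /g fct_sumE; apply: eq_bigr => a _.
  have [hla _ _] := lie_monomialP hK (hp a).
  rewrite (gpartM hK _ _ (hla s)) /scale; congr (gpart _ _ _ * _).
  by rewrite opprB addrA subrK.
rewrite -(h1 g Lg); last by move=> s sL; apply: fg; rewrite mem_cat sL.
have Dg : D g = m g.
  rewrite /g; have mD := (sld_linear hm).1; have mZ := (sld_linear hm).2.
  have lm a : homT n (scale (gpart hK (n - p a) (c a)) (l a)).
    by have := (Lie_finite (r := [:: a]) isT hterm).1; rewrite big_seq1.
  rewrite /assoc_ext (cts_linear_sum hK _ (der_cts_linear hK phiP n) lm).
  have: uniq A0 by []; elim: (A0) => [|a r IH] /=; first by rewrite !big_nil m_zero.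
  move=> /andP[ar ur]; rewrite !big_cons (mD n).
  - rewrite IH//; congr (_ + _); have [hla _ _] := lie_monomialP hK (hp a).
    rewrite (der_scale phiP _ hla) -/(assoc_ext deg m).
    by rewrite (mZ _ _ _ _ (gr_gpart hK _ _) (Lie_monomial (hp a))) -(der_lie_monomial
      (hp a)).
  - by have := Lie_finite (r := [:: a]) isT hterm; rewrite big_seq1.
  - exact: Lie_finite.
rewrite -Dg /assoc_ext !(h2 (undup L2))// ?undup_uniq//; try by [move=> s;
  rewrite mem_undup|case: Lg].
by apply: eq_big_seq => s sL; rewrite fg// mem_cat sL orbT.
Qed.

(** The square of the odd derivation is half of its graded commutator with
    itself, and it vanishes on letters because [m^2 = 0] on the Lie algebra. *)
Lemma assoc_ext_square n f : homT n f -> D (D f) = 0.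
Proof.
move=> hf; have h := odd_der_anticommute hK phiP phiP.
have gen x : der deg 1 phi (phi x) + der deg 1 phi (phi x) = 0.
  have Lx := Lie_letter x.
  by rewrite -/(D _) (der_Lie (sld_deg hm Lx)) (sld_square hm Lx) addr0.
have := h gen n f hf; rewrite -mulr2n -scaler_nat => e.
by rewrite -[LHS](@scalerK _ _ 2%:R)// /assoc_ext e scaler0.
Qed.

Lemma assoc_ext_hom n f : homT n f -> homT (n + 1) (D f).
Proof. exact: der_hom. Qed.

Lemma assoc_ext_shuffle n f : homT n f -> shuffle deg (D f) = D (shuffle deg f).
Proof.
apply: (der_shuffle hK phiP) => x; apply: (Lie_primitive hK); apply: sld_deg hm _ _ _;
  apply: Lie_letter.
Qed.

Lemma assoc_ext_nil f : D f [::] = 0.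
Proof.
apply: fsbig1 => -[|x u] _; first by rewrite mulr0.
have Lx := Lie_letter x.
by rewrite /= fctDE fctZE mul_letter_nil mul_nil (Lie_nil hK (sld_deg hm Lx)) mul0r
  scaler0 addr0 mulr0.
Qed.

Lemma P_submodule : graded_submodule gr (P gr deg).
Proof.
split=> [n|n f g [hf f0] [hg g0]|p n c f hc [hf f0]].
- by split => //; apply: hom0.
- by split; [apply: homB|rewrite fctDE fctNE f0 g0 subrr].
- by split; [apply: hom_scale|rewrite /scale f0 mulr0].
Qed.

Lemma Sigma_submodule (C : int -> set (seq X -> K)) :
  graded_submodule gr C -> graded_submodule gr (Sigma C).
Proof.
by move=> [h1 h2 h3]; split=> [n|n f g|p n c f hc hf]; rewrite /Sigma -?addrA;
  [apply: h1|apply: h2|apply: h3].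
Qed.

Lemma bar_complex : cochain_complex gr (Sigma (P gr deg)) D.
Proof.
split.
- exact/Sigma_submodule/P_submodule.
- split=> [n f g [hf _] [hg _]|p n c f hc [hf _]].
  + exact: (der_add hK phiP hf hg).
  + exact: (der_scale phiP _ hf).
- by move=> n f [hf _]; split; [apply: assoc_ext_hom|apply: assoc_ext_nil].
- by move=> n f [hf _]; apply: assoc_ext_square hf.
Qed.

Lemma P_pointwise n f : (forall w, exists2 g, P gr deg n g & f w = g w) -> P gr deg n f.
Proof.
move=> h; split=> [w|]; first by have [g [hg _] ->] := h w; apply: hg.
by have [g [_ g0] ->] := h [::].
Qed.

Theorem bar_splitting : splits_as_product gr (Sigma (P gr deg)) D
  (fun j => Sigma (gimage (e_idem deg j.+1) (P gr deg))).
Proof.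
apply: (@splitting _ _ hK _ (Sigma (P gr deg)) D (shuffle deg) (fun j =>
  e_idem deg j.+1) (fun j => lambda j.+1)).
- exact: bar_complex.
- exact: local_linear_shuffle.
- move=> j; exact: local_linear_e_idem.
- move=> n f; exact: P_pointwise.
- by move=> n f [hf _]; apply: assoc_ext_shuffle hf.
- by move=> n j f [hf f0]; split; [apply: e_idem_hom|rewrite e_idem_gt].
- by move=> n j f _; apply: (e_idem_eigen hK).
- by move=> n i j g _ /(e_idem_of_eigen hK i.+1); apply.
- move=> n f w [_ f0]; have [->|w0] := eqVneq w [::]; first by rewrite f0 big_nil.
  have w1 : (0 < size w)%N by case: (w) w0.
  by rewrite (e_idem_sum deg f w) big_nat_recl// (e_idem0 hK)// add0r.
- by move=> j f w; rewrite -ltnS; apply: e_idem_gt.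
Qed.
End LieDerivation.

(** * Rotations of words and traces *)

Section OddSquare.
Context (K : comAlgType rat) (gr : int -> set K) (hK : even_grading gr).
Context (X : choiceType) (deg : X -> int).

Lemma odd_der_square phi : vector_field gr deg 1 phi ->
  (forall x, der deg 1 phi (phi x) = 0) ->
  forall n f, hom gr (wdeg deg) n f -> der deg 1 phi (der deg 1 phi f) = 0.
Proof.
move=> hphi gen n f hf.
have := odd_der_anticommute hK hphi hphi _ hf; rewrite -mulr2n -scaler_nat => e.
by rewrite -[LHS](@scalerK _ _ 2%:R)// e ?scaler0// => x; rewrite gen addr0.
Qed.

(** This is the tameness of [der_word] for the trivial grading, in which all
    elements of [K] are homogeneous of all degrees. *)
Lemma der_local_linear e (phi : X -> seq X -> K) :
  (forall t, exists L : seq X, forall x, x \notin L -> phi x t = 0) ->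
    local_linear (der deg e phi).
Proof.
move=> h; apply: cext_local_linear => t.
have ht n : tame (fun=> setT) deg n phi.
  by move=> u; have [L hL] := h u; exists L => x c /hL-> _; rewrite mulr0.
have [//|L hL] := @der_word_tame K (fun=> setT) X deg e phi _ 0 t.
by exists L => w wL; have := hL w 1 wL I; rewrite mul1r.
Qed.
End OddSquare.

Section Trace.
Context (K : comAlgType rat) (gr : int -> set K) (hK : even_grading gr).
Context (Z : choiceType) (deg : Z -> int).
Local Notation wd := (wdeg deg).
Local Notation homT := (hom gr wd).

(** Evaluation at a cyclic word of the universal trace on the tensor algebra. *)
Definition rotation_sum (h : seq Z -> K) (z : seq Z) : K :=
  \sum_(k < size z) koszul (wd (take k z) * wd (drop k z)) *: h (rot k z).

Lemma rot_mod (z : seq Z) k l : (k < size z)%N -> (l <= size z)%N ->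
  rot ((k + l) %% size z) z = rot l (rot k z).
Proof.
move=> koszul_sign lz; rewrite rot_add_mod ?(ltnW koszul_sign)// addnC;
  case: ltngtP => h.
- by rewrite modn_small.
- rewrite -{1}(subnK (ltnW h)) modnDr modn_small// ltn_subLR ?(ltnW h)//.
  by rewrite -addnS addnC leq_add.
- by rewrite h modnn rot0 rot_size.
Qed.

(** The degree of the moved prefix is additive under composition of rotations,
    up to a full turn. *)
Lemma wdeg_take_rot (z : seq Z) k l : (k < size z)%N -> (l <= size z)%N ->
  wd (take ((k + l) %% size z) z) = wd (take k z) + wd (take l (rot k z)) \/
  wd (take ((k + l) %% size z) z) + wd z = wd (take k z) + wd (take l (rot k z)).
Proof.
move=> koszul_sign lz; have sd : size (drop k z) = (size z - k)%N by rewrite size_drop.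
have [kl|kl] := leqP (k + l) (size z).
  have -> : take l (rot k z) = take l (drop k z).
    by rewrite /rot takel_cat// sd leq_subRL// ltnW.
  rewrite -wdeg_cat -takeD; move: kl; rewrite leq_eqVlt => /orP[/eqP->|kl].
    by right; rewrite modnn take0 wdeg_nil add0r take_size.
  by left; rewrite modn_small.
have jk : (k + l - size z <= k)%N by rewrite leq_subLR addnC leq_add2r.
right; rewrite -{1}(subnK (ltnW kl)) modnDr modn_small;
  last exact: leq_ltn_trans jk koszul_sign.
have -> : take l (rot k z) = drop k z ++ take (k + l - size z) z.
  rewrite /rot take_cat sd ltnNge leq_subLR (ltnW kl)/=; congr (_ ++ _).
  by rewrite subnBA 1?ltnW// addnC take_takel.
by rewrite wdeg_cat [in LHS](wdeg_take_drop deg k z) addrC -addrA.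
Qed.

(** Modulo two [a (z - a) = a (z + 1)]: the sign of a rotation is a character of
    the degree of the prefix that is moved, so that composing rotations
    multiplies signs. *)
Lemma koszul_rot (z : seq Z) k : koszul (wd (take k z) * wd (drop k z)) =
    koszul (wd (take k z) * (wd z + 1)).
Proof. by rewrite [in RHS](wdeg_take_drop deg k z); koszul_sign. Qed.

(** A rotation of the cyclic word cut into [f]-part and [g]-part corresponds to
    the rotation that starts at the cut, with the parts exchanged. *)
Lemma rotation_sum_trace p q f g (z : seq Z) : homT p f -> homT q g ->
  rotation_sum (mul f g) z = koszul (p * q) *: rotation_sum (mul g f) z.
Proof.
move=> hf hg; rewrite /rotation_sum.
case: (posnP (size z)) => [z0|zpos].
  by rewrite !big1 ?scaler0// => -[k koszul_sign] _; exfalso; rewrite z0 in koszul_sign.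
pose T (f g : seq Z -> K) (k l : nat) := koszul (wd (take k z) * wd (drop k z)) *:
   (f (take l (rot k z)) * g (drop l (rot k z))).
have E a b : \sum_(k < size z) koszul (wd (take k z) * wd (drop k z)) *: mul a b (rot
  k z) =
   \sum_(c : 'I_(size z) * 'I_(size z).+1) T a b c.1 c.2.
  rewrite -(pair_bigA _ (fun (k : 'I_(size z)) (l : 'I_(size z).+1) => T a b k l))/=.
  by apply: eq_bigr => k _; rewrite /mul size_rot scaler_sumr.
rewrite !E scaler_sumr.
(* The pair (k, l) stands for the rotation by k cut after l letters. *)
pose h (c : 'I_(size z) * 'I_(size z).+1) : 'I_(size z) * 'I_(size z).+1 :=
  (Ordinal (ltn_pmod (c.1 + c.2) zpos), rev_ord c.2).
have hh : involutive h.
  move=> [[k koszul_sign] [l lz]]; have lz' : (l <= size z)%N by []; congr (_, _);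
    apply/val_inj => /=; rewrite subSS ?subKn//.
  by rewrite modnDml -addnA subnKC// modnDr modn_small.
rewrite [RHS](reindex_inj (inv_inj hh))/=;
  apply: eq_bigr => -[[k koszul_sign] [l lz]] _ /=.
have lz' : (l <= size z)%N by [];
  rewrite /T subSS rot_mod// koszul_rot [in RHS]koszul_rot.
set y := rot k z.
have sy : size y = size z by rewrite size_rot.
have -> : take (size z - l) (rot l y) = drop l y.
  by rewrite /rot take_size_cat// size_drop sy.
have -> : drop (size z - l) (rot l y) = take l y.
  by rewrite /rot drop_size_cat// size_drop sy.
rewrite scalerA [g _ * f _]mulrC.
have wy : wd y = wd z by rewrite /y /rot wdeg_cat addrC -wdeg_take_drop.
have -> : koszul (wd (take ((k + l) %% size z) z) * (wd z + 1)) =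
    koszul (wd (take k z) * (wd z + 1)) * koszul (wd (take l y) * wd (drop l y)).
  have := wdeg_take_rot koszul_sign lz'; rewrite -/y.
  have : podd (wd z) = podd (wd (take l y)) (+) podd (wd (drop l y)).
    by rewrite -wy (wdeg_take_drop deg l y) poddD.
  move=> e1 [e2|/(congr1 podd)]; rewrite !koszulE !poddE.
    by rewrite e2 !poddE e1; case: (podd (wd (take k z)));
      case: (podd (wd (take l y))); case: (podd (wd (drop l y))).
  rewrite e1 => e2.
  by move: e2; case: (podd (wd (take _ z))); case: (podd (wd (take k z)));
    case: (podd (wd (take l y))); case: (podd (wd (drop l y))).
rewrite mulrCA -scalerA; congr (_ *: _).
have hfy := koszul_hom hK (wd (drop l y)) (hf (take l y)).
have hgy := koszul_hom hK p (hg (drop l y)).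
rewrite -scalerA scalerAl -hfy -scalerAl [p * wd _]mulrC scalerAr -hgy -scalerAr
  scalerA.
by rewrite [q * p]mulrC koszul_sq scale1r.
Qed.
End Trace.

(** * Normal forms of one-forms *)

Section Forms.
Context (K : comAlgType rat) (gr : int -> set K) (hK : even_grading gr).
Context (X : choiceType) (deg : X -> int).
Local Notation od := (odeg deg).
Local Notation owd := (wdeg (odeg deg)).
Local Notation wd := (wdeg deg).
Local Notation homO := (hom gr owd).
Local Notation homT := (hom gr wd).
Local Notation inls := (map (@inl X X)).
Implicit Types (z : seq (X + X)) (u v w : seq X).

Lemma owd_inls w : owd (inls w) = wd w.
Proof. by elim: w => [|x w IH]; rewrite ?wdeg_nil// /= !wdeg_cons IH. Qed.

Definition strip_inl z : seq X := pmap (fun c => if c is inl x then Some x else None) z.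
Definition no_d z : bool := ~~ has (@is_d X) z.

Lemma strip_inl_inls w : strip_inl (inls w) = w. Proof. by elim: w => //= x w ->. Qed.
Lemma no_d_inls w : no_d (inls w). Proof. by elim: w. Qed.
Lemma inls_strip_inl z : no_d z -> inls (strip_inl z) = z.
Proof. by elim: z => [|[x|x] z IH] //= /IH /= ->. Qed.

Definition to_form_fun (f : seq X -> K) : seq (X + X) ->
    K := fun z => if no_d z then f (strip_inl z) else 0.

Lemma local_linear_to_form_fun : local_linear to_form_fun.
Proof.
split=> [f g|c f|z].
- by apply/funext => z; rewrite fctDE /to_form_fun; case: ifP; rewrite ?addr0.
- by apply/funext => z; rewrite /scale /to_form_fun; case: ifP; rewrite ?mulr0.
- by exists [:: strip_inl z] => f h; rewrite /to_form_fun h ?if_same// inE.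
Qed.

Lemma to_form_fun_elt w : to_form_fun (elt K w) = elt K (inls w).
Proof.
apply/funext => z; rewrite /to_form_fun /elt; case: ifP => [/inls_strip_inl e|/negP h].
  by rewrite -{2}e (inj_eq (inj_map (@inl_inj X X))).
by case: eqP => // e; exfalso; apply: h; rewrite -e; apply/negP; exact: no_d_inls.
Qed.

Lemma to_formE : @to_form K X = to_form_fun.
Proof. by apply: cext_local_linearE => [|w];
  [apply: local_linear_to_form_fun|rewrite to_form_fun_elt]. Qed.

Lemma local_linear_to_form : local_linear (@to_form K X).
Proof. by rewrite to_formE; apply: local_linear_to_form_fun. Qed.

Lemma to_form_elt w : to_form (elt K w) = elt K (inls w).
Proof. by rewrite to_formE to_form_fun_elt. Qed.

Lemma to_form_hom n f : homT n f -> homO n (to_form f).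
Proof.
rewrite to_formE => hf z; rewrite /to_form_fun; case: ifP => [/inls_strip_inl e|_];
  last exact: gr0.
by rewrite -e owd_inls strip_inl_inls.
Qed.

Lemma cts_linear_to_form n : cts_linear gr wd owd n n (@to_form K X).
Proof. by apply: local_linear_is_cts;
  [apply: local_linear_to_form|apply: to_form_hom]. Qed.

Lemma to_form_mul (f g : seq X -> K) : to_form (mul f g) = mul (to_form f) (to_form g).
Proof.
have tf := local_linear_to_form.
have h1 (g' : seq X -> K) : local_linear (fun f => to_form (mul f g')).
  exact: (local_linear_comp tf (local_linear_mulr g')).
have h2 (g' : seq X -> K) : local_linear (fun f => mul (to_form f) (to_form g')).
  exact: (local_linear_comp (local_linear_mulr (to_form g')) tf).
apply: (local_linear_eq (h1 g) (h2 g)) => u.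
have h3 : local_linear (fun g => to_form (mul (elt K u) g)).
  exact: (local_linear_comp tf (local_linear_mull _)).
have h4 : local_linear (fun g => mul (to_form (elt K u)) (to_form g)).
  exact: (local_linear_comp (local_linear_mull _) tf).
apply: (local_linear_eq h3 h4) => v.
by rewrite mul_elt !to_form_elt mul_elt map_cat.
Qed.

(** The representative [dx . u] of a one-form modulo graded commutators: one
    rotates [dx] to the front. *)
Definition normal_form (h : seq (X + X) -> K) : seq X -> K :=
  fun w => if w is x :: u then rotation_sum od h (inr x :: inls u) else 0.

Lemma local_linear_rotation_sum z : exists L : seq (seq (X + X)),
    forall h : seq (X + X) -> K,
  (forall s, s \in L -> h s = 0) -> rotation_sum od h z = 0.
Proof.
exists [seq rot k z | k <- iota 0 (size z)] => h hL;
  rewrite /rotation_sum big1// => k _.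
rewrite hL ?scaler0//; apply/mapP; exists (nat_of_ord k) => //.
by rewrite mem_iota ltn_ord.
Qed.

Lemma local_linear_normal_form : local_linear normal_form.
Proof.
split=> [f g|c f|[|x u]].
- apply/funext => -[|x u]; rewrite fctDE /= ?addr0// /rotation_sum -big_split/=.
  by apply: eq_bigr => k _; rewrite fctDE scalerDr.
- apply/funext => -[|x u]; rewrite /scale /= ?mulr0// /rotation_sum mulr_sumr.
  by apply: eq_bigr => k _; rewrite scalerAr.
- by exists [::].
- exact: local_linear_rotation_sum.
Qed.

Lemma normal_form_hom n h : homO (n + 1) h -> homT n (normal_form h).
Proof.
move=> hh [|x u]; first exact: gr0.
apply: (gr_sum hK) => k _; apply: (grZ hK); have := hh (rot k (inr x :: inls u)).
rewrite /rot wdeg_cat [owd (drop _ _) + _]addrC -wdeg_take_drop !wdeg_cons owd_inls /=.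
by congr gr; ring.
Qed.

Lemma normal_form_trace p q f g : homO p f -> homO q g ->
  normal_form (mul f g) = koszul (p * q) *: normal_form (mul g f).
Proof.
move=> hf hg; apply/funext => -[|x u]; first by rewrite fctZE /= scaler0.
by rewrite fctZE /= (rotation_sum_trace hK _ hf hg).
Qed.

Lemma normal_form_gcomm p q f g : homO p f -> homO q g ->
    normal_form (gcomm p q f g) = 0.
Proof.
move=> hf hg; rewrite /gcomm (local_linearB _ _ local_linear_normal_form)
  (local_linearZ _ _ local_linear_normal_form).
by rewrite (normal_form_trace hf hg) subrr.
Qed.

(** The normal form is a trace, and it is local, so it also kills convergent
    combinations of commutators. *)
Lemma normal_form_commutators n h : commutators gr od n h -> normal_form h = 0.
Proof.
case=> _; apply: local_linear_kills_cspan; first exact: local_linear_normal_form.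
by move=> _ [p [q [f [g [hf hg ->]]]]]; apply: normal_form_gcomm.
Qed.

Definition Theta_fun (f : seq X -> K) : seq (X + X) -> K :=
  fun z => if z is inr x :: z' then to_form (cut x f) z' else 0.

Lemma local_linear_Theta_fun : local_linear Theta_fun.
Proof.
have [tD tZ tL] := local_linear_to_form.
split=> [f g|c f|[|[x|x] z]]; try by exists [::].
- by apply/funext => -[|[x|x] z]; rewrite fctDE /= ?addr0// -fctDE -tD.
- by apply/funext => -[|[x|x] z]; rewrite /scale /= ?mulr0// -[c * _]/(scale c _ z) -tZ.
- have [L hL] := tL z; exists (map (cons x) L) => f f0; apply: hL => w wL.
  by apply: f0; apply: map_f.
Qed.

Lemma ThetaE : @Theta K X = Theta_fun.
Proof.
apply: cext_local_linearE => [|[|x u]]; first exact: local_linear_Theta_fun.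
  apply/funext => -[|[x|x] z] //=;
    by rewrite cut_elt_nil (local_linear0 local_linear_to_form).
apply/funext => -[|[y|y] z] //=; rewrite cut_elt.
have [_ tZ _] := local_linear_to_form; rewrite tZ to_form_elt /scale /elt eqseq_cons.
by rewrite -natrM mulnb.
Qed.

Lemma local_linear_Theta : local_linear (@Theta K X).
Proof. by rewrite ThetaE; apply: local_linear_Theta_fun. Qed.

Lemma Theta_mul x (g : seq X -> K) : Theta (mul (elt K [:: x]) g) =
    mul (elt K [:: inr x]) (to_form g).
Proof.
rewrite ThetaE; apply/funext => -[|[y|y] z]; rewrite ?mul_letter_nil// mul_letter //=.
- by rewrite mul0r.
- rewrite cut_mul_letters => [|w]; last exact: elt_letter_off.
  have [_ -> _] := local_linear_to_form; rewrite /scale /elt eqseq_cons andbT.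
  by rewrite (_ : (inr x == inr y :> X + X) = (x == y)).
Qed.

Lemma Theta_elt x u : Theta (elt K (x :: u)) = elt K (inr x :: inls u).
Proof. by rewrite elt_cons Theta_mul to_form_elt mul_elt. Qed.

Lemma Theta_hom n f : homT n f -> homO (n + 1) (Theta f).
Proof.
rewrite ThetaE => hf [|[x|x] z]; try exact: gr0.
rewrite wdeg_cons opprD addrACA /= opprD addrACA addrA.
have := to_form_hom (hom_cut x hf) z; rewrite /Theta_fun.
by congr gr; ring.
Qed.

(** Among the rotations of [dx . u] only the trivial one starts with [dx]. *)
Lemma normal_form_Theta f : f [::] = 0 -> normal_form (Theta f) = f.
Proof.
move=> f0; apply/funext => -[|x u]; first by rewrite f0.
rewrite /normal_form /rotation_sum big_ord_recl big1 ?addr0.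
  by rewrite take0 drop0 wdeg_nil mul0r koszul0 scale1r rot0 ThetaE /= to_formE
    /to_form_fun no_d_inls strip_inl_inls.
move=> k _; rewrite ThetaE /rot /= [X in Theta_fun _ X](_ : _ =
  inls (drop k u) ++ inr x :: take k (inls u)).
  case: (drop k u) (size_drop k u) => [|y v] //=; last by rewrite scaler0.
  by move=> /esym/eqP; rewrite subn_eq0 leqNgt -[size u](size_map (@inl X X)) ltn_ord.
by rewrite map_drop.
Qed.
End Forms.

(** * Adjoint actions *)

Section Adjoint.
Context (K : comAlgType rat) (gr : int -> set K) (hK : even_grading gr).
Context (X : choiceType) (deg : X -> int).
Local Notation wd := (wdeg deg).
Local Notation homT := (hom gr wd).
Local Notation s := (@shuffle K X deg).

(** The adjoint action of a Lie element is a derivation with Lie values on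
    generators. *)
Lemma shuffle_ad p l n g : lie_monomial gr deg p l -> homT n g ->
  s (gcomm p n l g) = gcomm p n l (s g).
Proof.
move=> hl; have [lh lp _] := lie_monomialP hK hl.
pose phi x := gcomm p (deg x) l (elt K [:: x]).
have phiP : vector_field gr deg p phi.
  split=> [x|k t]; first by rewrite addrC; apply: hom_gcomm => //; apply: hom_letter.
  exists t => x c xt _; rewrite /phi /gcomm fctDE fctNE fctZE /mul !big1 ?scaler0
    ?subrr ?mulr0//.
    move=> i _; rewrite /elt; case: eqP => [e|_]; last by rewrite mul0r.
    have : x \in take i t ++ drop i t by rewrite -e mem_cat inE eqxx.
    by rewrite cat_take_drop (negPf xt).
  move=> i _; rewrite /elt; case: eqP => [e|_]; last by rewrite mulr0.
  have : x \in take i t ++ drop i t by rewrite -e mem_cat inE eqxx orbT.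
  by rewrite cat_take_drop (negPf xt).
have phi_prim x : primitive deg (phi x).
  apply: (primitive_gcomm hK lh (hom_letter hK deg x) lp).
  by apply: primitive_letters => w; apply: elt_letter_off.
have ad_word w : der_word deg p phi w = gcomm p (wd w) l (elt K w).
  elim: w => [|x w IH] /=.
    by rewrite /gcomm wdeg_nil mulr0 koszul0 scale1r mulr_elt_nil mul_elt_nil subrr.
  rewrite IH /phi /gcomm mulBl mulBr mulZl mulZr scalerBr scalerA [elt K (x ::
    w)]elt_cons !mulA wdeg_cons.
  rewrite addrA subrK; congr (_ - _ *: _); rewrite mulrDr; by koszul_sign.
have ad k f : homT k f -> der deg p phi f = gcomm p k l f.
  move=> hf.
  have h2 : cts_linear gr wd wd k (k + p) (gcomm p k l).
    apply: cts_linearD => //; first by rewrite addrC; apply: cts_linear_mull.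
    by apply: cts_linear_opp => //; apply: cts_linearZ => //; apply: cts_linear_mulr.
  apply: (cts_linear_eq hK (der_cts_linear hK phiP k) h2 (Q := fun=> True)) =>
    // w c _ hc.
  rewrite der_scale_elt der_elt ad_word /gcomm mul_scaler mul_scalel scaleB scaleZ;
    congr (_ - _).
  by apply/funext => t; rewrite !fctZE /scale !scalerAl [p * k]mulrC [p * wd w]mulrC
    (koszul_hom hK _ hc).
move=> hg; rewrite -(ad n g hg) -(ad n (s g) (shuffle_hom hK hg)).
exact: (der_shuffle hK phiP phi_prim hg).
Qed.
End Adjoint.

(** * The Lie derivative on one-forms *)

Section Hochschild.
Context (K : comAlgType rat) (gr : int -> set K) (hK : even_grading gr).
Context (X : choiceType) (deg : X -> int) (m : (seq X -> K) -> (seq X -> K)).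
Hypothesis hm : square_zero_lie_derivation gr deg m.
Local Notation od := (odeg deg).
Local Notation owd := (wdeg (odeg deg)).
Local Notation wd := (wdeg deg).
Local Notation homO := (hom gr owd).
Local Notation homT := (hom gr wd).
Local Notation inls := (map (@inl X X)).
Local Notation s := (@shuffle K X deg).
Local Notation s1 := (@shuffle1 K X deg).
Local Notation D := (assoc_ext deg m).
Local Notation N := (@normal_form K X deg).
Local Notation Th := (@Theta K X).
Local Notation tf := (@to_form K X).
Implicit Types (u v w : seq X).

Definition d_gen : X + X -> seq (X + X) ->
    K := fun z => if z is inl x then elt K [:: inr x] else 0.
Local Notation d := (@dform K X deg).

Lemma d_gen_local t : exists L : seq (X + X), forall z, z \notin L -> d_gen z t = 0.
Proof.
exists (if t is [:: inr x] then [:: inl x] else [::]) => -[x|x] //=.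
rewrite /elt; case: eqP => // <-; by rewrite inE eqxx.
Qed.

Lemma d_genP : vector_field gr od 1 d_gen.
Proof.
split=> [[x|x]|n t]; [|exact: hom0|].
  by rewrite -[od _ + 1]/(od (inr x)); apply: hom_letter.
by have [L hL] := d_gen_local t; exists L => z c /hL-> _; rewrite mulr0.
Qed.

Lemma local_linear_d : local_linear d.
Proof. exact: (@der_local_linear K _ od 1 d_gen d_gen_local). Qed.

Lemma d_square n f : homO n f -> d (d f) = 0.
Proof.
apply: (odd_der_square hK d_genP) => -[x|x] /=; first by rewrite der_letter.
exact: (cts_linear0 hK (der_cts_linear hK d_genP 0)).
Qed.

Lemma d_hom n f : homO n f -> homO (n + 1) (d f). Proof. exact: (der_hom hK d_genP).
    Qed.

Definition L_gen : X + X -> seq (X + X) -> K := fun z =>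
  match z with
  | inl x => tf (D (elt K [:: x]))
  | inr x => koszul 1 *: d (tf (D (elt K [:: x])))
  end.
Local Notation L := (@L_m K X deg m).
Let phiP := lie_vector_field hK hm.

Lemma D_letter x : D (elt K [:: x]) = m (elt K [:: x]).
Proof. by rewrite /assoc_ext der_letter. Qed.

Lemma D_letter_hom x : homT (deg x + 1) (D (elt K [:: x])).
Proof. by apply: (der_hom hK phiP); apply: hom_letter. Qed.

Lemma L_genP : vector_field gr od 1 L_gen.
Proof.
have c1 n : cts_linear gr deg owd n (n + 1) (fun g => tf (D (lift_letters g))).
  exact: (cts_linear_comp hK (cts_linear_to_form hK deg _) (cts_linear_comp hK
    (der_cts_linear hK phiP n) (cts_linear_lift hK deg n))).
have c2 n : cts_linear gr deg owd n (n + 1 + 1) (fun g =>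
  koszul 1 *: d (tf (D (lift_letters g)))).
  by apply: cts_linearZ => //;
    apply: (cts_linear_comp hK (der_cts_linear hK d_genP _) (c1 n)).
have [_ tZ _] := local_linear_to_form K X; have [_ dZ _] := local_linear_d.
have lE x : lift_letters (elt K x) =
  elt K [:: x] by rewrite -[elt K x]scale1 lift_elt scale1.
have t1 n := cts_linear_tame hK (c1 n); have t2 n := cts_linear_tame hK (c2 n).
split=> [[x|x]|n t].
- by apply: to_form_hom => //; apply: D_letter_hom.
- by apply: homZ => //; apply: d_hom; apply: to_form_hom => //; apply: D_letter_hom.
have [|L1 h1] := t1 n _ t.
  by move=> x c; rewrite lift_elt lE /assoc_ext der_scale_elt tZ.
have [|L2 h2] := t2 (n - 1) _ t.
  by move=> x c; rewrite lift_elt lE /assoc_ext der_scale_elt tZ dZ scaleZ.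
exists (map inl L1 ++ map inr L2) => -[x|x] c;
  rewrite mem_cat negb_or => /andP[n1 n2] hc.
  rewrite /L_gen -lE; apply: h1 => //; apply: contra n1; exact: map_f.
rewrite /L_gen -lE; apply: h2; first by apply: contra n2; apply: map_f.
by move: hc; rewrite /= opprD addrA addrAC.
Qed.

Lemma LE : L = der od 1 L_gen. Proof. by []. Qed.

Lemma L_hom n f : homO n f -> homO (n + 1) (L f). Proof. exact: (der_hom hK L_genP).
    Qed.

Lemma L_to_form n f : homT n f -> L (tf f) = tf (D f).
Proof.
move=> hf.
have h1 : cts_linear gr wd owd n (n + 1) (fun f =>
  L (tf f)) := cts_linear_comp hK (der_cts_linear hK L_genP n) (cts_linear_to_form hK
  deg n).
have h2 : cts_linear gr wd owd n (n + 1) (fun f =>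
  tf (D f)) := cts_linear_comp hK (cts_linear_to_form hK deg _) (der_cts_linear hK
  phiP n).
apply: (cts_linear_eq hK h1 h2 (Q := fun=> True)) => // w c _ _.
have [tD tZ _] := local_linear_to_form K X.
rewrite /assoc_ext der_scale_elt !tZ to_form_elt LE der_scale_elt -to_form_elt;
  congr scale.
elim: w => [|x w IH]; first by rewrite to_form_elt !der_elt /= (local_linear0
  (local_linear_to_form K X)).
have hx := hom_letter hK deg x; have hw := hom_elt hK wd w.
rewrite elt_cons to_form_mul (der_mul hK L_genP (to_form_hom hK hx) (to_form_hom hK
  hw)).
rewrite (der_mul hK phiP hx hw) tD (local_linearZ _ _ (local_linear_to_form K X))
  !to_form_mul IH.
by rewrite !to_form_elt der_letter /L_gen /assoc_ext.
Qed.

(** Both [d] and [L] are odd derivations, so it suffices to look at [x] and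
    [dx]. *)
Lemma d_L n f : homO n f -> d (L f) + L (d f) = 0.
Proof.
apply: (odd_der_anticommute hK d_genP L_genP) => -[x|x].
  rewrite [d_gen _]/(elt K [:: inr x]) der_letter /L_gen -/(d _).
  by rewrite (_ : koszul 1 = -1)// scaleN1r subrr.
rewrite [d_gen _]/0 (cts_linear0 hK (der_cts_linear hK L_genP 0)) addr0 /L_gen -/(d _).
have hx := to_form_hom hK (D_letter_hom x).
by rewrite (local_linearZ _ _ local_linear_d) (d_square hx) scaler0.
Qed.

Lemma L_square n f : homO n f -> L (L f) = 0.
Proof.
apply: (odd_der_square hK L_genP) => z; rewrite -LE.
have gen x : L (tf (D (elt K [:: x]))) = 0.
  rewrite (L_to_form (D_letter_hom x)) (assoc_ext_square hK hm (hom_letter hK deg x)).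
  exact: (local_linear0 (local_linear_to_form K X)).
case: z => x; first exact: gen.
have hx := to_form_hom hK (D_letter_hom x).
rewrite [L_gen _]/(koszul 1 *: d (tf (D (elt K [:: x])))) LE (der_rat L_genP _ (d_hom
  hx)) -LE.
have := d_L hx; rewrite gen (local_linear0 local_linear_d) add0r => ->; exact: scaler0.
Qed.

(** Forms homogeneous of degree [j] for the number of differentials. *)
Definition dcount (j : nat) (f : seq (X + X) -> K) : Prop :=
  forall t, count (@is_d X) t != j -> f t = 0.

Lemma dcount_mul i j f g : dcount i f -> dcount j g -> dcount (i + j) (mul f g).
Proof.
move=> hf hg t ht; rewrite /mul big1// => k _.
have [e|ne] := eqVneq (count (@is_d X) (take k t)) i; last by rewrite hf// mul0r.
rewrite hg ?mulr0//; apply: contra ht => /eqP e'.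
by rewrite -(cat_take_drop k t) count_cat e e'.
Qed.

Lemma dcount_elt z : dcount (count (@is_d X) z) (elt K z).
Proof. by move=> t; rewrite /elt; case: (z =P t) => // ->; rewrite eqxx. Qed.

Lemma dcount_der e (phi : X + X -> seq (X + X) ->
    K) i j n f : vector_field gr od e phi ->
  (forall z, dcount (is_d z + i) (phi z)) -> homO n f -> dcount j f ->
  dcount (j + i) (der od e phi f).
Proof.
move=> phiP' hphi hf hj t ht.
have hw (w : seq (X + X)) : dcount (count (@is_d X) w + i) (der_word od e phi w).
  elim: w => [//|z w IH] t' ht'; rewrite /= fctDE fctZE.
  rewrite (dcount_mul (hphi z) (@dcount_elt w)); last by rewrite addnAC.
  have hz : dcount (is_d z) (elt K [:: z]).
    by have := dcount_elt (z := [:: z]); rewrite /= addn0.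
  by rewrite (dcount_mul hz IH) ?scaler0 ?addr0// addnA.
have [L0 uL /(_ f hf)[_ E]] := tameE t (der_word_tame phiP' n).
rewrite /der E big1// => w _; have [e0|ne] := eqVneq (count (@is_d X) w) j.
  by rewrite hw ?mulr0// e0.
by rewrite hj// mul0r.
Qed.

Lemma dcount_to_form f : dcount 0 (tf f).
Proof.
move=> t ht; rewrite to_formE /to_form_fun /no_d ifF//.
by apply/negbTE; rewrite negbK has_count lt0n.
Qed.

Lemma dcount_L j n f : homO n f -> dcount j f -> dcount j (L f).
Proof.
move=> hf hj; rewrite -[j]addn0; apply: (dcount_der L_genP _ hf hj) => -[x|x].
  exact: dcount_to_form.
rewrite addn0 => t ht; rewrite -[L_gen _]/(koszul 1 *: der od 1 d_gen (tf (D (elt K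
  [:: x])))) fctZE.
rewrite (@dcount_der 1 d_gen 1 0 (deg x + 1) _ d_genP) ?scaler0//.
- move=> [y|y] //=; exact: (dcount_elt (z := [:: inr y])).
- by apply: to_form_hom => //; apply: D_letter_hom.
- exact: dcount_to_form.
Qed.

Lemma Omega1_L n h : Omega1 gr deg n h -> Omega1 gr deg (n + 1) (L h).
Proof. by move=> [hh h1]; split; [apply: L_hom|apply: (dcount_L hh)]. Qed.

Lemma count1P z : count (@is_d X) z = 1%N ->
    exists u x v, z = inls u ++ inr x :: inls v.
Proof.
have h0 z' : count (@is_d X) z' = 0%N -> z' = inls (strip_inl z').
  by move=> e; rewrite inls_strip_inl// /no_d has_count e.
elim: z => [//|[x|x] z IH] /=; first by rewrite add0n => /IH[u [y [v ->]]];
  exists (x :: u), y, v.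
by rewrite add1n => -[/h0 e]; exists [::], x, (strip_inl z); rewrite /= -e.
Qed.

Lemma Theta_Omega1 n f : P gr deg n f -> Omega1 gr deg (n + 1) (Th f).
Proof.
move=> [hf _]; split; first exact: Theta_hom.
rewrite ThetaE => -[|[x|x] z] //= hz; rewrite to_formE /to_form_fun /no_d ifF//.
by apply/negbTE; rewrite negbK has_count lt0n; apply: contra hz => /eqP->.
Qed.

Lemma normal_form_P n h : homO (n + 1) h -> P gr deg n (N h).
Proof. by move=> hh; split; [apply: normal_form_hom|]. Qed.

Lemma Theta_normal_form_elt u x v (z := inls u ++ inr x :: inls v) :
  elt K z - Th (N (elt K z)) =
  gcomm (wd u) (owd (inr x :: inls v)) (elt K (inls u)) (elt K (inr x :: inls v)).
Proof.
have hu : homO (wd u) (elt K (inls u)) by rewrite -(owd_inls deg); apply: hom_elt.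
have hv : homO (owd (inr x :: inls v)) (elt K (inr x :: inls v)) by apply: hom_elt.
rewrite /z -mul_elt (normal_form_trace hK hu hv) (local_linearZ _ _
  (local_linear_Theta K X)).
rewrite [mul (elt K (inr x :: _)) _]mul_elt cat_cons -map_cat -(Theta_elt K x (v ++
  u)) normal_form_Theta// Theta_elt.
by rewrite /gcomm !mul_elt map_cat.
Qed.

(** On a word [a . dx . b] the difference is the commutator of [a] and [dx . b];
    the general case is a convergent combination of these. *)
Lemma sub_Theta_normal_form n h : Omega1 gr deg (n + 1) h ->
    commutators gr od (n + 1) (h - Th (N h)).
Proof.
move=> [hh h1]; split.
  by apply: homB => //; apply: Theta_hom => //; apply: normal_form_hom.
pose F (h : seq (X + X) -> K) := h - Th (N h).
have FP : local_linear F.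
  apply: local_linear_sub; first exact: local_linear_id.
  exact: (local_linear_comp (local_linear_Theta K X) (local_linear_normal_form _ _)).
apply: (local_linear_cspan FP) => [z hz|].
  have [|u [x [v e]]] := @count1P z.
    by apply/eqP/negPn/negP => /h1; apply: hz.
  rewrite /F e Theta_normal_form_elt; do 4 eexists; split; last by [].
    by rewrite -(owd_inls deg); apply: hom_elt.
  exact: hom_elt.
exists 0, 0, 0, 0; split; try exact: hom0.
by rewrite /gcomm mulf0 scaler0 subrr.
Qed.

Lemma normal_form_L_trace p q f g : homO p f -> homO q g ->
  N (L (mul f g)) = koszul (p * q) *: N (L (mul g f)).
Proof.
move=> hf hg; have [ND _ _] := local_linear_normal_form K deg;
  have NZ := local_linearZ _ _ (local_linear_normal_form K deg).
rewrite !LE (der_mul hK L_genP hf hg) (der_mul hK L_genP hg hf) -!LE !ND !NZ.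
have hLf := L_hom hf; have hLg := L_hom hg.
rewrite (normal_form_trace hK hLf hg) (normal_form_trace hK hf hLg) scalerDr !scalerA
  addrC; congr (_ *: _ + _ *: _).
- by rewrite mulrDr; koszul_sign.
- by rewrite mulrDl !mul1r; koszul_sign.
Qed.

(** The Lie derivative of a commutator is a sum of commutators, so the normal
    form of [L h] depends on [h] only through its class. *)
Lemma normal_form_L_mod_commutators n h : Omega1 gr deg n h ->
    N (L h) = N (L (Th (N h))).
Proof.
move=> [hh h1].
have NC k : cts_linear gr owd wd k (k - 1) N.
  apply: local_linear_is_cts; first exact: local_linear_normal_form.
  by move=> f; rewrite -{1}(subrK 1 k); apply: normal_form_hom.
have TC k : cts_linear gr wd owd k (k + 1) Th.
  by apply: local_linear_is_cts; [apply: local_linear_Theta|apply: Theta_hom].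
have c1 : cts_linear gr owd wd n n (fun h => N (L h)).
  by have := cts_linear_comp hK (NC _) (der_cts_linear hK L_genP n); rewrite addrK.
have c2 : cts_linear gr owd wd n n (fun h => N (L (Th (N h)))).
  have := cts_linear_comp hK (NC _) (cts_linear_comp hK (der_cts_linear hK L_genP _)
    (cts_linear_comp hK (TC _) (NC n))).
  by rewrite subrK addrK.
apply: (cts_linear_eq hK c1 c2 (Q := fun z => count (@is_d X) z = 1%N)) => //;
  last first.
  by move=> z hz; apply/eqP/negPn/negP => /h1; apply: hz.
move=> z c /count1P[u [x [v e]]] _.
have [_ NZ _] := local_linear_normal_form K deg;
  have [_ TZ _] := local_linear_Theta K X.
have hu : homO (wd u) (elt K (inls u)) by rewrite -(owd_inls deg); apply: hom_elt.
have hv : homO (owd (inr x :: inls v)) (elt K (inr x :: inls v)) by apply: hom_elt.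
have e2 : Th (N (elt K z)) = koszul (wd u * owd (inr x :: inls v)) *:
    mul (elt K (inr x :: inls v)) (elt K (inls u)).
  by have := Theta_normal_form_elt u x v;
    rewrite -e /gcomm mul_elt -e => /addrI/oppr_inj.
rewrite NZ TZ !LE der_scale_elt (der_scale L_genP _ (n := wd u + owd (inr x :: inls
  v))); last first.
  by rewrite e2 addrC; apply: homZ => //; apply: hom_mul.
rewrite !NZ e2; congr scale;
  rewrite (der_rat L_genP _ (hom_mul hK hv hu)) -!LE (local_linearZ _ _
  (local_linear_normal_form K deg)).
by rewrite e -mul_elt (normal_form_L_trace hu hv).
Qed.
End Hochschild.

(** * The Hochschild complex *)

Section HochschildSplitting.
Context (K : comAlgType rat) (gr : int -> set K) (hK : even_grading gr).
Context (X : choiceType) (deg : X -> int) (m : (seq X -> K) -> (seq X -> K)).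
Hypothesis hm : square_zero_lie_derivation gr deg m.
Local Notation od := (odeg deg).
Local Notation owd := (wdeg (odeg deg)).
Local Notation wd := (wdeg deg).
Local Notation homO := (hom gr owd).
Local Notation homT := (hom gr wd).
Local Notation inls := (map (@inl X X)).
Local Notation s := (@shuffle K X deg).
Local Notation s1 := (@shuffle1 K X deg).
Local Notation D := (assoc_ext deg m).
Local Notation N := (@normal_form K X deg).
Local Notation Th := (@Theta K X).
Local Notation tf := (@to_form K X).
Local Notation d := (@dform K X deg).
Local Notation L := (@L_m K X deg m).
Implicit Types (u v w : seq X).
Let phiP := lie_vector_field hK hm.
Let lP := L_genP hK hm.

(** The class of [d l . g] modulo commutators, as an element of [W (x) T]. *)
Definition dmul_class (l g : seq X -> K) : seq X -> K := N (mul (d (tf l)) (tf g)).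

Lemma normal_form_letter x g : N (mul (elt K [:: inr x]) (tf g)) = mul (elt K [:: x]) g.
Proof. by rewrite -Theta_mul normal_form_Theta// mul_letter_nil. Qed.

Lemma local_linear_dmul_class g : local_linear (fun l => dmul_class l g).
Proof.
apply: (local_linear_comp (local_linear_normal_form K deg));
  apply: (local_linear_comp (local_linear_mulr (tf g))).
exact: (local_linear_comp (local_linear_d K deg) (local_linear_to_form K X)).
Qed.

Lemma dmul_class_letters n l g : Wpart gr deg n l -> dmul_class l g = mul l g.
Proof.
move=> hl; rewrite (lift_cut hl).
have h1 : local_linear (fun h : X ->
  K => dmul_class (lift_letters h) g) := local_linear_comp (local_linear_dmul_class g)
  (local_linear_lift K X).
have h2 : local_linear (fun h : X ->
  K => mul (lift_letters h) g) := local_linear_comp (local_linear_mulr g)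
  (local_linear_lift K X).
apply: (local_linear_eq h1 h2) => x.
rewrite -[elt K x]scale1 lift_elt scale1 /dmul_class to_form_elt -normal_form_letter;
  congr (N (mul _ _)).
exact: (@der_letter K _ od 1 (@d_gen K X) (inl x)).
Qed.

Lemma shuffle1_letters n l g : Wpart gr deg n l -> s1 (mul l g) = mul l (s g).
Proof.
move=> [_ hl]; apply: cut_ext => [|x]; first by rewrite mul_nil hl// mul0r.
rewrite cut_shuffle1 !cut_mul_letters//.
by have [_ -> _] := local_linear_shuffle K deg.
Qed.

(** By the Leibniz rule [d [f1, f2] . g] is a sum of [d f1 . [f2, g]] and [d f2
    . [f1, g]] modulo commutators. *)
Lemma dmul_class_gcomm p q n f1 f2 g : homT p f1 -> homT q f2 -> homT n g ->
  dmul_class (gcomm p q f1 f2) g =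
  dmul_class f1 (gcomm q n f2 g) - koszul (p * q) *: dmul_class f2 (gcomm p n f1 g).
Proof.
move=> h1 h2 hg; rewrite /dmul_class.
have tB := local_linearB _ _ (local_linear_to_form K X);
  have tZ := local_linearZ _ _ (local_linear_to_form K X).
have H1 := to_form_hom hK h1; have H2 := to_form_hom hK h2;
  have HG := to_form_hom hK hg.
rewrite {1 2 3}/gcomm !tB !tZ !to_form_mul (local_linearB _ _ (local_linear_d K deg))
  (local_linearZ _ _ (local_linear_d K deg)).
have dM a b F G : homO a F -> homO b G ->
  d (mul F G) = mul (d F) G + koszul (1 * a) *: mul F (d G).
  exact: (der_mul hK (d_genP hK deg)).
rewrite (dM _ _ _ _ H1 H2) (dM _ _ _ _ H2 H1) !mul1r.
have D1 := d_hom hK H1; have D2 := d_hom hK H2.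
have NB := local_linearB _ _ (local_linear_normal_form K deg);
  have NZ := local_linearZ _ _ (local_linear_normal_form K deg).
have [ND _ _] := local_linear_normal_form K deg.
rewrite !mulBl !mulBr !mulZl !mulZr !mulDl !mulZl !NB !NZ !ND !NZ.
rewrite -[mul (mul (tf f1) _) _]mulA (normal_form_trace hK H1 (hom_mul hK D2 HG)).
rewrite -[mul (mul (tf f2) _) _]mulA (normal_form_trace hK H2 (hom_mul hK D1 HG)).
rewrite -!mulA !scalerBr !scalerDr !scalerA.
have -> : koszul p * koszul (p * (q + 1 + n)) =
  koszul (p * q) * koszul (p * n) by rewrite !mulrDr; koszul_sign.
have -> : koszul (p * q) * koszul q * koszul (q * (p + 1 + n)) =
  koszul (q * n) by rewrite !mulrDr; koszul_sign.
by apply/funext => w; rewrite !(fctDE, fctNE); ring.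
Qed.

(** Induction on the Lie monomial: each bracket becomes an adjoint action on
    [g], which commutes with [s], until only letters are left. *)
Lemma dmul_class_shuffle p l : lie_monomial gr deg p l -> forall n g, homT n g ->
  s1 (dmul_class l g) = dmul_class l (s g).
Proof.
elim=> [k f hf n g hg|p' q f1 f2 l1 IH1 l2 IH2 n g hg].
  by rewrite !(dmul_class_letters _ hf) (shuffle1_letters _ hf).
have [h1 _ _] := lie_monomialP hK l1; have [h2 _ _] := lie_monomialP hK l2.
rewrite (dmul_class_gcomm h1 h2 hg) (dmul_class_gcomm h1 h2 (shuffle_hom hK hg)).
rewrite (local_linearB _ _ (local_linear_shuffle1 _ _)) (local_linearZ _ _
  (local_linear_shuffle1 _ _)).
rewrite (IH1 _ _ (hom_gcomm hK h2 hg)) (IH2 _ _ (hom_gcomm hK h1 hg)).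
by rewrite (shuffle_ad hK l1 hg) (shuffle_ad hK l2 hg).
Qed.

Lemma dmul_class_Lie k l n g : Lie gr deg k l -> homT n g ->
    s1 (dmul_class l g) = dmul_class l (s g).
Proof.
move=> [_ hl] hg; apply/subr0_eq.
have h : local_linear (fun l => s1 (dmul_class l g) - dmul_class l (s g)).
  apply: local_linear_sub; last exact: local_linear_dmul_class.
  exact: (local_linear_comp (local_linear_shuffle1 _ _) (local_linear_dmul_class g)).
apply: (local_linear_kills_cspan h _ hl) => f [p hf].
by rewrite (dmul_class_shuffle hf hg) subrr.
Qed.

(** The Hochschild differential in normal form, on all of [W (x) T]. *)
Definition hoch f : seq X -> K := N (L (Th f)).

Lemma hoch_letter x q g : homT q g ->
  hoch (mul (elt K [:: x]) g) =
  koszul 1 *: dmul_class (D (elt K [:: x])) g + koszul (deg x + 1) *: mul (elt K [::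
    x]) (D g).
Proof.
move=> hg; rewrite /hoch Theta_mul.
have hx : homO (deg x + 1) (elt K [:: inr x]) by apply: (hom_letter hK od (inr x)).
rewrite LE (der_mul hK lP hx (to_form_hom hK hg)) der_letter -LE (L_to_form hK hm hg).
rewrite [L_gen _ _ _]/(koszul 1 *: d (tf (D (elt K [:: x])))) mulZl mul1r.
have [ND _ _] := local_linear_normal_form K deg;
  have NZ := local_linearZ _ _ (local_linear_normal_form K deg).
by rewrite ND !NZ normal_form_letter.
Qed.

Lemma hoch_hom n f : homT n f -> homT (n + 1) (hoch f).
Proof.
move=> hf; apply: normal_form_hom => //; apply: L_hom => //; exact: Theta_hom.
Qed.

Lemma hoch_cts_linear n : cts_linear gr wd wd n (n + 1) hoch.
Proof.
have c1 : cts_linear gr owd wd (n + 1 + 1) (n + 1) N.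
  by apply: local_linear_is_cts; [apply: local_linear_normal_form|move=> f;
    apply: normal_form_hom].
have c2 : cts_linear gr wd owd n (n + 1) Th.
  by apply: local_linear_is_cts; [apply: local_linear_Theta|move=> f; apply: Theta_hom].
exact: (cts_linear_comp hK c1 (cts_linear_comp hK (der_cts_linear hK lP (n + 1)) c2)).
Qed.

Lemma hoch_scale n c f : homT n f -> hoch (scale c f) = scale c (hoch f).
Proof.
move=> hf; have [_ NZ _] := local_linear_normal_form K deg;
  have [_ TZ _] := local_linear_Theta K X.
by rewrite /hoch TZ LE (der_scale lP _ (Theta_hom hK hf)) NZ.
Qed.

Lemma hoch_shuffle1 n f : P gr deg n f -> s1 (hoch f) = hoch (s1 f).
Proof.
move=> [hf f0].
have sC k : cts_linear gr wd wd k k s1.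
  by apply: local_linear_is_cts; [apply: local_linear_shuffle1|move=> g;
    apply: shuffle1_hom].
have c1 : cts_linear gr wd wd n (n + 1) (fun f =>
  s1 (hoch f)) := cts_linear_comp hK (sC _) (hoch_cts_linear n).
have c2 : cts_linear gr wd wd n (n + 1) (fun f =>
  hoch (s1 f)) := cts_linear_comp hK (hoch_cts_linear n) (sC n).
apply: (cts_linear_eq hK c1 c2 (Q := fun w => w <> [::])) => //;
  last by move=> w hw e; apply: hw; rewrite e.
case=> [|x u] c // _ _.
have [_ sZ _] := local_linear_shuffle1 K deg; have hxu := hom_elt hK wd (x :: u).
rewrite (hoch_scale _ hxu) !sZ (hoch_scale _ (shuffle1_hom hK hxu)); congr scale.
have hu := hom_elt hK wd u.
have hl : Wpart gr deg (deg x) (elt K [:: x]).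
  split; first exact: hom_letter.
  by move=> w; apply: elt_letter_off.
rewrite elt_cons (shuffle1_letters _ hl) (hoch_letter x hu) (hoch_letter x
  (shuffle_hom hK hu)).
have [sD _ _] := local_linear_shuffle1 K deg;
  have sZ' := local_linearZ _ _ (local_linear_shuffle1 K deg).
rewrite sD !sZ' (shuffle1_letters _ hl) (assoc_ext_shuffle hK hm hu).
by rewrite (D_letter deg m) (dmul_class_Lie (sld_deg hm (Lie_letter hK deg x)) hu).
Qed.

(** The element chosen by [Theta_inv] is unique because the normal form kills
    commutators and inverts [Theta]. *)
Lemma hoch_bE n f : P gr deg n f -> hoch_b gr deg m f = hoch f.
Proof.
move=> [hf f0]; rewrite /hoch_b /Theta_inv.
have O1 : Omega1 gr deg (n + 1 + 1) (L (Th f)).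
  by apply: (Omega1_L hK hm); apply: Theta_Omega1.
have ex : exists g, [set g | exists k,
  P gr deg k g /\ commutators gr od (k + 1) (L (Th f) - Th g)] g.
  exists (hoch f), (n + 1); split; last exact: sub_Theta_normal_form.
  by apply: normal_form_P => //; case: O1.
have [k [[_ g0] /(normal_form_commutators hK)]] := xgetPex 0 ex.
rewrite (local_linearB _ _ (local_linear_normal_form K deg)) (normal_form_Theta deg
  g0) => /subr0_eq.
by rewrite /hoch => ->.
Qed.

Lemma hoch_P n f : P gr deg n f -> P gr deg (n + 1) (hoch f).
Proof. by move=> [hf _]; split; [apply: hoch_hom|]. Qed.

(** Between the two Lie derivatives the normal form may be dropped, and [L]
    squares to zero. *)
Lemma hoch_square n f : P gr deg n f -> hoch (hoch f) = 0.
Proof.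
move=> hf; have O1 : Omega1 gr deg (n + 1 + 1) (L (Th f)).
  by apply: (Omega1_L hK hm); apply: Theta_Omega1.
rewrite /hoch -(normal_form_L_mod_commutators hK hm O1) (L_square hK hm (Theta_hom hK
  hf.1)).
exact: (local_linear0 (local_linear_normal_form K deg)).
Qed.

Theorem Theta_identifies : Theta_identifies_Hoch gr deg m.
Proof.
split.
- by move=> n f; apply: Theta_Omega1.
- by move=> n f [hf f0] /(normal_form_commutators hK); rewrite normal_form_Theta.
- move=> n h hO; exists (N h); last exact: sub_Theta_normal_form.
  by apply: normal_form_P => //; case: hO.
- move=> n h hO hc; have OL := Omega1_L hK hm hO; split=> //.
  have := sub_Theta_normal_form hK OL;
    rewrite (normal_form_L_mod_commutators hK hm hO) (normal_form_commutators hK hc).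
  have z1 := local_linear0 (local_linear_Theta K X);
    have z2 := local_linear0 (local_linear_normal_form K deg).
  by rewrite z1 LE (cts_linear0 hK (der_cts_linear hK lP 0)) z2 z1 subr0.
- move=> n f hf; rewrite (hoch_bE hf); apply: sub_Theta_normal_form => //.
  by apply: (Omega1_L hK hm); apply: Theta_Omega1.
Qed.

Lemma hoch_complex : cochain_complex gr (Sigma (P gr deg)) (hoch_b gr deg m).
Proof.
have PS := P_submodule hK deg; have [P0 PB PZ] := PS.
have PD n f g : P gr deg n f -> P gr deg n g -> P gr deg n (f + g).
  by move=> [hf f0] [hg g0]; split; [apply: homD|rewrite fctDE f0 g0 addr0].
split.
- exact: Sigma_submodule.
- split=> [n f g hf hg|p n c f hc hf].
  + rewrite (hoch_bE (PD _ _ _ hf hg)) (hoch_bE hf) (hoch_bE hg).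
    by have [_ hD _] := hoch_cts_linear (n + 1); apply: hD; [case: hf|case: hg].
  + by rewrite (hoch_bE (PZ _ _ _ _ hc hf)) (hoch_bE hf) (hoch_scale _ hf.1).
- by move=> n f hf; rewrite (hoch_bE hf); apply: hoch_P.
- by move=> n f hf; rewrite (hoch_bE hf) (hoch_bE (hoch_P hf)) (hoch_square hf).
Qed.

Theorem hochschild_splitting : splits_as_product gr (Sigma (P gr deg)) (hoch_b gr deg m)
  (fun j => Sigma (gimage (et_idem deg j) (P gr deg))).
Proof.
have s1P n f : P gr deg n f -> P gr deg n (s1 f).
  by move=> [hf _]; split; [apply: shuffle1_hom|].
apply: (@splitting _ _ hK _ (Sigma (P gr deg)) (hoch_b gr deg m) s1 (fun j =>
  et_idem deg j) lambda).
- exact: hoch_complex.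
- exact: local_linear_shuffle1.
- move=> j; exact: local_linear_et_idem.
- by move=> n f; apply: P_pointwise.
- by move=> n f hf; rewrite (hoch_bE hf) (hoch_bE (s1P _ _ hf)) (hoch_shuffle1 hf).
- by move=> n j f [hf f0]; split; [apply: et_idem_hom|rewrite et_idemE].
- by move=> n j f _; apply: (et_idem_eigen hK).
- by move=> n i j g [_ g0]; apply: (et_idem_of_eigen hK).
- by move=> n f w [_ f0]; apply: et_idem_sum.
- by move=> j f w; apply: et_idem_ge.
Qed.
End HochschildSplitting.

Theorem theorem7p11 (K : comAlgType rat) (gr : int -> set K)
    (hK : even_grading gr)
    (I : choiceType) (degV : I -> int)
    (m : (seq I -> K) -> (seq I -> K))
    (hm : C_infty_structure gr degV m) :
  let degW := dual_susp degV in
  splits_as_product gr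
    (Sigma (P gr degW)) (assoc_ext degW m)
    (fun j => Sigma (gimage (e_idem degW j.+1) (P gr degW)))
  /\
  (Theta_identifies_Hoch gr degW m /\
   splits_as_product gr
    (Sigma (P gr degW)) (hoch_b gr degW m)
    (fun j => Sigma (gimage (et_idem degW j) (P gr degW)))).
Proof.
split; first exact: bar_splitting.
by split; [apply: Theta_identifies|apply: hochschild_splitting].
Qed.
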